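(* Let $0<p,q<\infty$, $\alpha>-2$, and let $\{X_n\}_{n\ge0}$ be a standard random sequence, with associated randomization $\mathcal{R}$. Then $$(\mathcal{AT}_{q,\alpha}^{p})_\star=H\!\left(2,q,\tfrac{\alpha+2}{q}\right),$$ where $(\mathcal{AT}_{q,\alpha}^{p})_\star=\{f\in H(\mathbb{D}):\mathbb{P}(\mathcal{R}f\in\mathcal{AT}_{q,\alpha}^{p})=1\}$ is the symbol space of $\mathcal{AT}_{q,\alpha}^{p}$.
   Context: $\mathbb{D}$ is the open unit disk, $\mathbb{T}$ the unit circle, $|d\xi|$ Lebesgue (arc length) measure on $\mathbb{T}$, $dA$ Euclidean area measure on $\mathbb{D}$, and $H(\mathbb{D})$ the space of analytic functions on $\mathbb{D}$. For $\xi\in\mathbb{T}$ let $\Gamma(\xi)=\{z\in\mathbb{D}: |1-z\bar\xi|<1-|z|^2\}$. Analytic tent spaces: for $0<p,q<\infty$ and $\alpha>-2$, $\mathcal{AT}_{q,\alpha}^p$ is the space of all $f\in H(\mathbb{D})$ with $$\|f\|_{\mathcal{AT}_{q,\alpha}^p}^p=\int_{\mathbb{T}}\left(\int_{\Gamma(\xi)}|f(z)|^q(1-|z|^2)^\alpha\,dA(z)\right)^{p/q}|d\xi|<\infty .$$ Mixed norm spaces: for $0<p,q,\alpha<\infty$, $H(p,q,\alpha)$ is the space of all $f\in H(\mathbb{D})$ with $$\|f\|_{H(p,q,\alpha)}=\left(\int_0^1M_p(r,f)^q(1-r)^{\alpha q-1}\,dr\right)^{1/q}<\infty,\qquad M_p(r,f)=\left(\frac1{2\pi}\int_{\mathbb{T}}|f(r\xi)|^p|d\xi|\right)^{1/p}.$$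 Randomization: a standard random sequence $\{X_n\}_{n\ge0}$ is a sequence of independent identically distributed random variables which are either all Bernoulli ($\mathbb{P}(X=1)=\mathbb{P}(X=-1)=\frac12$), or all Steinhaus (uniformly distributed on the unit circle), or all Gaussian $N(0,1)$ (zero mean, unit variance). For $f(z)=\sum_{n\ge0}a_nz^n\in H(\mathbb{D})$, $(\mathcal{R}f)(z)=\sum_{n=0}^\infty X_na_nz^n$. *)

(* Defs.v *)
From HB Require Import structures.
From mathcomp Require Import all_boot all_order all_algebra.
From mathcomp Require Import all_classical all_reals all_analysis.
From mathcomp Require Import complex.

Set Implicit Arguments.
Unset Strict Implicit.
Unset Printing Implicit Defensive.

Import Order.TTheory GRing.Theory Num.Theory.
Import numFieldNormedType.Exports.

Local Open Scope classical_set_scope.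
Local Open Scope ring_scope.
Local Open Scope complex_scope.

(* The modulus as an element of R; the generic norm `|z| lives in R[i]. *)
Definition cmod (R : realType) (z : R[i]) : R := ComplexField.Normc.normc z.

(* The identifications of R[i] with the plane R * R, which carries the
   product Borel sigma-algebra and the product Lebesgue measure. *)
Definition cpair (R : realType) (z : R[i]) : R * R := (complex.Re z, complex.Im z).
Definition of_cpair (R : realType) (u : R * R) : R[i] := u.1 +i* u.2.

Definition expi (R : realType) (t : R) : R[i] := cos t +i* sin t.

Definition unit_disk (R : realType) : set R[i] := [set z | cmod z < 1].

(* The topology of R[i] is the one of its regular module R[i]^o. *)
Definition power_series_on (R : realType)
    (f : R[i] -> R[i]) (c : R[i]) (r : R) (a : nat -> R[i]) : Prop :=
  forall z, cmod (z - c) < r ->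
    (fun n => \sum_(k < n) a k * (z - c) ^+ k : R[i]^o) @ \oo --> (f z : R[i]^o).

(* H(D).  Functions are total on R[i]; this set, and all the spaces below,
   only constrain their values on the open unit disk. *)
Definition analytic_on_disk (R : realType) : set (R[i] -> R[i]) :=
  [set f | forall c, unit_disk c ->
    exists r a, 0 < r /\ power_series_on f c r a].

Definition tent_region (R : realType) (xi : R[i]) : set R[i] :=
  [set z | unit_disk z /\ cmod (1 - z * xi^*) < 1 - cmod z ^+ 2].

(* The p-th power of the tent space (quasi-)norm. *)
Definition tent_normp (R : realType) (p q alpha : R) (f : R[i] -> R[i]) : \bar R :=
  (\int[@lebesgue_measure R]_(t in `[0%R, (2 * pi)%R])
    (\int[(@lebesgue_measure R) \x (@lebesgue_measure R)]_(u in
        [set u | tent_region (expi t) (of_cpair u)])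
      (cmod (f (of_cpair u)) `^ q
        * (1 - cmod (of_cpair u) ^+ 2) `^ alpha)%:E) `^ (p / q))%E.

Definition tent_space (R : realType) (p q alpha : R) : set (R[i] -> R[i]) :=
  [set f | analytic_on_disk f /\ (tent_normp p q alpha f < +oo)%E].

Definition integral_mean (R : realType) (p r : R) (f : R[i] -> R[i]) : \bar R :=
  (((2 * pi)^-1%:E * \int[@lebesgue_measure R]_(t in `[0%R, (2 * pi)%R])
      (cmod (f (r%:C%C * expi t)) `^ p)%:E) `^ p^-1)%E.

Definition mixed_norm (R : realType) (p q alpha : R) (f : R[i] -> R[i]) : \bar R :=
  ((\int[@lebesgue_measure R]_(r in `]0%R, 1%R[)
      (integral_mean p r f `^ q * ((1 - r) `^ (alpha * q - 1))%:E)) `^ q^-1)%E.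

Definition mixed_norm_space (R : realType) (p q alpha : R) : set (R[i] -> R[i]) :=
  [set f | analytic_on_disk f /\ (mixed_norm p q alpha f < +oo)%E].

Section random.
Context (R : realType) (d : measure_display) (T : measurableType d).
Variable P : probability T R.

Definition complex_random_variable (Y : T -> R[i]) : Prop :=
  measurable_fun [set: T] (fun w => cpair (Y w)).

Definition mutually_independent (X : nat -> T -> R[i]) : Prop :=
  forall (J : seq nat) (B : nat -> set (R * R)), uniq J ->
    (forall n, measurable (B n)) ->
    P [set w | forall n, n \in J -> B n (cpair (X n w))] =
    (\prod_(n <- J) P [set w | B n (cpair (X n w))])%E.

Definition bernoulli_variable (Y : T -> R[i]) : Prop :=
  P [set w | Y w = 1] = (2^-1)%:E /\ P [set w | Y w = -1] = (2^-1)%:E.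

Definition steinhaus_variable (Y : T -> R[i]) : Prop :=
  forall B : set (R * R), measurable B ->
    P [set w | B (cpair (Y w))] =
    ((2 * pi)^-1%:E
      * @lebesgue_measure R (`[0%R, (2 * pi)%R] `&` [set t | B (cpair (expi t))]))%E.

(* The law N(0,1) of the real line, seen as a law on the complex plane. *)
Definition gaussian_variable (Y : T -> R[i]) : Prop :=
  forall B : set (R * R), measurable B ->
    P [set w | B (cpair (Y w))] = normal_prob 0 1 [set x : R | B (cpair x%:C)].

Definition standard_random_sequence (X : nat -> T -> R[i]) : Prop :=
  [/\ forall n, complex_random_variable (X n),
      mutually_independent X &
      [\/ forall n, bernoulli_variable (X n),
          forall n, steinhaus_variable (X n) |
          forall n, gaussian_variable (X n)]].

Definition randomization (X : nat -> T -> R[i]) (a : nat -> R[i]) (w : T) :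
    R[i] -> R[i] :=
  fun z => limn (fun n => \sum_(k < n) X k w * a k * z ^+ k : R[i]^o).

(* a is the sequence of Taylor coefficients of f at 0; it is determined by f. *)
Definition symbol_space (X : nat -> T -> R[i]) (S : set (R[i] -> R[i])) :
    set (R[i] -> R[i]) :=
  [set f | analytic_on_disk f /\
    exists a, power_series_on f 0 1 a /\
      {ae P, forall w, S (randomization X a w)}].

End random.

(* Main.v *)
Require Import Defs.
From HB Require Import structures.
From mathcomp Require Import finmap.
From mathcomp Require Import all_boot all_order all_algebra.
From mathcomp Require Import all_classical all_reals all_analysis.
From mathcomp Require Import measurable_realfun complex ring lra.

(** Write f(z) = sum_k a_k z^k and let sigma(r)^2 = sum_k |a_k|^2 r^(2k). At a fixed
    point z of modulus r, the random series (Rf)(z) is a sum of independent centered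
    variables whose second moments add up to v sigma(r)^2. All three kinds of standard
    variables are subgaussian, so that |(Rf)(z)| / sigma(r) has a bounded exponential
    moment and a second moment bounded below, uniformly in z and f (the Khinchin
    inequalities in both directions). Thus |(Rf)(z)|^q behaves like sigma(|z|)^q, and
    both sides of the theorem become the condition
<<
      int_0^1 sigma(r)^q (1 - r)^(alpha + 1) dr < oo.
>>
    For the mixed norm this is Parseval's formula, M_2(r, f) being comparable with
    sigma(r) (mixed_norm_radial). For the tent space, consider the integral V(t) of
    sigma(|z|)^q (1 - |z|^2)^alpha over the tent at exp(it). It does not depend on t by
    rotation invariance, and slicing the tent at 1 by vertical lines shows that it is
    finite exactly when the integral above is (tent_int_radial). It remains to compare
    the random integrals I_t of |Rf|^q (1 - |z|^2)^alpha over the tents with V(t).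

    If the tent norm of Rf is almost surely finite, then by Fubini some single I_t is
    almost surely finite, hence bounded on an event A of probability close to 1. The
    moment bounds leave a fixed proportion of the mean of |(Rf)(z)|^q on every such event
    (small_ball), and integrating I_t over A yields V(t) < oo (field_mass_necessary).
    Conversely, if V is finite, the exponential moments bound the expectation of
    I_t^(p/q) by a constant depending on V only (field_mass_sufficient); integrating over
    t, the p-th power of the tent norm of Rf has a finite expectation.

    Constants being irrelevant, orthogonality is used through a Fatou argument with a
    factor 2 (orthogonal_limit), both for Parseval's formula and for the second moments
    of random series. Two facts about analytic functions complete the argument. A
    function with local expansions on the disk is the sum of its Taylor series at 0
    (analytic_power_series), which is derived here from Parseval's formula and the
    compactness of circles. The random coefficients are almost surely summable on the
    whole disk, which makes Rf analytic (random_coefficients_summable,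
    psum_analytic). *)

Set Implicit Arguments.
Unset Strict Implicit.
Unset Printing Implicit Defensive.

Import Order.TTheory GRing.Theory Num.Theory.
Import numFieldNormedType.Exports.

Local Open Scope classical_set_scope.
Local Open Scope ring_scope.
Local Open Scope complex_scope.

(** * Modulus and convergence in the complex plane *)

Section ComplexModulus.
Context {R : realType}.
Implicit Types (z w : R[i]) (u : nat -> R[i]).

Lemma normcE_cmod z : `|z| = (cmod z)%:C.
Proof. by rewrite /cmod; case: z. Qed.

Lemma cmod_ge0 z : 0 <= cmod z.
Proof. by case: z => a b; rewrite /cmod /= sqrtr_ge0. Qed.

Lemma cmod0 : cmod (0 : R[i]) = 0.
Proof. exact: ComplexField.Normc.normc0. Qed.

Lemma cmod1 : cmod (1 : R[i]) = 1.
Proof. exact: ComplexField.Normc.normc1. Qed.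

Lemma cmodM z w : cmod (z * w) = cmod z * cmod w.
Proof. exact: ComplexField.Normc.normcM. Qed.

Lemma cmodN z : cmod (- z) = cmod z.
Proof. by have := normrN z; rewrite !normcE_cmod => -[]. Qed.

Lemma cmodB z w : cmod (z - w) = cmod (w - z).
Proof. by rewrite -cmodN opprB. Qed.

Lemma le_cmodD z w : cmod (z + w) <= cmod z + cmod w.
Proof. by have := ler_normD z w; rewrite !normcE_cmod -rmorphD lecR. Qed.

Lemma le_cmod_sum I (s : seq I) (P : pred I) (F : I -> R[i]) :
  cmod (\sum_(i <- s | P i) F i) <= \sum_(i <- s | P i) cmod (F i).
Proof.
elim/big_ind2: _ => //; first by rewrite cmod0.
by move=> x y z w hx hz; apply: (le_trans (le_cmodD _ _)); apply: lerD.
Qed.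

Lemma cmodX z n : cmod (z ^+ n) = cmod z ^+ n.
Proof. by elim: n => [|n IH]; rewrite ?expr0 ?cmod1// !exprS cmodM IH. Qed.

Lemma cmod_eq0 z : (cmod z == 0) = (z == 0).
Proof.
apply/eqP/eqP => [|->]; last exact: cmod0.
exact: ComplexField.Normc.eq0_normc.
Qed.

Lemma cmod_sqr z : cmod z ^+ 2 = complex.Re z ^+ 2 + complex.Im z ^+ 2.
Proof. by case: z => a b; rewrite /cmod /= sqr_sqrtr// addr_ge0// sqr_ge0. Qed.

Lemma Re_le_cmod z : `|complex.Re z| <= cmod z.
Proof.
rewrite -[leRHS](ger0_norm (cmod_ge0 z)) -ler_sqr ?nnegrE//.
by rewrite !real_normK ?num_real// cmod_sqr lerDl sqr_ge0.
Qed.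

Lemma Im_le_cmod z : `|complex.Im z| <= cmod z.
Proof.
rewrite -[leRHS](ger0_norm (cmod_ge0 z)) -ler_sqr ?nnegrE//.
by rewrite !real_normK ?num_real// cmod_sqr lerDr sqr_ge0.
Qed.

Lemma cmod_le_ReIm z : cmod z <= `|complex.Re z| + `|complex.Im z|.
Proof.
rewrite -ler_sqr ?nnegrE ?cmod_ge0 ?addr_ge0//.
rewrite cmod_sqr sqrrD !real_normK ?num_real// -addrA lerD2l lerDr.
by rewrite mulrn_wge0// mulr_ge0.
Qed.

Lemma cmod_real (x : R) : cmod x%:C = `|x|.
Proof. by rewrite /cmod /= expr0n /= addr0 sqrtr_sqr. Qed.

Lemma cmod_natr n : cmod (n%:R : R[i]) = n%:R.
Proof. by rewrite -[n%:R](rmorph_nat (@real_complex R)) cmod_real ger0_norm. Qed.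

Lemma cmod_expi (t : R) : cmod (expi t) = 1.
Proof. by rewrite /cmod /expi /= cos2Dsin2 sqrtr1. Qed.

Lemma cmod_lipschitz z w : `|cmod z - cmod w| <= cmod (z - w).
Proof.
rewrite ler_norml; apply/andP; split.
  rewrite lerNl opprB lerBlDr cmodB; apply: le_trans (le_cmodD _ _).
  by rewrite subrK.
by rewrite lerBlDr; apply: le_trans (le_cmodD _ _); rewrite subrK.
Qed.

Lemma ReD z w : complex.Re (z + w) = complex.Re z + complex.Re w.
Proof. by case: z => ? ?; case: w. Qed.

Lemma ImD z w : complex.Im (z + w) = complex.Im z + complex.Im w.
Proof. by case: z => ? ?; case: w. Qed.

Lemma Re_sum I (s : seq I) (P : pred I) (F : I -> R[i]) :
  complex.Re (\sum_(i <- s | P i) F i) = \sum_(i <- s | P i) complex.Re (F i).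
Proof. exact: (big_morph (fun z : R[i] => complex.Re z) ReD). Qed.

Lemma Im_sum I (s : seq I) (P : pred I) (F : I -> R[i]) :
  complex.Im (\sum_(i <- s | P i) F i) = \sum_(i <- s | P i) complex.Im (F i).
Proof. exact: (big_morph (fun z : R[i] => complex.Im z) ImD). Qed.

(** Transfers convergence in the plane to real sequences, where order and limits
    interact well. *)
Lemma cvgC_cmod u (l : R[i]) :
  (u : nat -> R[i]^o) @ \oo --> (l : R[i]^o) <->
  (fun n => cmod (u n - l)) @ \oo --> (0 : R).
Proof.
split=> [/cvgrPdist_lt h|/cvgrPdist_lt h].
  apply/cvgrPdist_lt => e e0.
  have := h e%:C; rewrite ltcR => /(_ e0).
  apply: filterS => n; rewrite normcE_cmod ltcR sub0r normrN cmodB.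
  by rewrite ger0_norm// cmod_ge0.
apply/cvgrPdist_lt => e; case: e => a b; rewrite ltcE /= => /andP[/eqP -> a0].
have := h a a0; apply: filterS => n.
by rewrite sub0r normrN ger0_norm ?cmod_ge0// normcE_cmod cmodB ltcR.
Qed.

Lemma cvgC_ReIm u (l : R[i]) :
  (fun n => complex.Re (u n)) @ \oo --> complex.Re l ->
  (fun n => complex.Im (u n)) @ \oo --> complex.Im l ->
  (u : nat -> R[i]^o) @ \oo --> (l : R[i]^o).
Proof.
move=> hr hi; apply/cvgC_cmod.
have h : (fun n => `|complex.Re (u n) - complex.Re l|
   + `|complex.Im (u n) - complex.Im l|) @ \oo --> (0 : R).
  rewrite -[0 in X in _ --> X](addr0 0); apply: cvgD.
    rewrite -(@normr0 _ R); apply: cvg_norm; rewrite -(subrr (complex.Re l)).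
    by apply: cvgB => //; exact: cvg_cst.
  rewrite -(@normr0 _ R); apply: cvg_norm; rewrite -(subrr (complex.Im l)).
  by apply: cvgB => //; exact: cvg_cst.
apply: (squeeze_cvgr _ (cvg_cst 0) h); near=> n; rewrite cmod_ge0 /=.
by apply: le_trans (cmod_le_ReIm _) _; case: (u n) => ? ?; case: l {hr hi h}.
Unshelve. all: by end_near. Qed.

Lemma cvgC_unique u (l l' : R[i]) :
  (u : nat -> R[i]^o) @ \oo --> (l : R[i]^o) ->
  (u : nat -> R[i]^o) @ \oo --> (l' : R[i]^o) -> l = l'.
Proof. by move=> h h'; rewrite -(cvg_lim _ h)// (cvg_lim _ h'). Qed.

Lemma cvg_cmod u (l : R[i]) : (u : nat -> R[i]^o) @ \oo --> (l : R[i]^o) ->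
  (fun n => cmod (u n)) @ \oo --> cmod l.
Proof.
move=> /cvgC_cmod/cvgrPdist_le h; apply/cvgrPdist_le => e e0.
apply: filterS (h e e0) => n; rewrite sub0r normrN ger0_norm ?cmod_ge0//.
by apply: le_trans; rewrite cmodB; exact: cmod_lipschitz.
Qed.

(** Besides the limit, the tail bound is recorded: it makes exchanges of limits
    quantitative below. *)
Lemma abs_cvg_series u : cvgn (series (fun k => cmod (u k))) ->
  exists l : R[i], (fun n => \sum_(k < n) u k : R[i]^o) @ \oo --> (l : R[i]^o) /\
   forall n, cmod (l - \sum_(k < n) u k) <=
     limn (series (fun k => cmod (u k))) - series (fun k => cmod (u k)) n.
Proof.
move=> cu.
have cRe : cvgn (series (fun k => complex.Re (u k))).
  apply: normed_cvg; apply: series_le_cvg cu => n //=; first exact: cmod_ge0.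
  exact: Re_le_cmod.
have cIm : cvgn (series (fun k => complex.Im (u k))).
  apply: normed_cvg; apply: series_le_cvg cu => n //=; first exact: cmod_ge0.
  exact: Im_le_cmod.
pose l : R[i] := (limn (series (fun k => complex.Re (u k))))
  +i* (limn (series (fun k => complex.Im (u k)))).
have sumRe n : complex.Re (\sum_(k < n) u k) = series (fun k => complex.Re (u k)) n.
  by rewrite /series /= big_mkord Re_sum.
have sumIm n : complex.Im (\sum_(k < n) u k) = series (fun k => complex.Im (u k)) n.
  by rewrite /series /= big_mkord Im_sum.
have hl : (fun n => \sum_(k < n) u k : R[i]^o) @ \oo --> (l : R[i]^o).
  by apply: cvgC_ReIm; rewrite /l /=;
    [under eq_fun do rewrite sumRe|under eq_fun do rewrite sumIm].
exists l; split=> // n.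
have h1 : (fun m => cmod (\sum_(k < m) u k - \sum_(k < n) u k)) @ \oo -->
    cmod (l - \sum_(k < n) u k).
  by apply: cvg_cmod; apply: (@cvgB _ R[i]^o _ _ _ _ _ _ _ hl); exact: cvg_cst.
have h2 : (fun m => series (fun k => cmod (u k)) m - series (fun k => cmod (u k)) n)
   @ \oo --> limn (series (fun k => cmod (u k))) - series (fun k => cmod (u k)) n.
  by apply: cvgB => //; exact: cvg_cst.
rewrite -(cvg_lim _ h1)// -(cvg_lim _ h2)//.
apply: ler_lim; [by apply/cvg_ex; eexists; exact: h1|
  by apply/cvg_ex; eexists; exact: h2|].
near=> m; have nm : (n <= m)%N by near: m; exact: nbhs_infty_ge.
rewrite /series /= -!(big_mkord xpredT u).
rewrite (big_cat_nat (n := n))//= [X in _ <= X - _](big_cat_nat (n := n))//=.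
by rewrite [X in cmod X]addrC addKr [leRHS]addrC addKr; exact: le_cmod_sum.
Unshelve. all: by end_near. Qed.

End ComplexModulus.

(** * Power series and their recentering *)

Definition summable_at (R : realType) (a : nat -> R[i]) (r : R) : Prop :=
  cvgn (series (fun k => cmod (a k) * r ^+ k)).

Definition psum (R : realType) (a : nat -> R[i]) (z : R[i]) : R[i] :=
  limn (fun n => \sum_(k < n) a k * z ^+ k : R[i]^o).

(** The Taylor coefficients at c of the sum of the power series with coefficients a,
    obtained by expanding each (c + h)^j. *)
Definition recenter (R : realType) (a : nat -> R[i]) (c : R[i]) (k : nat) : R[i] :=
  limn (fun n => \sum_(j < n) a j * c ^+ (j - k) *+ 'C(j, k) : R[i]^o).

Section PowerSeries.
Context {R : realType}.
Implicit Types (z c h : R[i]) (a : nat -> R[i]) (r s : R).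

Lemma summable_le a r s : 0 <= r <= s -> summable_at a s -> summable_at a r.
Proof.
move=> /andP[r0 rs]; apply: series_le_cvg => n.
- by rewrite mulr_ge0 ?cmod_ge0 ?exprn_ge0.
- by rewrite mulr_ge0 ?cmod_ge0 ?exprn_ge0// (le_trans r0).
- by rewrite ler_wpM2l ?cmod_ge0// lerXn2r// nnegrE (le_trans r0).
Qed.

Lemma bounded_summable a r s M : 0 <= r < s ->
  (forall k, cmod (a k) * s ^+ k <= M) -> summable_at a r.
Proof.
move=> /andP[r0 rs] hM; have s0 : 0 < s by exact: le_lt_trans rs.
apply: (@series_le_cvg _ _ (geometric M (r / s))).
- by move=> n; rewrite mulr_ge0 ?cmod_ge0 ?exprn_ge0.
- move=> n; rewrite /= mulr_ge0 ?exprn_ge0 ?divr_ge0 ?(ltW s0)//.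
  by apply: le_trans (hM 0%N); rewrite mulr_ge0 ?cmod_ge0 ?exprn_ge0 ?(ltW s0).
- move=> n /=; rewrite expr_div_n mulrCA mulrC ler_wpM2l ?exprn_ge0//.
  by rewrite ler_pdivlMr ?exprn_gt0//; exact: hM.
apply: is_cvg_geometric_series.
by rewrite ger0_norm ?divr_ge0 ?(ltW s0)// ltr_pdivrMr ?mul1r.
Qed.

Lemma summable_bounded a s : 0 <= s -> summable_at a s ->
  exists2 M, 0 <= M & forall k, cmod (a k) * s ^+ k <= M.
Proof.
move=> s0 hs; exists (limn (series (fun k => cmod (a k) * s ^+ k))).
  rewrite -[0](_ : series (fun k => cmod (a k) * s ^+ k) 0%N = 0).
    apply: nondecreasing_cvgn_le => //; apply: nondecreasing_series => n _ _.
    by rewrite mulr_ge0 ?cmod_ge0 ?exprn_ge0.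
  by rewrite /series /= big_geq.
move=> k; apply: (@le_trans _ _ (series (fun k => cmod (a k) * s ^+ k) k.+1)).
  rewrite /series /= big_nat_recr//= lerDr sumr_ge0// => i _.
  by rewrite mulr_ge0 ?cmod_ge0 ?exprn_ge0.
apply: nondecreasing_cvgn_le => //; apply: nondecreasing_series => n _ _.
by rewrite mulr_ge0 ?cmod_ge0 ?exprn_ge0.
Qed.

Lemma summable_cmod a z : summable_at a (cmod z) ->
  cvgn (series (fun k => cmod (a k * z ^+ k))).
Proof.
move=> h; rewrite (_ : (fun k => _) = fun k => cmod (a k) * cmod z ^+ k)//.
by apply/funext => k; rewrite cmodM cmodX.
Qed.

Lemma cvg_psum a z : summable_at a (cmod z) ->
  (fun n => \sum_(k < n) a k * z ^+ k : R[i]^o) @ \oo --> (psum a z : R[i]^o).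
Proof.
move=> /summable_cmod/abs_cvg_series[l [hl _]].
by rewrite /psum (cvg_lim _ hl).
Qed.

Lemma power_series_psum f c r a : (forall s, 0 <= s < r -> summable_at a s) ->
  power_series_on f c r a <-> (forall z, cmod (z - c) < r -> f z = psum a (z - c)).
Proof.
move=> hs; split=> h z hz.
  by apply: cvgC_unique (h z hz) _; apply: cvg_psum; apply: hs; rewrite cmod_ge0.
by rewrite h//; apply: cvg_psum; apply: hs; rewrite cmod_ge0.
Qed.

(** Abel's lemma: the terms are bounded at a point of larger modulus, and the ratio
    of the two moduli gives geometric decay. *)
Lemma power_series_summable f c r a : power_series_on f c r a ->
  forall s, 0 <= s < r -> summable_at a s.
Proof.
move=> h s /andP[s0 sr]; pose t := (s + r) / 2.
have st : s < t by rewrite /t; lra.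
have tr : t < r by rewrite /t; lra.
have t0 : 0 < t by exact: le_lt_trans st.
have := h (c + t%:C); rewrite [c + _]addrC addrK cmod_real gtr0_norm// => /(_ tr) hc.
have : cvgn (series (fun k => a k * t%:C ^+ k : R[i]^o)).
  by apply/cvg_ex; exists (f (t%:C + c)); rewrite /series /=; under eq_fun do rewrite big_mkord.
move=> /cvg_series_cvg_0 h0.
have h1 : (fun k => cmod (a k * t%:C ^+ k)) @ \oo --> (0 : R).
  by rewrite -cmod0; apply: cvg_cmod.
have : cvgn (fun k => cmod (a k * t%:C ^+ k)) by apply/cvg_ex; exists 0.
move=> /cvg_has_ub[M hM]; apply: (@bounded_summable _ _ t M); first by rewrite s0.
move=> k; apply: le_trans (hM _ _); last by exists k.
by rewrite cmodM cmodX cmod_real (gtr0_norm t0) ger0_norm ?mulr_ge0 ?cmod_ge0 ?exprn_ge0 ?(ltW t0).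
Qed.

Lemma cvgC_sum n (u : nat -> nat -> R[i]) (l : nat -> R[i]) :
  (forall k, (u k : nat -> R[i]^o) @ \oo --> (l k : R[i]^o)) ->
  (fun m => \sum_(k < n) u k m : R[i]^o) @ \oo --> (\sum_(k < n) l k : R[i]^o).
Proof.
move=> h; elim: n => [|n IH].
  by rewrite big_ord0; under eq_fun do rewrite big_ord0; exact: cvg_cst.
rewrite big_ord_recr /=; under eq_fun do rewrite big_ord_recr /=.
exact: (@cvgD _ R[i]^o _ _ _ _ _ _ _ IH (h n)).
Qed.

Lemma binom_term_le (x y : R) j k : 0 <= x -> 0 <= y ->
  x ^+ (j - k) * y ^+ k *+ 'C(j, k) <= (x + y) ^+ j.
Proof.
move=> x0 y0; case: (leqP k j) => kj; last by rewrite bin_small// mulr0n exprn_ge0// addr_ge0.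
rewrite exprDn (bigD1 (Ordinal (ltnSE kj : (k < j.+1)%N)))//= lerDl.
by apply: sumr_ge0 => i _; rewrite mulrn_wge0// mulr_ge0 ?exprn_ge0.
Qed.

(** Each term 'C(j, k) |c|^(j-k) d^k is one of the terms in the expansion of
    (|c| + d)^j. *)
Lemma recenter_termwise_summable a c d k : 0 < d -> summable_at a (cmod c + d) ->
  cvgn (series (fun j => cmod (a j * c ^+ (j - k) *+ 'C(j, k)))) /\
  limn (series (fun j => cmod (a j * c ^+ (j - k) *+ 'C(j, k)))) * d ^+ k
    <= limn (series (fun j => cmod (a j) * (cmod c + d) ^+ j)).
Proof.
move=> d0 hs; pose v j := d ^- k * (cmod (a j) * (cmod c + d) ^+ j).
have cv : cvgn (series v) by exact: (@is_cvg_seriesZ R _ (d ^- k) hs).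
have le_v j : cmod (a j * c ^+ (j - k) *+ 'C(j, k)) <= v j.
  rewrite -mulr_natr !cmodM cmodX cmod_natr /v -mulrA [leRHS]mulrCA ler_wpM2l ?cmod_ge0//.
  rewrite ler_pdivlMl ?exprn_gt0// mulrCA mulrA mulr_natr.
  exact: binom_term_le (cmod_ge0 c) (ltW d0).
have cu : cvgn (series (fun j => cmod (a j * c ^+ (j - k) *+ 'C(j, k)))).
  apply: series_le_cvg cv => // n; first exact: cmod_ge0.
  by apply: le_trans (le_v n); exact: cmod_ge0.
split=> //; rewrite -ler_pdivlMr ?exprn_gt0// mulrC.
rewrite [leRHS](_ : _ = limn (series v)); last exact/esym/(lim_seriesZ (d ^- k)).
exact: lim_series_le.
Qed.

Lemma binom_widen c h j n : (j < n)%N ->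
  (c + h) ^+ j = \sum_(k < n) c ^+ (j - k) * h ^+ k *+ 'C(j, k).
Proof.
move=> jn; rewrite exprDn.
rewrite (big_ord_widen n (fun k => c ^+ (j - k) * h ^+ k *+ 'C(j, k)) jn).
rewrite [RHS](bigID (fun k : 'I_n => (k < j.+1)%N))/=.
rewrite [X in _ = _ + X]big1 ?addr0// => k.
by rewrite -leqNgt => kj; rewrite bin_small.
Qed.

Lemma cvg_recenter a c d k : 0 < d -> summable_at a (cmod c + d) ->
  (fun n => \sum_(j < n) a j * c ^+ (j - k) *+ 'C(j, k) : R[i]^o) @ \oo -->
    (recenter a c k : R[i]^o) /\
  cmod (recenter a c k) * d ^+ k
    <= limn (series (fun j => cmod (a j) * (cmod c + d) ^+ j)).
Proof.
move=> d0 hs; have [cu lu] := recenter_termwise_summable k d0 hs.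
have [l [hl ht]] := abs_cvg_series cu.
rewrite /recenter (cvg_lim _ hl)//; split=> //.
apply: le_trans lu; rewrite ler_wpM2r ?exprn_ge0 ?(ltW d0)//.
by have := ht 0%N; rewrite big_ord0 subr0 /series /= big_geq// subr0.
Qed.

(** Both sums come from one absolutely convergent double series; they differ by terms of
    index j >= N, whose moduli add up to at most the tail of the series at |c| + |h|. *)
Lemma recenter_partial_sum a c h N d :
  0 < d -> summable_at a (cmod c + d) -> summable_at a (cmod c + cmod h) ->
  cmod (\sum_(k < N) recenter a c k * h ^+ k - \sum_(j < N) a j * (c + h) ^+ j) <=
  limn (series (fun j => cmod (a j) * (cmod c + cmod h) ^+ j)) -
  series (fun j => cmod (a j) * (cmod c + cmod h) ^+ j) N.
Proof.
move=> d0 hd hh; set ser := series _.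
pose t k j := a j * c ^+ (j - k) *+ 'C(j, k).
have step M : (N <= M)%N ->
  cmod (\sum_(k < N) (\sum_(j < M) t k j) * h ^+ k
        - \sum_(j < N) a j * (c + h) ^+ j) <= ser M - ser N.
  move=> NM.
  (* for j < N the terms with k > j vanish, so that both sums range over k < N *)
  have -> : \sum_(j < N) a j * (c + h) ^+ j =
      \sum_(k < N) (\sum_(j < N) t k j) * h ^+ k.
    under [RHS]eq_bigr do rewrite mulr_suml.
    rewrite exchange_big /=; apply: eq_bigr => j _.
    rewrite (binom_widen c h (ltn_ord j)) mulr_sumr; apply: eq_bigr => k _.
    by rewrite /t mulrnAr mulrnAl mulrA.
  rewrite -sumrB.
  have -> : \sum_(k < N) ((\sum_(j < M) t k j) * h ^+ k
       - (\sum_(j < N) t k j) * h ^+ k)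
     = \sum_(N <= j < M) \sum_(k < N) t k j * h ^+ k.
    rewrite exchange_big /=; apply: eq_bigr => k _.
    rewrite -mulrBl -!(big_mkord xpredT (t k)) (big_cat_nat (n := N))//=.
    by rewrite [X in X * _]addrC addKr mulr_suml.
  rewrite /ser /series /= [X in _ <= X - _](big_cat_nat (n := N))//= [leRHS]addrC addKr.
  apply: le_trans (le_cmod_sum _ _ _) _.
  apply: ler_sum_nat => j /andP[Nj jM].
  apply: le_trans (le_cmod_sum _ _ _) _.
  rewrite exprDn mulr_sumr.
  rewrite (big_ord_widen _ (fun k => cmod (t k j * h ^+ k)) (leqW Nj)) big_mkcond /=.
  apply: ler_sum => k _.
  have e : cmod (t k j * h ^+ k) =
      cmod (a j) * (cmod c ^+ (j - k) * cmod h ^+ k *+ 'C(j, k)).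
    rewrite /t -[in LHS]mulr_natr -[in RHS]mulr_natr !cmodM !cmodX cmod_natr.
    by rewrite -!mulrA [X in _ * (_ * X)]mulrC.
  case: ifP => _; first by rewrite e.
  by rewrite mulr_ge0 ?cmod_ge0// mulrn_wge0// mulr_ge0 ?exprn_ge0 ?cmod_ge0.
have h1 : (fun M => cmod (\sum_(k < N) (\sum_(j < M) t k j) * h ^+ k
        - \sum_(j < N) a j * (c + h) ^+ j)) @ \oo -->
   cmod (\sum_(k < N) recenter a c k * h ^+ k - \sum_(j < N) a j * (c + h) ^+ j).
  apply: cvg_cmod; apply: (@cvgB _ R[i]^o _ _ _ _ _ _ _ _ (cvg_cst _)).
  apply: (@cvgC_sum N (fun k M => (\sum_(j < M) t k j) * h ^+ k)
    (fun k => recenter a c k * h ^+ k)) => k.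
  apply: (@cvgM R[i]); last exact: cvg_cst.
  by have [] := cvg_recenter k d0 hd.
have h2 : (fun M => ser M - ser N) @ \oo --> limn ser - ser N.
  by apply: cvgB => //; exact: cvg_cst.
rewrite -(cvg_lim _ h1)// -(cvg_lim _ h2)//; apply: ler_lim.
- by apply/cvg_ex; eexists; exact: h1.
- by apply/cvg_ex; eexists; exact: h2.
- by near=> M; apply: step; near: M; exact: nbhs_infty_ge.
Unshelve. all: by end_near. Qed.

Lemma psum_recenter a r c h : (forall s, 0 <= s < r -> summable_at a s) ->
  cmod c + cmod h < r ->
  (fun n => \sum_(k < n) recenter a c k * h ^+ k : R[i]^o) @ \oo -->
    (psum a (c + h) : R[i]^o).
Proof.
move=> hs hr.
have hh : summable_at a (cmod c + cmod h) by apply: hs; rewrite addr_ge0 ?cmod_ge0.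
have hch : summable_at a (cmod (c + h)).
  by apply: hs; rewrite cmod_ge0 /=; apply: le_lt_trans hr; exact: le_cmodD.
pose d := (r - cmod c) / 2.
have hc0 := cmod_ge0 c; have hh0 := cmod_ge0 h.
have d0 : 0 < d by rewrite /d; lra.
have hd : summable_at a (cmod c + d) by apply: hs; rewrite /d; lra.
set ser := series (fun j => cmod (a j) * (cmod c + cmod h) ^+ j).
have hB N : cmod (\sum_(k < N) recenter a c k * h ^+ k - \sum_(j < N) a j * (c + h) ^+ j)
    <= limn ser - ser N by exact: recenter_partial_sum d0 hd hh.
have t0 : (fun N => limn ser - ser N) @ \oo --> (0 : R).
  by rewrite -(subrr (limn ser)); apply: cvgB; [exact: cvg_cst|exact: hh].
have : (fun N => (\sum_(k < N) recenter a c k * h ^+ k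
     - \sum_(j < N) a j * (c + h) ^+ j : R[i]^o)) @ \oo --> (0 : R[i]^o).
  apply/cvgC_cmod; apply: (squeeze_cvgr _ (cvg_cst 0) t0).
  by near=> N; rewrite cmod_ge0 subr0 hB.
move=> hz.
rewrite (_ : (fun n => _) = fun N => (\sum_(k < N) recenter a c k * h ^+ k
     - \sum_(j < N) a j * (c + h) ^+ j) + \sum_(j < N) a j * (c + h) ^+ j); last first.
  by apply/funext => N; rewrite subrK.
rewrite -[X in _ --> X]add0r; exact: (@cvgD _ R[i]^o _ _ _ _ _ _ _ hz (cvg_psum hch)).
Unshelve. all: by end_near. Qed.

Lemma power_series_recenter f c r a h : power_series_on f c r a -> cmod h < r ->
  power_series_on f (c + h) (r - cmod h) (recenter a h).
Proof.
move=> hf hr z hz; have hs := power_series_summable hf.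
have -> : f z = psum a (h + (z - (c + h))).
  rewrite (_ : h + _ = z - c); last by rewrite opprD; ring.
  move/(power_series_psum _ _ hs) : hf; apply.
  rewrite (_ : z - c = (z - (c + h)) + h); last by ring.
  by apply: le_lt_trans (le_cmodD _ _) _; rewrite -ltrBrDr.
by apply: (psum_recenter hs); rewrite addrC -ltrBrDr.
Qed.

(** This is what makes a random power series with almost surely summable terms an
    analytic function in the sense of local expansions. *)
Lemma psum_analytic a : (forall s, 0 <= s < 1 -> summable_at a s) ->
  analytic_on_disk (psum a).
Proof.
move=> hs c hc; exists (1 - cmod c), (recenter a c); split.
  by rewrite subr_gt0.
have : power_series_on (psum a) 0 1 a.
  by apply/(power_series_psum _ _ hs) => z _; rewrite subr0.
by move=> /power_series_recenter => /(_ _ hc); rewrite add0r.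
Qed.

(** Isolated zeros: near the origin the term of lowest degree with a nonzero
    coefficient dominates the rest of the series. *)
Lemma power_series_eq0 a r : 0 < r -> summable_at a r ->
  (forall e, 0 < e -> exists h, 0 < cmod h < e /\ psum a h = 0) ->
  forall k, a k = 0.
Proof.
move=> r0 hs hz; apply: contrapT => /existsNP[k0 /eqP hk0].
case: (@ex_minnP (fun k => a k != 0)); first by exists k0.
move=> m am hmin.
have am0 : 0 < cmod (a m) by rewrite lt_def cmod_ge0 cmod_eq0 am.
pose ser s := series (fun k => cmod (a k) * s ^+ k).
have [M M0 hM] : exists2 M, 0 <= M & forall k, cmod (a (k + m.+1)%N) * r ^+ k <= M.
  have [M M0 hM] := summable_bounded (ltW r0) hs.
  exists (M / r ^+ m.+1); first by rewrite divr_ge0// exprn_ge0// ltW.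
  by move=> k; rewrite ler_pdivlMr ?exprn_gt0// -mulrA -exprD.
(* below r / 2 the tail is at most twice the geometric bound M, and below the second
   value it is smaller than the term of degree m *)
pose e := Num.min (r / 2) (cmod (a m) / (M *+ 2 + 1)).
have e0 : 0 < e by rewrite lt_min !divr_gt0// ltr_pwDr// mulrn_wge0.
have [h [/andP[h0]]] := hz e e0; rewrite lt_min => /andP[hr hM'] ph.
have hrr : cmod h < r by lra.
have hsh : summable_at a (cmod h).
  by apply: summable_le hs; rewrite cmod_ge0 ltW.
suff hle : cmod (a m) <= cmod h * (M *+ 2).
  move: hM'; rewrite ltr_pdivlMr; last by rewrite ltr_pwDr// mulrn_wge0.
  rewrite mulrDr mulr1 => hlt; have := lt_le_trans hlt hle.
  by rewrite gtrDl ltNge (ltW h0).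
have hn n : cmod (\sum_(k < n + m.+1) a k * h ^+ k) >=
    cmod h ^+ m * (cmod (a m) - cmod h * (M *+ 2)).
  rewrite addnC -(big_mkord xpredT (fun k => a k * h ^+ k)).
  rewrite (big_cat_nat (n := m.+1)) ?leq_addr//= big_nat_recr//= big_nat.
  rewrite big1 ?add0r; last first.
    move=> i /andP[_ im]; case: (eqVneq (a i) 0) => [->|/hmin]; first by rewrite mul0r.
    by rewrite leqNgt im.
  rewrite mulrBr lerBlDr.
  apply: (@le_trans _ _ (cmod (a m * h ^+ m))); first by rewrite cmodM cmodX mulrC.
  rewrite -[X in cmod X <= _](addrK (\sum_(m.+1 <= i < m.+1 + n) a i * h ^+ i)).
  apply: le_trans (le_cmodD _ _) _; rewrite lerD2l cmodN.
  apply: le_trans (le_cmod_sum _ _ _) _.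
  rewrite -{1}[m.+1]add0n big_addn addKn big_mkord.
  apply: (@le_trans _ _ (\sum_(i < n) cmod h ^+ m.+1 * (geometric M (cmod h / r) i))).
    apply: ler_sum => i _; rewrite cmodM cmodX /= expr_div_n exprD mulrA mulrC.
    rewrite ler_wpM2l ?exprn_ge0 ?cmod_ge0// mulrCA mulrC ler_wpM2l ?exprn_ge0 ?cmod_ge0//.
    by rewrite ler_pdivlMr ?exprn_gt0.
  rewrite -mulr_sumr exprSr -mulrA ler_wpM2l ?exprn_ge0 ?cmod_ge0//.
  rewrite ler_wpM2l ?cmod_ge0//.
  have q1 : cmod h / r <= 1 / 2 by rewrite ler_pdivrMr//; lra.
  have q0 : 0 <= cmod h / r by rewrite divr_ge0 ?cmod_ge0// ltW.
  rewrite -(big_mkord xpredT (geometric M (cmod h / r))).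
  have qn1 : cmod h / r != 1 by lra.
  rewrite -[leLHS]/(series (geometric M (cmod h / r)) n) (geometric_seriesE _ qn1).
  rewrite /= -mulr_natr -mulrA ler_wpM2l// ler_pdivrMr; last by lra.
  have : 0 <= (cmod h / r) ^+ n by rewrite exprn_ge0.
  lra.
have hc : (fun n => cmod (\sum_(k < n + m.+1) a k * h ^+ k)) @ \oo --> (0 : R).
  have := cvg_cmod (cvg_psum hsh); rewrite ph cmod0.
  by rewrite -(cvg_shiftn m.+1).
have : cmod h ^+ m * (cmod (a m) - cmod h * (M *+ 2)) <= 0.
  rewrite -(cvg_lim _ hc)//; apply: limr_ge; first by apply/cvg_ex; eexists; exact: hc.
  by near=> n; exact: hn.
by rewrite pmulr_rle0 ?exprn_gt0// subr_le0.
Unshelve. all: by end_near. Qed.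

End PowerSeries.

(** * Measurable complex functions and orthogonal series *)

Definition cmeas (R : realType) d (T : measurableType d) (f : T -> R[i]) : Prop :=
  measurable_fun [set: T] (fun x => complex.Re (f x)) /\
  measurable_fun [set: T] (fun x => complex.Im (f x)).

(** The real inner product of the plane; orthogonality of complex random variables is
    expressed with it, so that no complex-valued integral is needed. *)
Definition dotc (R : realType) (z w : R[i]) : R :=
  complex.Re z * complex.Re w + complex.Im z * complex.Im w.

Section ComplexMeasurable.
Context {R : realType} d (T : measurableType d).
Implicit Types (f g : T -> R[i]).

Lemma cmeas_cst (z : R[i]) : cmeas (fun _ : T => z).
Proof. by split; exact: measurable_cst. Qed.

Lemma cmeasD f g : cmeas f -> cmeas g -> cmeas (fun x => f x + g x).
Proof.
move=> [fr fi] [gr gi]; split.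
  by under eq_fun do rewrite ReD; exact: measurable_funD.
by under eq_fun do rewrite ImD; exact: measurable_funD.
Qed.

Lemma Re_mul (z w : R[i]) :
  complex.Re (z * w) = complex.Re z * complex.Re w - complex.Im z * complex.Im w.
Proof. by case: z => ? ?; case: w. Qed.

Lemma Im_mul (z w : R[i]) :
  complex.Im (z * w) = complex.Re z * complex.Im w + complex.Im z * complex.Re w.
Proof. by case: z => ? ?; case: w. Qed.

Lemma cmeasM f g : cmeas f -> cmeas g -> cmeas (fun x => f x * g x).
Proof.
move=> [fr fi] [gr gi]; split.
  by under eq_fun do rewrite Re_mul; apply: measurable_funB; exact: measurable_funM.
by under eq_fun do rewrite Im_mul; apply: measurable_funD; exact: measurable_funM.
Qed.

Lemma cmeasX f n : cmeas f -> cmeas (fun x => f x ^+ n).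
Proof.
move=> mf; elim: n => [|n IH]; first by under eq_fun do rewrite expr0; exact: cmeas_cst.
by under eq_fun do rewrite exprS; exact: cmeasM.
Qed.

Lemma cmeas_sum (F : nat -> T -> R[i]) m n :
  (forall k, cmeas (F k)) -> cmeas (fun x => \sum_(m <= k < n) F k x).
Proof.
move=> mF; split.
  by under eq_fun do rewrite Re_sum; apply: measurable_sum => k; have [] := mF k.
by under eq_fun do rewrite Im_sum; apply: measurable_sum => k; have [] := mF k.
Qed.

Lemma cmeas_sum_ord (F : nat -> T -> R[i]) n :
  (forall k, cmeas (F k)) -> cmeas (fun x => \sum_(k < n) F k x).
Proof.
move=> mF; have := cmeas_sum 0 n mF.
by under eq_fun do rewrite big_mkord.
Qed.

Lemma measurable_cmod f : cmeas f -> measurable_fun [set: T] (fun x => cmod (f x)).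
Proof.
move=> [fr fi]; rewrite (_ : (fun x => _) =
   Num.sqrt \o (fun x => complex.Re (f x) ^+ 2 + complex.Im (f x) ^+ 2)); last first.
  by apply/funext => x; rewrite /= -cmod_sqr sqrtr_sqr ger0_norm ?cmod_ge0.
apply: measurableT_comp.
  by apply: continuous_measurable_fun; exact: sqrt_continuous.
by apply: measurable_funD; exact: measurable_funX.
Qed.

Lemma measurable_dotc f g : cmeas f -> cmeas g ->
  measurable_fun [set: T] (fun x => dotc (f x) (g x)).
Proof.
by move=> [fr fi] [gr gi]; apply: measurable_funD; exact: measurable_funM.
Qed.

Lemma cmeas_comp d' (T' : measurableType d') (h : T' -> T) f :
  measurable_fun [set: T'] h -> cmeas f -> cmeas (f \o h).
Proof.
move=> mh [fr fi]; split.
  by apply: (measurableT_comp (f := fun x => complex.Re (f x))).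
by apply: (measurableT_comp (f := fun x => complex.Im (f x))).
Qed.

End ComplexMeasurable.

Section FatouOrthogonal.
Context {R : realType} d (T : measurableType d) (mu : {measure set T -> \bar R}).
Variables (D : set T) (mD : measurable D).
Local Open Scope ereal_scope.

Lemma fatou_bound (f : nat -> T -> R) (g : T -> R) (C : \bar R) :
  (forall n, measurable_fun D (f n)) ->
  (forall n x, D x -> (0 <= f n x)%R) ->
  (forall x, D x -> (fun n => f n x) @ \oo --> g x) ->
  (forall n, \int[mu]_(x in D) (f n x)%:E <= C) ->
  \int[mu]_(x in D) (g x)%:E <= C.
Proof.
move=> mf f0 fg fC.
have -> : \int[mu]_(x in D) (g x)%:E =
    \int[mu]_(x in D) limn_einf (fun n => (f n x)%:E).
  apply: eq_integral => x; rewrite inE => Dx.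
  have h : (fun n => (f n x)%:E) @ \oo --> (g x)%:E.
    by apply: cvg_EFin (fg _ Dx); exact: nearW.
  by rewrite is_cvg_limn_einfE ?(cvg_lim _ h)//; apply/cvg_ex; eexists; exact: h.
apply: le_trans (fatou mu mD _ _) _.
- by move=> n; apply/measurable_EFinP.
- by move=> n x Dx; rewrite lee_fin f0.
rewrite limn_einf_lim; apply: lime_le; first exact: is_cvg_einfs.
apply: nearW => n; apply: le_trans (fC n).
by rewrite /einfs /sdrop; apply: ereal_inf_lbound; exists n => /=.
Qed.

Lemma cmodD_sqr (z w : R[i]) :
  (cmod (z + w) ^+ 2 = cmod z ^+ 2 + 2 * dotc z w + cmod w ^+ 2)%R.
Proof. by rewrite !cmod_sqr ReD ImD /dotc; ring. Qed.

Lemma dotc_suml I (s : seq I) (P : pred I) (F : I -> R[i]) w :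
  (dotc (\sum_(i <- s | P i) F i) w = \sum_(i <- s | P i) dotc (F i) w)%R.
Proof.
by rewrite /dotc Re_sum Im_sum !mulr_suml -big_split.
Qed.

Lemma dotc_le (z w : R[i]) : (`|dotc z w| <= cmod z ^+ 2 + cmod w ^+ 2)%R.
Proof.
rewrite ler_norml !cmod_sqr /dotc.
case: z w => a b [c e] /=.
have := sqr_ge0 (a + c); have := sqr_ge0 (a - c).
have := sqr_ge0 (b + e); have := sqr_ge0 (b - e).
have := sqr_ge0 a; have := sqr_ge0 b; have := sqr_ge0 c; have := sqr_ge0 e.
move=> *; apply/andP; split; nra.
Qed.

Variables (Z : nat -> T -> R[i]) (s : nat -> R) (v : R).
Hypotheses (mZ : forall k, cmeas (Z k))
  (Z2 : forall k, \int[mu]_(x in D) (cmod (Z k x) ^+ 2)%:E = (v * s k ^+ 2)%:E)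
  (ZZ : forall j k, j != k -> \int[mu]_(x in D) (dotc (Z j x) (Z k x))%:E = 0).

Let intZ2 k : mu.-integrable D (fun x => (cmod (Z k x) ^+ 2)%:E).
Proof.
apply/integrableP; split.
  by apply/measurable_EFinP/measurable_funTS/measurable_funX/measurable_cmod.
under eq_integral => x _ do rewrite gee0_abs ?lee_fin ?exprn_ge0 ?cmod_ge0//.
by rewrite Z2 ltry.
Qed.

Let int_dot j k : mu.-integrable D (fun x => (dotc (Z j x) (Z k x))%:E).
Proof.
apply: (le_integrable mD _ _ (integrableD mD (intZ2 j) (intZ2 k))).
  by apply/measurable_EFinP/measurable_funTS/measurable_dotc.
move=> x _; rewrite /= lee_fin; apply: le_trans (dotc_le _ _) _.
by rewrite ger0_norm// addr_ge0 ?exprn_ge0 ?cmod_ge0.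
Qed.

Lemma orthogonal_sum m n :
  mu.-integrable D (fun x => (cmod (\sum_(m <= k < n) Z k x)%R ^+ 2)%:E) /\
  \int[mu]_(x in D) (cmod (\sum_(m <= k < n) Z k x)%R ^+ 2)%:E
  = (v * \sum_(m <= k < n) s k ^+ 2)%:E.
Proof.
have base n' : (n' <= m)%N ->
  mu.-integrable D (fun x => (cmod (\sum_(m <= k < n') Z k x)%R ^+ 2)%:E) /\
  \int[mu]_(x in D) (cmod (\sum_(m <= k < n') Z k x)%R ^+ 2)%:E
  = (v * \sum_(m <= k < n') s k ^+ 2)%:E.
  move=> nm; rewrite (_ : (fun x : T => _) = cst 0); last first.
    by apply/funext => x; rewrite big_geq// cmod0 expr0n.
  by rewrite integral0 big_geq// mulr0; split=> //; exact: integrable0.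
elim: n => [|n [IHi IH]]; first exact: base.
case: (leqP m n) => mn; last exact: base.
have e x : (cmod (\sum_(m <= k < n.+1) Z k x)%R ^+ 2)%:E =
  ((cmod (\sum_(m <= k < n) Z k x)%R ^+ 2)%:E +
  2%:E * \sum_(m <= k < n) (dotc (Z k x) (Z n x))%:E) + (cmod (Z n x) ^+ 2)%:E.
  by rewrite big_nat_recr//= cmodD_sqr dotc_suml sumEFin -EFinM -!EFinD.
have i1 : mu.-integrable D (fun x => \sum_(m <= k < n) (dotc (Z k x) (Z n x))%:E).
  by apply: integrable_sum.
have i2 := integrableZl mD 2 i1.
have i3 := integrableD mD IHi i2.
under eq_fun do rewrite e;
split; first exact: (integrableD mD i3 (intZ2 n)).
rewrite integralD// integralD// integralZl// integral_sum//.
rewrite big_nat big1 ?mule0 ?adde0; last first.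
  by move=> k /andP[_ kn]; rewrite ZZ// ltn_eqF.
by rewrite IH Z2 -EFinD big_nat_recr//= mulrDr.
Qed.

(** The first bound is Fatou's lemma. For the second, the same lemma shows that S is
    within v (L - sum_(k < m) (s k)^2) of its m-th partial sum in mean square; as
    |S_m|^2 <= 2 |S|^2 + 2 |S - S_m|^2, letting m grow leaves the factor 2. Only the
    order of magnitude matters in the sequel. *)
Lemma orthogonal_limit (S : T -> R[i]) (L : R) : (0 <= v)%R ->
  (fun n => \sum_(0 <= k < n) s k ^+ 2)%R @ \oo --> L ->
  (forall x, D x ->
    (fun n => (\sum_(k < n) Z k x)%R : R[i]^o) @ \oo --> (S x : R[i]^o)) ->
  \int[mu]_(x in D) (cmod (S x) ^+ 2)%:E <= (v * L)%:E /\
  (v * L)%:E <= 2%:E * \int[mu]_(x in D) (cmod (S x) ^+ 2)%:E.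
Proof.
move=> v0 hL hS.
have hS' x : D x ->
    (fun n => (\sum_(0 <= k < n) Z k x)%R : R[i]^o) @ \oo --> (S x : R[i]^o).
  by move=> Dx; under eq_fun do rewrite big_mkord; exact: hS.
have mS : measurable_fun D (fun x => cmod (S x)).
  apply: (measurable_fun_cvg (h := fun n x => cmod (\sum_(0 <= k < n) Z k x)%R)).
    by move=> n; apply/measurable_funTS/measurable_cmod/cmeas_sum.
  by move=> x Dx; apply: cvg_cmod; exact: hS'.
have nds : nondecreasing_seq (fun n => \sum_(0 <= k < n) s k ^+ 2)%R.
  by apply: nondecreasing_series => k _ _; exact: sqr_ge0.
have sL n : (\sum_(0 <= k < n) s k ^+ 2 <= L)%R.
  rewrite -(cvg_lim _ hL)//; apply: nondecreasing_cvgn_le => //.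
  by apply/cvg_ex; exists L.
have tail m : \int[mu]_(x in D) (cmod (S x - \sum_(0 <= k < m) Z k x)%R ^+ 2)%:E
    <= (v * (L - \sum_(0 <= k < m) s k ^+ 2))%:E.
  apply: (@fatou_bound (fun n x =>
     cmod (\sum_(0 <= k < n + m) Z k x - \sum_(0 <= k < m) Z k x)%R ^+ 2)%R).
  - move=> n; apply/measurable_funTS/measurable_funX/measurable_cmod.
    rewrite (_ : (fun x => _) = fun x => \sum_(m <= k < n + m) Z k x)%R.
      exact: cmeas_sum.
    apply/funext => x; rewrite (big_cat_nat (n := m)) ?leq_addl//=.
    by rewrite [LHS]addrC addKr.
  - by move=> n x _; rewrite exprn_ge0 ?cmod_ge0.
  - move=> x Dx; rewrite expr2; under eq_fun do rewrite expr2.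
    have h : (fun n => cmod (\sum_(0 <= k < n + m) Z k x - \sum_(0 <= k < m) Z k x)%R) @ \oo
       --> cmod (S x - \sum_(0 <= k < m) Z k x)%R.
      have hm := hS' x Dx; rewrite -(cvg_shiftn m) in hm.
      by apply: cvg_cmod; exact: (@cvgB _ R[i]^o _ _ _ _ _ _ _ hm (cvg_cst _)).
    exact: cvgM.
  - move=> n.
    under eq_integral => x _.
      rewrite (big_cat_nat (n := m)) ?leq_addl//= [X in cmod X]addrC addKr; over.
    rewrite (orthogonal_sum m (n + m)).2 lee_fin ler_wpM2l//.
    rewrite lerBrDl; have := sL (n + m)%N.
    by rewrite (big_cat_nat (n := m)) ?leq_addl.
split.
  have := tail 0%N; rewrite big_geq// subr0.
  by under eq_integral do rewrite big_geq// subr0.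
have mSB m : measurable_fun D (fun x => cmod (S x - \sum_(0 <= k < m) Z k x)%R).
  apply: (measurable_fun_cvg
    (h := fun n x => cmod (\sum_(0 <= k < n) Z k x - \sum_(0 <= k < m) Z k x)%R)).
    move=> n; apply/measurable_funTS/measurable_cmod/cmeasD; first exact: cmeas_sum.
    have := cmeasM (cmeas_cst T (-1)%R) (cmeas_sum 0 m mZ).
    by under eq_fun do rewrite mulN1r.
  move=> x Dx; apply: cvg_cmod.
  exact: (@cvgB _ R[i]^o _ _ _ _ _ _ _ (hS' x Dx) (cvg_cst _)).
have up m : (v * \sum_(0 <= k < m) s k ^+ 2)%:E <=
   2%:E * \int[mu]_(x in D) (cmod (S x) ^+ 2)%:E +
   2%:E * (v * (L - \sum_(0 <= k < m) s k ^+ 2))%:E.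
  rewrite -(orthogonal_sum 0 m).2.
  apply: (@le_trans _ _ (\int[mu]_(x in D) (2%:E * (cmod (S x) ^+ 2)%:E +
      2%:E * (cmod (S x - \sum_(0 <= k < m) Z k x)%R ^+ 2)%:E))).
    apply: ge0_le_integral => //.
    - by move=> x _; rewrite lee_fin exprn_ge0 ?cmod_ge0.
    - by apply/measurable_EFinP/measurable_funTS/measurable_funX/measurable_cmod/cmeas_sum.
    - by apply: emeasurable_funD; apply: measurable_funeM;
        apply/measurable_EFinP/measurable_funX.
    - move=> x _; rewrite -!EFinM -EFinD lee_fin.
      set A := S x; set B := (\sum_(0 <= k < m) Z k x)%R.
      rewrite !cmod_sqr; case: A B => a b [c e] /=.
      have := sqr_ge0 (2 * a - c); have := sqr_ge0 (2 * b - e).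
      rewrite !sqrrB !exprMn -!mulrA; nra.
  rewrite ge0_integralD//; last 4 first.
  - by move=> x _; rewrite -EFinM lee_fin mulr_ge0// exprn_ge0 ?cmod_ge0.
  - by apply: measurable_funeM; apply/measurable_EFinP/measurable_funX.
  - by move=> x _; rewrite -EFinM lee_fin mulr_ge0// exprn_ge0 ?cmod_ge0.
  - by apply: measurable_funeM; apply/measurable_EFinP/measurable_funX.
  rewrite !ge0_integralZl//; last 4 first.
  - by apply/measurable_EFinP/measurable_funX.
  - by move=> x _; rewrite lee_fin exprn_ge0 ?cmod_ge0.
  - by apply/measurable_EFinP/measurable_funX.
  - by move=> x _; rewrite lee_fin exprn_ge0 ?cmod_ge0.
  by rewrite leeD2l// lee_pmul2l//; exact: tail.
move: up; set I := \int[mu]_(x in D) _.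
have : 0 <= I by apply: integral_ge0 => x _; rewrite lee_fin exprn_ge0 ?cmod_ge0.
case: I => [r r0 up|_ _|//]; last by rewrite gt0_muley ?lte_fin// leey.
rewrite -EFinM lee_fin.
have h1 : (fun m => v * \sum_(0 <= k < m) s k ^+ 2)%R @ \oo --> (v * L)%R.
  by apply: cvgM => //; exact: cvg_cst.
have h2 : (fun m => 2 * r + 2 * (v * (L - \sum_(0 <= k < m) s k ^+ 2)))%R @ \oo -->
    (2 * r + 2 * (v * (L - L)))%R.
  apply: cvgD; first exact: cvg_cst.
  apply: cvgM; first exact: cvg_cst.
  apply: cvgM; first exact: cvg_cst.
  by apply: cvgB => //; exact: cvg_cst.
rewrite subrr !mulr0 addr0 in h2.
rewrite -(cvg_lim _ h1)// -(cvg_lim _ h2)//; apply: ler_lim.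
- by apply/cvg_ex; eexists; exact: h1.
- by apply/cvg_ex; eexists; exact: h2.
- by apply: nearW => m; have := up m; rewrite -!EFinM -EFinD lee_fin.
Qed.

End FatouOrthogonal.

(** * Parseval and Cauchy estimates on circles *)

(** Up to constants, the mean of |f|^2 over the circle of radius r, and also the mean
    square modulus of the random series at any point of that circle. *)
Definition sig2 (R : realType) (a : nat -> R[i]) (r : R) : R :=
  limn (series (fun k => (cmod (a k) * r ^+ k) ^+ 2)).

Section Parseval.
Context {R : realType}.
Implicit Types (a : nat -> R[i]) (r t m : R).
Local Notation leb := (@lebesgue_measure R).

Lemma expi_sum t u : expi (t + u) = expi t * expi u :> R[i].
Proof. by rewrite /expi cosD sinD; congr (_ +i* _); rewrite addrC mulrC [X in _ + X]mulrC addrC // mulrC. Qed.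

Lemma expiX t k : expi t ^+ k = expi (k%:R * t) :> R[i].
Proof.
elim: k => [|k IH]; first by rewrite expr0 mul0r /expi cos0 sin0.
by rewrite exprS IH -expi_sum -natr1 mulrDl mul1r addrC.
Qed.

Lemma cmeas_expi : cmeas (fun t : R => expi t).
Proof.
by split; apply: continuous_measurable_fun; [exact: continuous_cos|exact: continuous_sin].
Qed.

Lemma trig_period j k : cos ((j%:R - k%:R) * (2 * pi)) = 1 :> R /\
  sin ((j%:R - k%:R) * (2 * pi)) = 0 :> R.
Proof.
have cn n : cos (n%:R * (2 * pi)) = 1 :> R.
  rewrite (_ : n%:R * (2 * pi) = 0 + pi *+ 2 *+ n); first by rewrite (periodicn (@cosD2pi R)) cos0.
  by rewrite add0r -[RHS]mulr_natl -(mulr_natl pi 2).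
have sn n : sin (n%:R * (2 * pi)) = 0 :> R.
  rewrite (_ : n%:R * (2 * pi) = 0 + pi *+ 2 *+ n); first by rewrite (periodicn (@sinD2pi R)) sin0.
  by rewrite add0r -[RHS]mulr_natl -(mulr_natl pi 2).
by rewrite mulrBl cosB sinB !cn !sn; split; ring.
Qed.

Lemma integral_trig (A B : R) j k : j != k ->
  (\int[leb]_(t in `[0%R, (2 * pi)%R])
    (A * cos ((j%:R - k%:R) * t) + B * sin ((j%:R - k%:R) * t))%:E = 0)%E.
Proof.
move=> jk; set m : R := j%:R - k%:R.
have m0 : m != 0 by rewrite subr_eq0 eqr_nat.
pose F t := m^-1 * (A * sin (m * t) - B * cos (m * t)).
have dm t : is_derive t 1 (fun t => m * t) m.
  by rewrite -[X in is_derive _ _ _ X]mulr1; apply: is_deriveZ.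
have ds t : is_derive t 1 (fun t => sin (m * t)) (m * cos (m * t)).
  by rewrite mulrC; apply: (@is_derive1_comp _ sin (fun t => m * t)).
have dc t : is_derive t 1 (fun t => cos (m * t)) (m * - sin (m * t)).
  by rewrite mulrC; apply: (@is_derive1_comp _ cos (fun t => m * t)).
have dF t : is_derive t 1 F (A * cos (m * t) + B * sin (m * t)).
  have h : is_derive t 1 F (m^-1 * (A * (m * cos (m * t)) - B * (m * - sin (m * t)))).
    have s1 : is_derive t 1 (fun t => A * sin (m * t)) (A * (m * cos (m * t))).
      exact: is_deriveZ.
    have s2 : is_derive t 1 (fun t => B * cos (m * t)) (B * (m * - sin (m * t))).
      exact: is_deriveZ.
    have s3 := is_deriveB s1 s2.
    exact: (is_deriveZ m^-1 s3).
  by apply: is_derive_eq; field.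
have cF : continuous F.
  by move=> t; apply: differentiable_continuous; apply/derivable1_diffP; apply: ex_derive.
have cf : continuous (fun t => A * cos (m * t) + B * sin (m * t)).
  move=> t; apply: differentiable_continuous; apply/derivable1_diffP.
  by apply: derivableD; apply: derivableZ; apply: ex_derive.
rewrite (@continuous_FTC2 _ _ F).
- have [c2 s2] := trig_period j k.
  by rewrite /F !mulr0 c2 s2 sin0 cos0 subee.
- by rewrite mulr_gt0 ?pi_gt0.
- by apply: continuous_in_subspaceT => x ?; exact: cf.
- split.
  + by move=> x _; apply: ex_derive.
  + by apply: cvg_at_right_filter; exact: cF.
  + by apply: cvg_at_left_filter; exact: cF.
- by move=> x _; rewrite derive1E; apply: derive_val.
Qed.

Lemma summable_nonneg_cvg a r : summable_at a r -> 0 <= r ->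
  cvgn (series (fun k => (cmod (a k) * r ^+ k) ^+ 2)).
Proof.
move=> hs r0; have [M M0 hM] := summable_bounded r0 hs.
have p k : 0 <= cmod (a k) * r ^+ k by rewrite mulr_ge0 ?cmod_ge0 ?exprn_ge0.
apply: (@series_le_cvg _ _ (fun k => M * (cmod (a k) * r ^+ k))).
- by move=> n; exact: sqr_ge0.
- by move=> n; exact: mulr_ge0.
- by move=> n; rewrite expr2 ler_wpM2r.
- exact: (@is_cvg_seriesZ R _ M hs).
Qed.

Lemma cmeas_psum_term a r k : cmeas (fun t => a k * (r%:C * expi t) ^+ k).
Proof.
apply: cmeasM; first exact: cmeas_cst.
by apply: cmeasX; apply: cmeasM; [exact: cmeas_cst|exact: cmeas_expi].
Qed.

Lemma cmod_circle r t : 0 <= r -> cmod (r%:C * expi t) = r.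
Proof. by move=> r0; rewrite cmodM cmod_expi mulr1 cmod_real ger0_norm. Qed.

(** Orthogonality of the exponentials, in the form of orthogonal_limit; hence the
    factor 2 instead of an identity. *)
Lemma parseval a r : 0 <= r -> summable_at a r ->
  let I := (\int[leb]_(t in `[0%R, (2 * pi)%R])
    (cmod (psum a (r%:C * expi t)) ^+ 2)%:E)%E in
  (I <= (2 * pi * sig2 a r)%:E)%E /\ ((2 * pi * sig2 a r)%:E <= 2%:E * I)%E.
Proof.
move=> r0 hs I.
have pi2 : 0 <= 2 * pi :> R by rewrite mulr_ge0 ?pi_ge0.
apply: (@orthogonal_limit R _ _ leb `[0%R, (2 * pi)%R] _
   (fun k t => a k * (r%:C * expi t) ^+ k)
   (fun k => cmod (a k) * r ^+ k) (2 * pi) _ _ _ (fun t => psum a (r%:C * expi t))) => //.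
- by move=> k; exact: cmeas_psum_term.
- move=> k; under eq_integral do rewrite cmodM cmodX (cmod_circle _ r0).
  rewrite (integral_cst leb _ (((cmod (a k) * r ^+ k) ^+ 2)%:E))//.
  by rewrite /= lebesgue_measure_itv /= lte_fin mulr_gt0 ?pi_gt0// sube0 -EFinM mulrC.
- move=> j k jk.
  pose A := r ^+ (j + k) * (complex.Re (a j) * complex.Re (a k) + complex.Im (a j) * complex.Im (a k)).
  pose B := r ^+ (j + k) * (complex.Re (a j) * complex.Im (a k) - complex.Im (a j) * complex.Re (a k)).
  rewrite -(integral_trig A B jk); apply: eq_integral => t _; congr EFin.
  rewrite !exprMn !expiX mulrBl cosB sinB /A /B /dotc.
  have rC i : r%:C ^+ i = (r ^+ i)%:C by rewrite rmorphXn.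
  rewrite !rC !Re_mul !Im_mul /= exprD.
  by case: (a j) (a k) => a1 a2 [b1 b2] /=; ring.
- exact: (summable_nonneg_cvg hs r0).
- by move=> t _; apply: cvg_psum; rewrite cmod_circle.
Qed.

Lemma sig2_term_le a r n : 0 <= r -> summable_at a r ->
  (cmod (a n) * r ^+ n) ^+ 2 <= sig2 a r.
Proof.
move=> r0 hs; have hc := summable_nonneg_cvg hs r0.
apply: (@le_trans _ _ (series (fun k => (cmod (a k) * r ^+ k) ^+ 2) n.+1)).
  by rewrite /series /= big_nat_recr//= lerDr sumr_ge0// => i _; exact: sqr_ge0.
by apply: nondecreasing_cvgn_le => //; apply: nondecreasing_series => k _ _; exact: sqr_ge0.
Qed.

(** Drawn from parseval, since one term of sig2 is at most the whole sum. *)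
Lemma cauchy_estimate a r M n : 0 <= r -> summable_at a r -> 0 <= M ->
  (forall t, 0 <= t <= 2 * pi -> cmod (psum a (r%:C * expi t)) <= M) ->
  cmod (a n) * r ^+ n <= 2 * M.
Proof.
move=> r0 hs M0 hM; have [_ h] := parseval r0 hs.
have pi2 : 0 < 2 * pi :> R by rewrite mulr_gt0 ?pi_gt0.
have mS : measurable_fun `[0, 2 * pi] (fun t => cmod (psum a (r%:C * expi t))).
  apply: (measurable_fun_cvg
    (h := fun n t => cmod (\sum_(k < n) a k * (r%:C * expi t) ^+ k))).
    move=> m; apply/measurable_funTS/measurable_cmod.
    apply: (@cmeas_sum_ord R _ _ (fun k t => a k * (r%:C * expi t) ^+ k)) => k.
    exact: cmeas_psum_term.
  by move=> t _; apply: cvg_cmod; apply: cvg_psum; rewrite cmod_circle.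
have : ((2 * pi * sig2 a r)%:E <= 2%:E * (2 * pi * M ^+ 2)%:E)%E.
  apply: (le_trans h); rewrite lee_pmul2l//.
  apply: (@le_trans _ _ (\int[leb]_(t in `[0%R, (2 * pi)%R]) (M ^+ 2)%:E)%E).
    apply: ge0_le_integral => //.
    - by move=> t _; rewrite lee_fin sqr_ge0.
    - by apply/measurable_EFinP/measurable_funX.
    - move=> t; rewrite /= in_itv /= => ht; rewrite lee_fin lerXn2r ?nnegrE ?cmod_ge0//.
      exact: hM.
  rewrite (integral_cst leb _ ((M ^+ 2)%:E))//= lebesgue_measure_itv /= lte_fin pi2 sube0.
  by rewrite -EFinM mulrC.
rewrite -EFinM lee_fin mulrCA ler_pM2l// => hsig.
rewrite -ler_sqr ?nnegrE ?mulr_ge0 ?cmod_ge0 ?exprn_ge0//.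
apply: (le_trans (sig2_term_le n r0 hs)); apply: (le_trans hsig).
have := sqr_ge0 M; rewrite exprMn; lra.
Qed.

Lemma polar (z : R[i]) : exists2 t, 0 <= t <= 2 * pi & z = (cmod z)%:C * expi t.
Proof.
have [->|z0] := eqVneq z 0.
  by exists 0; [rewrite lexx mulr_ge0 ?pi_ge0|rewrite cmod0 mul0r].
have c0 : 0 < cmod z by rewrite lt_def cmod_eq0 z0 cmod_ge0.
pose x := complex.Re z / cmod z.
have x1 : -1 <= x <= 1.
  by rewrite -ler_norml /x normrM normfV (gtr0_norm c0) ler_pdivrMr// mul1r Re_le_cmod.
have e : Num.sqrt (1 - x ^+ 2) = `|complex.Im z| / cmod z.
  have -> : 1 - x ^+ 2 = (complex.Im z / cmod z) ^+ 2.
    rewrite /x !expr_div_n cmod_sqr; field.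
    by rewrite -cmod_sqr expf_neq0// gt_eqF.
  by rewrite sqrtr_sqr normrM normfV (gtr0_norm c0).
have ap := acos_lepi x1; have a0 := acos_ge0 x1; have p0 := @pi_gt0 R.
have cx : cos (acos x) = x by apply: acosK; rewrite in_itv.
have sx := sin_acos x1.
case: (lerP 0 (complex.Im z)) => im.
  exists (acos x); first by lra.
  rewrite /expi cx sx e (ger0_norm im) /x; apply/eqP; rewrite eq_complex Re_mul Im_mul /=.
  by apply/andP; split; apply/eqP; field; rewrite gt_eqF.
exists (2 * pi - acos x); first by lra.
have c2 : cos (2 * pi) = 1 :> R by have := cos2pi R; rewrite -(mulr_natl pi 2).
have s2 : sin (2 * pi) = 0 :> R by have := sin2pi R; rewrite -(mulr_natl pi 2).
rewrite /expi cosB sinB c2 s2 cx sx e (ltr0_norm im) /x; apply/eqP.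
rewrite eq_complex Re_mul Im_mul /=.
by apply/andP; split; apply/eqP; field; rewrite gt_eqF.
Qed.

End Parseval.

(** * Taylor expansion on the whole disk *)

Section GlobalExpansion.
Context {R : realType}.
Implicit Types (a b : nat -> R[i]) (c h z : R[i]) (f g : R[i] -> R[i]) (r : R).

(** Isolated zeros, applied to the difference of the two series. *)
Lemma power_series_unique f g c r r' a b : 0 < r -> 0 < r' ->
  power_series_on f c r a -> power_series_on g c r' b ->
  (forall e, 0 < e -> exists h, 0 < cmod h < e /\ f (c + h) = g (c + h)) ->
  a = b.
Proof.
move=> r0 r'0 hf hg fg.
pose s := Num.min r r' / 2.
have m0 : 0 < Num.min r r' by rewrite lt_min r0.
have s0 : 0 < s by rewrite divr_gt0.
have sr : s < r by rewrite (@lt_le_trans _ _ (Num.min r r'))// ?ge_min ?lexx// /s; lra.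
have sr' : s < r' by rewrite (@lt_le_trans _ _ (Num.min r r'))// ?ge_min ?lexx ?orbT// /s; lra.
have ha : summable_at a s by apply: power_series_summable hf _ _; rewrite (ltW s0).
have hb : summable_at b s by apply: power_series_summable hg _ _; rewrite (ltW s0).
have hd : summable_at (fun k => a k - b k) s.
  apply: (@series_le_cvg _ _ ((fun k => cmod (a k) * s ^+ k) + (fun k => cmod (b k) * s ^+ k))).
  - by move=> n; rewrite mulr_ge0 ?cmod_ge0 ?exprn_ge0 ?(ltW s0).
  - by move=> n; rewrite /= addr_ge0// mulr_ge0 ?cmod_ge0 ?exprn_ge0 ?(ltW s0).
  - move=> n; rewrite /= -mulrDl ler_wpM2r ?exprn_ge0 ?(ltW s0)//.
    by apply: le_trans (le_cmodD _ _) _; rewrite cmodN.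
  - exact: is_cvg_seriesD.
apply/funext => k; apply/eqP; rewrite -subr_eq0; apply/eqP; move: k.
apply: (power_series_eq0 s0 hd) => e e0.
have [h [/andP[h0]]] := fg _ (ltac:(rewrite lt_min e0 s0//) : 0 < Num.min e s).
rewrite lt_min => /andP[he hs] efg; exists h; rewrite h0 he; split=> //.
have le_s d : summable_at d s -> summable_at d (cmod h).
  by apply: summable_le; rewrite cmod_ge0 ltW.
have fa := hf (c + h); rewrite addrC addKr (lt_trans hs sr) in fa.
have gb := hg (c + h); rewrite addrC addKr (lt_trans hs sr') in gb.
apply: cvgC_unique (cvg_psum (le_s _ hd)) _.
have e1 : (fun n => \sum_(k < n) (a k - b k) * h ^+ k) =
    (fun n => \sum_(k < n) a k * h ^+ k - \sum_(k < n) b k * h ^+ k).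
  by apply/funext => n; rewrite -sumrB; apply: eq_bigr => k _; rewrite mulrBl.
have fa' := fa isT; rewrite efg in fa'.
have hl : (fun n => \sum_(k < n) a k * h ^+ k - \sum_(k < n) b k * h ^+ k : R[i]^o)
    @ \oo --> (g (c + h) - g (c + h) : R[i]^o).
  exact: (@cvgB _ R[i]^o _ _ _ _ _ _ _ fa' (gb isT)).
by rewrite subrr -e1 in hl.
Qed.

(** For fixed k, the recentered coefficient is itself a power series in the centre, so
    that Cauchy's estimate applies to it. *)
Lemma psum_recenter_coeff a r c k : (forall s, 0 <= s < r -> summable_at a s) ->
  cmod c < r ->
  let al := fun i => a (i + k)%N *+ 'C(i + k, k) in
  summable_at al (cmod c) /\ psum al c = recenter a c k.
Proof.
move=> hs cr al; have c0 := cmod_ge0 c.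
pose d := (r - cmod c) / 4.
have d0 : 0 < d by rewrite /d; lra.
have sal : summable_at al (cmod c).
  have s2 : 0 <= cmod c + d + d by lra.
  have s2r : cmod c + d + d < r by rewrite /d; lra.
  have [M M0 hM] := summable_bounded s2 (hs _ (introT andP (conj s2 s2r))).
  apply: (@bounded_summable _ _ _ (cmod c + d) (M / d ^+ k)); first by lra.
  move=> i; rewrite ler_pdivlMr ?exprn_gt0//.
  apply: le_trans (hM (i + k)%N).
  rewrite /al -mulr_natr cmodM cmod_natr -!mulrA ler_wpM2l ?cmod_ge0//.
  have := @binom_term_le _ (cmod c + d) d (i + k) k.
  rewrite addnK -mulr_natl; apply; lra.
split=> //.
have cdr : 0 <= cmod c + d < r by apply/andP; split; rewrite /d; lra.
have [hrec _] := @cvg_recenter _ a c d k d0 (hs _ cdr).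
apply: cvgC_unique (cvg_psum sal) _.
rewrite -(cvg_shiftn k) in hrec.
rewrite (_ : (fun n => _) = fun n => \sum_(j < n + k) a j * c ^+ (j - k) *+ 'C(j, k))//.
apply/funext => n.
rewrite -[RHS](big_mkord xpredT (fun j => a j * c ^+ (j - k) *+ 'C(j, k))).
rewrite (big_cat_nat (n := k)) ?leq_addl//= big_nat [X in _ = X + _]big1 ?add0r; last first.
  by move=> j /andP[_ jk]; rewrite bin_small.
rewrite -{1}[k]add0n big_addn addnK big_mkord; apply: eq_bigr => i _.
by rewrite addnK mulrnAl.
Qed.

Lemma recenter_coeff_bound a r rho B k : (forall s, 0 <= s < r -> summable_at a s) ->
  0 <= rho < r -> 0 <= B ->
  (forall t, 0 <= t <= 2 * pi -> cmod (recenter a (rho%:C * expi t) k) <= B) ->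
  forall j, (k <= j)%N -> cmod (a j) * rho ^+ (j - k) *+ 'C(j, k) <= 2 * B.
Proof.
move=> hs /andP[r0 rr] B0 hB j kj.
have h t : cmod (rho%:C * expi t) < r by rewrite cmod_circle.
have [s1 _] := psum_recenter_coeff k hs (h 0); rewrite cmod_circle// in s1.
have := @cauchy_estimate _ _ _ _ (j - k)%N r0 s1 B0.
rewrite subnK// -(mulr_natr (a j)) cmodM cmod_natr mulrAC mulr_natr; apply.
by move=> t ht; rewrite (psum_recenter_coeff k hs (h t)).2; exact: hB.
Qed.

Lemma expi_near (t0 e : R) : 0 < e -> \forall t \near t0, cmod (expi t - expi t0) < e.
Proof.
move=> e0; have e20 : 0 < e / 2 by rewrite divr_gt0.
have := @continuous_cos R t0; move/cvgrPdist_lt => /(_ _ e20) h1.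
have := @continuous_sin R t0; move/cvgrPdist_lt => /(_ _ e20) h2.
near=> t; apply: le_lt_trans (cmod_le_ReIm _) _.
rewrite (splitr e) ltrD//=.
  by rewrite distrC; near: t.
by rewrite distrC; near: t.
Unshelve. all: by end_near. Qed.

Lemma power_series_shrink f c r r' a : r' <= r ->
  power_series_on f c r a -> power_series_on f c r' a.
Proof. by move=> rr h z hz; apply: h; exact: lt_le_trans rr. Qed.

(** The expansion of f at a point of the circle of radius rho, recentered, gives the
    coefficients at all nearby interior points and bounds them geometrically. The
    single integer N measures both the size of the coefficients and the distance to
    the circle, which is the form required by compactness. *)
Lemma local_coeff_bound f rho a (t0 : R) : 0 < rho -> rho < 1 ->
  power_series_on f 0 rho a -> analytic_on_disk f ->
  \forall t \near t0 & N \near \oo, forall s k, 0 < s ->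
    rho - N.+1%:R^-1 < s < rho ->
    cmod (recenter a (s%:C * expi t) k) <= N.+1%:R ^+ k.+1.
Proof.
move=> rho0 rho1 hf han.
have hc0 : cmod (rho%:C * expi t0) < 1 by rewrite cmod_circle ?(ltW rho0).
have [r [b [r0 hb]]] := han _ hc0; set c0 := rho%:C * expi t0 in hb hc0 *.
have r2 : 0 < r / 2 by lra.
have sb := power_series_summable hb.
pose C := limn (series (fun j => cmod (b j) * (r / 2) ^+ j)).
have r80 : 0 < r / 8 by lra.
(* an arc and a radial distance of r / 8 keep the new centre within r / 4 of c0 *)
exists ([set t | cmod (expi t - expi t0) < r / 8],
  [set N : nat | [/\ C <= N%:R, 8 / r <= N%:R & 1 <= N%:R :> R]]).
  split; first exact: expi_near.
  near=> N; split; near: N; exact: nbhs_infty_ger.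
move=> [t N] [/= ht [hN1 hN2 hN3]] s k s0 /andP[hs1 hs2].
have N0 : 0 < N.+1%:R :> R by rewrite ltr0n.
have N1 : N.+1%:R^-1 <= r / 8.
  rewrite -[leRHS]invrK lef_pV2 ?posrE ?invr_gt0 ?divr_gt0//.
  by rewrite invf_div; apply: le_trans hN2 _; rewrite ler_nat.
have {}hs1 : rho - r / 8 < s by apply: le_lt_trans hs1; rewrite lerB.
set c := s%:C * expi t; pose h := c - c0.
have hr4 : cmod h < r / 4.
  rewrite /h /c /c0 (_ : _ - _ = (s - rho)%:C * expi t + rho%:C * (expi t - expi t0)); last first.
    by rewrite rmorphB /=; ring.
  apply: le_lt_trans (le_cmodD _ _) _; rewrite !cmodM cmod_expi !cmod_real mulr1.
  rewrite (gtr0_norm rho0) ltr0_norm ?subr_lt0// opprB.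
  have : rho * cmod (expi t - expi t0) <= r / 8.
    rewrite -[leRHS]mul1r ler_pM ?cmod_ge0 ?(ltW rho0) ?(ltW rho1) ?(ltW ht)//.
  lra.
have -> : recenter a c = recenter b h.
  have hc : cmod c = s by rewrite cmod_circle ?(ltW s0).
  have h1 : power_series_on f c (rho - s) (recenter a c).
    have := @power_series_recenter _ f 0 rho a c hf; rewrite add0r hc; exact.
  have h2 : power_series_on f c (r - cmod h) (recenter b h).
    have hr : cmod h < r by lra.
    have := @power_series_recenter _ f c0 r b h hb hr.
    have -> : c0 + h = c by rewrite /h addrCA subrr addr0.
    exact.
  apply: (power_series_unique _ _ h1 h2); [lra|lra|].
  move=> e e0; exists (e / 2)%:C; rewrite cmod_real gtr0_norm ?divr_gt0//; split=> //.
  by apply/andP; split; lra.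
have r40 : 0 < r / 4 by lra.
have hh : cmod h + r / 4 <= r / 2 by lra.
have sh : summable_at b (cmod h + r / 4) by apply: sb; have := cmod_ge0 h; lra.
have [_ hk] := cvg_recenter k r40 sh.
have CC : limn (series (fun j => cmod (b j) * (cmod h + r / 4) ^+ j)) <= C.
  apply: lim_series_le; [exact: sh|by apply: sb; lra|].
  move=> n; rewrite ler_wpM2l ?cmod_ge0// lerXn2r ?nnegrE//; last by lra.
  by have := cmod_ge0 h; lra.
have r4k : 0 < (r / 4) ^+ k by rewrite exprn_gt0.
rewrite -(ler_pM2r r4k); apply: (le_trans hk); apply: (le_trans CC).
rewrite exprS -mulrA -exprMn; apply: (@le_trans _ _ N.+1%:R).
  by apply: le_trans hN1 _; rewrite ler_nat.
rewrite ler_peMr ?(ltW N0)// exprn_ege1//.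
rewrite -[leLHS](mulVf (lt0r_neq0 N0)) mulrC ler_wpM2l ?(ltW N0)//; apply: le_trans N1 _; lra.
Unshelve. all: by end_near. Qed.

(** If the power series at 0 converges beyond radius rho, then its sum agrees with f
    near each point of the circle: both functions have expansions there, and these
    coincide by the agreement inside the circle. *)
Lemma local_extension f g rho rho' a (t0 : R) : 0 < rho -> rho < 1 -> rho < rho' ->
  power_series_on f 0 rho a -> power_series_on g 0 rho' a -> analytic_on_disk f ->
  \forall t \near t0 & N \near \oo, forall s,
    rho <= s < rho + N.+1%:R^-1 -> f (s%:C * expi t) = g (s%:C * expi t).
Proof.
move=> rho0 rho1 rr hf hg han.
have hc : cmod (rho%:C * expi t0) = rho by rewrite cmod_circle ?(ltW rho0).
have hc0 : cmod (rho%:C * expi t0) < 1 by rewrite hc.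
have [r [b [r0 hb]]] := han _ hc0; set c0 := rho%:C * expi t0 in hb hc hc0 *.
have hg0 : power_series_on g c0 (rho' - rho) (recenter a c0).
  by have := @power_series_recenter _ g 0 rho' a c0 hg; rewrite add0r hc; exact.
have fg z : cmod z < rho -> f z = g z.
  move=> zr; have h1 := hf z; have h2 := hg z; rewrite !subr0 in h1 h2.
  exact: cvgC_unique (h1 zr) (h2 (lt_trans zr rr)).
have ba : b = recenter a c0.
  apply: (power_series_unique r0 _ hb hg0); first by rewrite subr_gt0.
  move=> e e0; pose q := Num.min (e / 2) (rho / 2).
  have q0 : 0 < q by rewrite lt_min !divr_gt0.
  have qe : q <= e / 2 by rewrite ge_min lexx.
  have qr : q <= rho / 2 by rewrite ge_min lexx orbT.
  exists (- (q%:C * expi t0)); rewrite cmodN cmod_circle ?(ltW q0)//; split.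
    by rewrite q0 /=; lra.
  apply: fg; rewrite (_ : c0 - q%:C * expi t0 = (rho - q)%:C * expi t0); last first.
    by rewrite /c0 -mulrBl rmorphB.
  rewrite cmod_circle; lra.
pose e := Num.min r (rho' - rho).
have e0 : 0 < e by rewrite lt_min r0 subr_gt0.
have e20 : 0 < e / 4 by rewrite divr_gt0.
exists ([set t | cmod (expi t - expi t0) < e / 4],
  [set N : nat | 4 / e <= N%:R]).
  split; first exact: expi_near.
  exact: nbhs_infty_ger.
move=> [t N] [/= ht hN] s /andP[hs1 hs2].
have N0 : 0 < N.+1%:R :> R by rewrite ltr0n.
have N1 : N.+1%:R^-1 <= e / 4.
  rewrite -[leRHS]invrK lef_pV2 ?posrE ?invr_gt0 ?divr_gt0//.
  by rewrite invf_div; apply: le_trans hN _; rewrite ler_nat.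
have {}hs2 : s < rho + e / 4 by apply: lt_le_trans hs2 _; rewrite lerD2l.
set z := s%:C * expi t.
have hz : cmod (z - c0) < e.
  rewrite /z /c0 (_ : _ - _ = (s - rho)%:C * expi t + rho%:C * (expi t - expi t0)); last first.
    by rewrite rmorphB /=; ring.
  apply: le_lt_trans (le_cmodD _ _) _; rewrite !cmodM cmod_expi !cmod_real mulr1.
  rewrite (gtr0_norm rho0) ger0_norm ?subr_ge0//.
  have : rho * cmod (expi t - expi t0) <= e / 4.
    by rewrite -[leRHS]mul1r ler_pM ?cmod_ge0 ?(ltW rho0) ?(ltW rho1) ?(ltW ht).
  lra.
move: hz; rewrite lt_min => /andP[hz1 hz2].
apply: cvgC_unique (hb z hz1) _; rewrite ba; exact: hg0.
Qed.

(** Compactness of [0, 2 pi], in a form that yields one integer for all angles. *)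
Lemma covering_circle (P : nat -> R -> Prop) :
  (forall t : R, \forall t' \near t & N \near \oo, P N t') ->
  exists N, forall t, 0 <= t <= 2 * pi -> P N t.
Proof.
move=> hP; have := @segment_compact R 0 (2 * pi).
move/compact_near_coveringP => /(_ nat \oo P _ (fun t _ => hP t)) [N _ hN].
exists N => t ht; apply: (hN N) => //=.
Qed.

(** Let rho be the largest radius at most 1 on which the expansion at 0 represents f.
    If rho < 1, compactness of the circle makes local_coeff_bound uniform. Cauchy's
    estimate turns the bounds N^(k+1) on the k-th coefficients at distance s from the
    origin into |a_j| 'C(j, k) s^(j-k) <= 2 N^(k+1). Multiplying by (1/(2N))^k and
    summing over k bounds |a_j| (s + 1/(2N))^j, so that the series converges on a
    larger disk, and local_extension identifies its sum with f there. *)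
Theorem analytic_power_series f : analytic_on_disk f ->
  exists a, power_series_on f 0 1 a.
Proof.
move=> han.
have h0 : unit_disk (0 : R[i]) by rewrite /unit_disk /mkset cmod0 ltr01.
have [r0 [a [r00 ha]]] := han 0 h0.
exists a.
pose E := [set s | 0 < s <= 1 /\ power_series_on f 0 s a].
have E0 : E (Num.min r0 1).
  split; first by rewrite lt_min r00 ltr01 ge_min lexx orbT.
  by apply: power_series_shrink ha; rewrite ge_min lexx.
have supE : has_sup E.
  split; first by exists (Num.min r0 1).
  by exists 1 => s [/andP[]].
pose rho := sup E.
have rho0 : 0 < rho.
  case: (E0) => /andP[h _] _; apply: lt_le_trans h _; exact: ub_le_sup supE.2 _ E0.
have rhole1 : rho <= 1.
  by apply: ge_sup; [exact: supE.1|move=> s [/andP[]]].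
have hrho : power_series_on f 0 rho a.
  move=> z hz; have [s Es zs] := sup_gt supE.1 hz.
  by case: Es => _; apply.
suff : ~~ (rho < 1) by rewrite -leNgt => h1; apply: power_series_shrink hrho.
apply/negP => rho1.
have [N hN] := covering_circle (fun t0 => local_coeff_bound t0 rho0 rho1 hrho han).
have := ltr0Sn R N; move: hN; move: (N.+1%:R : R) => n1 hN n10.
have n1V : 0 < n1^-1 by rewrite invr_gt0.
(* s is within 1/(4 n1) of rho, so that s + 1/(2 n1) exceeds rho by at
   least 1/(4 n1) *)
pose eta := Num.min (n1^-1 / 4) (rho / 2).
have eta0 : 0 < eta by rewrite lt_min !divr_gt0.
have eta1 : eta <= n1^-1 / 4 by rewrite ge_min lexx.
have eta2 : eta <= rho / 2 by rewrite ge_min lexx orbT.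
pose s := rho - eta.
have s0 : 0 < s by rewrite /s; lra.
have srho : 0 <= s < rho by apply/andP; split; rewrite /s; lra.
have sN : rho - n1^-1 < s < rho by apply/andP; split; rewrite /s; lra.
pose dl := n1^-1 / 2.
have dl0 : 0 < dl by rewrite /dl; lra.
have hB : forall j, cmod (a j) * (s + dl) ^+ j <= 4 * n1.
  move=> j; rewrite exprDn mulr_sumr.
  apply: (@le_trans _ _ (\sum_(k < j.+1) (geometric (2 * n1) (1 / 2)) k)); last first.
    rewrite -(big_mkord xpredT (geometric (2 * n1) (1 / 2))).
    have q1 : 1 / 2 != 1 :> R by lra.
    rewrite -[leLHS]/(series (geometric (2 * n1) (1 / 2)) j.+1) (geometric_seriesE _ q1) /=.
    rewrite ler_pdivrMr; last by lra.
    apply: (@le_trans _ _ (2 * n1)); last by lra.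
    by rewrite ler_piMr ?mulr_ge0 ?(ltW n10)// lerBlDr lerDl exprn_ge0.
  apply: ler_sum => k _; have kj := leq_ord k.
  have hk := @recenter_coeff_bound a rho s (n1 ^+ k.+1) k (power_series_summable hrho)
    srho (exprn_ge0 _ (ltW n10)) (fun t ht => hN t ht s k s0 sN) j kj.
  rewrite -mulrnAl mulrA /dl exprMn exprVn /=.
  rewrite mulrnAr -[X in X * _ <= _]mulrnAr mulrnAr.
  rewrite mulrA; apply: ler_pM => //.
  - by rewrite mulr_ge0 ?mulrn_wge0 ?mulr_ge0 ?cmod_ge0 ?exprn_ge0 ?invr_ge0 ?exprn_ge0 ?(ltW s0) ?(ltW n10).
  - by rewrite ler_pdivrMr ?exprn_gt0// -mulrA -exprS.
  - by rewrite div1r.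
pose rho' := rho + n1^-1 / 4.
have hs' : forall u, 0 <= u < rho' -> summable_at a u.
  move=> u /andP[u0 ur]; apply: (bounded_summable _ hB); rewrite u0 /=.
  by apply: lt_le_trans ur _; rewrite /rho' /s /dl; lra.
have hg : power_series_on (psum a) 0 rho' a.
  by apply/(power_series_psum _ _ hs') => z _; rewrite subr0.
have rr' : rho < rho' by rewrite /rho'; lra.
have [N' hN'] := covering_circle (fun t0 => local_extension t0 rho0 rho1 rr' hrho hg han).
have n2V : 0 < N'.+1%:R^-1 :> R by rewrite invr_gt0 ltr0Sn.
pose rho2 := Num.min (Num.min rho' (rho + N'.+1%:R^-1)) 1.
have rho2E : rho < rho2 by rewrite !lt_min rho1 rr' ltrDl n2V.
have : E rho2.
  split; first by rewrite (lt_trans rho0 rho2E) ge_min lexx orbT.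
  move=> z; rewrite !lt_min => /andP[/andP[hz1 hz2] hz3].
  suff -> : f z = psum a z by exact: hg.
  rewrite subr0 in hz1 hz2 hz3.
  case: (ltP (cmod z) rho) => hz.
    have := hrho z; rewrite subr0 => /(_ hz) h1.
    have := hg z; rewrite subr0 => /(_ hz1) h2.
    exact: cvgC_unique h1 h2.
  have [t ht ->] := polar z; apply: hN' => //.
  by rewrite hz.
by move/(ub_le_sup supE.2); rewrite leNgt -/rho rho2E.
Qed.

End GlobalExpansion.

(** * Integrals of products of independent functions *)

Section MonotoneClass.
Context {R : realType} du (U : measurableType du).
Local Open Scope ereal_scope.
Import HBNNSimple.

Section one_side.
Context d (T : measurableType d) (mu : {measure set T -> \bar R}).
Variables (D : set T) (mD : measurable D) (phi : T -> U) (Z : T -> R).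
Hypotheses (mphi : measurable_fun setT phi) (mZ : measurable_fun D Z)
  (Z0 : forall x, (0 <= Z x)%R).

Let mcomp (h : U -> R) : measurable_fun setT h -> measurable_fun D (h \o phi).
Proof. by move=> mh; apply: measurable_funTS; exact: measurableT_comp. Qed.

Lemma weighted_simple_integral (f : {nnsfun U >-> R}) :
  \int[mu]_(x in D) (f (phi x) * Z x)%:E =
  \sum_(i < #|` fset_set (range f)|) ((fset_set (range f))`_i)%:E *
    \int[mu]_(x in D) (\1_(f @^-1` [set (fset_set (range f))`_i]) (phi x) * Z x)%:E.
Proof.
set s := fset_set (range f).
have mI i : measurable (f @^-1` [set s`_i]) by exact: measurable_sfunP.
have s0 (i : 'I_(#|` s|)) : (0 <= s`_i)%R.
  have : s`_i \in s by exact: mem_nth.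
  by rewrite in_fset_set// => /set_mem[x _ <-]; exact: fun_ge0.
have m1 i : measurable_fun D (fun x => (\1_(f @^-1` [set s`_i]) (phi x) * Z x)%:E).
  apply/measurable_EFinP/measurable_funM => //.
  by apply: (mcomp (h := \1_(f @^-1` [set s`_i]))); exact: measurable_indic.
have p1 i x : 0 <= (\1_(f @^-1` [set s`_i]) (phi x) * Z x)%:E.
  by rewrite lee_fin mulr_ge0.
under eq_integral => x _.
  rewrite fimfunEord mulr_suml -sumEFin; over.
rewrite /= -/s ge0_integral_sum//=; last 2 first.
- move=> i; apply/measurable_EFinP/measurable_funM => //.
  apply: (mcomp (h := fun u => (s`_i * \1_(f @^-1` [set s`_i]) u)%R)).
  by apply: measurable_funM => //; exact: measurable_indic.
- by move=> i x _; rewrite lee_fin !mulr_ge0.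
apply: eq_bigr => i _.
under eq_integral do rewrite -mulrA EFinM.
by rewrite ge0_integralZl ?lee_fin.
Qed.

Lemma weighted_integral_limit (g : U -> R)
  (mg : measurable_fun setT (EFin \o g)) : (forall u, (0 <= g u)%R) ->
  \int[mu]_(x in D) (g (phi x) * Z x)%:E =
  limn (fun n => \int[mu]_(x in D) (nnsfun_approx measurableT mg n (phi x) * Z x)%:E).
Proof.
move=> g0; set gn := nnsfun_approx measurableT mg.
rewrite -monotone_convergence//.
- apply: eq_integral => x _; apply/esym/cvg_lim => //.
  have := @cvg_nnsfun_approx _ _ _ _ measurableT _ mg _ (phi x) I.
  move=> /(_ (fun u _ => _ : 0 <= (EFin \o g) u)) h.
  under eq_fun do rewrite EFinM.
  rewrite EFinM; apply: cvgeZr => //; apply: h => u.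
  by rewrite /= lee_fin.
- move=> n; apply/measurable_EFinP/measurable_funM => //.
  exact: (mcomp (h := gn n)).
- by move=> n x _; rewrite lee_fin mulr_ge0.
- move=> x _ m n mn; rewrite lee_fin ler_wpM2r//.
  by have /lefP := @nd_nnsfun_approx _ _ _ _ measurableT _ mg m n mn.
Qed.

End one_side.

(** Two linear functionals of g that agree on indicators agree on nonnegative functions.
    Each side carries its own space, map and density, so that the lemma serves both
    for independence and for the change of variables to the law of a variable. *)
Lemma monotone_class_integral
  d1 (T1 : measurableType d1) (mu1 : {measure set T1 -> \bar R}) (D1 : set T1)
  (phi1 : T1 -> U) (Z1 : T1 -> R)
  d2 (T2 : measurableType d2) (mu2 : {measure set T2 -> \bar R}) (D2 : set T2)
  (phi2 : T2 -> U) (Z2 : T2 -> R) :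
  measurable D1 -> measurable_fun setT phi1 -> measurable_fun D1 Z1 ->
  (forall x, (0 <= Z1 x)%R) ->
  measurable D2 -> measurable_fun setT phi2 -> measurable_fun D2 Z2 ->
  (forall x, (0 <= Z2 x)%R) ->
  (forall B, measurable B -> \int[mu1]_(x in D1) (\1_B (phi1 x) * Z1 x)%:E =
     \int[mu2]_(x in D2) (\1_B (phi2 x) * Z2 x)%:E) ->
  forall g : U -> R, measurable_fun setT g -> (forall u, (0 <= g u)%R) ->
  \int[mu1]_(x in D1) (g (phi1 x) * Z1 x)%:E =
     \int[mu2]_(x in D2) (g (phi2 x) * Z2 x)%:E.
Proof.
move=> mD1 mp1 mZ1 Z10 mD2 mp2 mZ2 Z20 hB g mg g0.
have mg' : measurable_fun setT (EFin \o g) by exact/measurable_EFinP.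
rewrite (weighted_integral_limit mu1 mD1 mp1 mZ1 Z10 mg' g0).
rewrite (weighted_integral_limit mu2 mD2 mp2 mZ2 Z20 mg' g0).
congr (limn _); apply/funext => n.
rewrite weighted_simple_integral// weighted_simple_integral//.
by apply: eq_bigr => i _; rewrite hB.
Qed.

End MonotoneClass.

Section Independence.
Context {R : realType} d (T : measurableType d) (P : probability T R).
Variable X : nat -> T -> R[i].
Hypotheses (mX : forall n, complex_random_variable (X n))
  (iX : mutually_independent P X).
Local Open Scope ereal_scope.
Local Notation U := (R * R)%type.

Let mprod (J : seq nat) (h : nat -> U -> R) : (forall k, measurable_fun setT (h k)) ->
  measurable_fun [set: T] (fun w => \prod_(k <- J) h k (cpair (X k w)))%R.
Proof.
move=> mh; elim: J => [|j J IH].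
  by under eq_fun do rewrite big_nil; exact: measurable_cst.
under eq_fun do rewrite big_cons; apply: measurable_funM => //.
exact: (measurableT_comp (mh j) (mX j)).
Qed.

Let mevent k (A : set U) : measurable A -> measurable [set w | A (cpair (X k w))].
Proof. by move=> mA; have := mX k measurableT mA; rewrite setTI. Qed.

(** Indicators are replaced by general functions one index at a time: the indices in J1
    already carry the functions g, those in J2 still carry events. *)
Lemma independent_prod_indic (J1 J2 : seq nat) (g : nat -> U -> R) (m : nat -> R)
    (B : nat -> set U) : uniq (J1 ++ J2) ->
  (forall k, measurable_fun setT (g k)) -> (forall k u, (0 <= g k u)%R) ->
  (forall k, measurable (B k)) ->
  (forall k, \int[P]_w (g k (cpair (X k w)))%:E = (m k)%:E) ->
  \int[P]_w (\prod_(k <- J1) g k (cpair (X k w)) *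
     \prod_(k <- J2) \1_(B k) (cpair (X k w)))%:E =
  (\prod_(k <- J1) m k)%:E * \prod_(k <- J2) P [set w | B k (cpair (X k w))].
Proof.
move=> uJ mg g0; elim: J1 J2 B uJ => [|j J1 IH] J2 B uJ mB hm.
  under eq_integral do rewrite big_nil mul1r.
  rewrite big_nil mul1e -iX//.
  have -> : (fun w : T => (\prod_(k <- J2) (\1_(B k) (cpair (X k w)) : R))%:E : \bar R) =
    fun w => (\1_[set w | forall n, n \in J2 -> B n (cpair (X n w))] w : R)%:E.
    apply/funext => w; congr EFin.
    have [h|] := pselect (forall n, n \in J2 -> B n (cpair (X n w))).
      rewrite indicE mem_set// big_seq big1// => k kJ.
      by rewrite indicE mem_set//; exact: h.
    move=> nh; rewrite indicE memNset//.
    move/existsNP : nh => [k /not_implyP[kJ nB]].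
    by rewrite (big_rem k)//= indicE memNset// mul0r.
  rewrite integral_indic//= ?setIT//.
  rewrite (_ : [set w | _] = \big[setI/setT]_(n <- J2) ((fun w => cpair (X n w)) @^-1` B n)).
    elim/big_ind : _ => // [A A' mA mA'|k _]; first exact: measurableI.
    exact: mevent.
  rewrite -bigcap_seq; apply/seteqP; split => w /=.
    by move=> h n /= nJ; exact: h.
  by move=> h n nJ; exact: h.
(* the event attached to the index j is arbitrary, hence so is the function, by the
   monotone class argument *)
have [uj uJ'] : j \notin J1 ++ J2 /\ uniq (J1 ++ J2) by apply/andP.
pose Z w := (\prod_(k <- J1) g k (cpair (X k w)) *
     \prod_(k <- J2) \1_(B k) (cpair (X k w)))%R.
pose c := fine ((\prod_(k <- J1) m k)%:E * \prod_(k <- J2) P [set w | B k (cpair (X k w))]).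
have cE : c%:E = (\prod_(k <- J1) m k)%:E * \prod_(k <- J2) P [set w | B k (cpair (X k w))].
  rewrite /c fineK// fin_numM//.
  apply: prode_fin_num => k _; apply: fin_num_measure.
  exact: mevent.
have mZ : measurable_fun setT Z.
  apply: measurable_funM; first exact: mprod.
  by apply: (@mprod J2 (fun k => \1_(B k))) => k; exact: measurable_indic.
have Z0 w : (0 <= Z w)%R.
  by rewrite mulr_ge0//; apply: prodr_ge0.
have c0 : (0 <= c)%R.
  rewrite -lee_fin cE -IH//.
  by apply: integral_ge0 => w _; rewrite lee_fin; exact: Z0.
have step A : measurable A ->
    \int[P]_w (\1_A (cpair (X j w)) * Z w)%:E = \int[P]_w (\1_A (cpair (X j w)) * c)%:E.
  move=> mA; pose B' k := if k == j then A else B k.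
  have mB' k : measurable (B' k) by rewrite /B'; case: ifP.
  have uJ2 : uniq (J1 ++ j :: J2).
    by rewrite uniq_catC /= mem_cat orbC -mem_cat uj uniq_catC.
  have BB : {in J2, B' =1 B}.
    move=> k kJ; rewrite /B'; case: eqP => // kj.
    by move: uj; rewrite -kj mem_cat kJ orbT.
  have := IH (j :: J2) B' uJ2 mB' hm.
  have Bj : B' j = A by rewrite /B' eqxx.
  rewrite big_cons Bj => h.
  transitivity (P [set w | A (cpair (X j w))] * c%:E).
    rewrite cE muleCA (eq_big_seq (fun k => P [set w | B' k (cpair (X k w))])); last first.
      by move=> k kJ /=; rewrite BB.
    rewrite -h; apply: eq_integral => w _; rewrite big_cons Bj /Z.
    rewrite mulrCA; congr (_ * (_ * _))%:E%R; apply: eq_big_seq => k kJ.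
    by rewrite BB.
  under eq_integral do rewrite EFinM.
  rewrite ge0_integralZr ?lee_fin//=; last first.
    by apply/measurable_EFinP; apply: (measurableT_comp _ (mX j)); exact: measurable_indic.
  congr (_ * _); have := integral_indic P measurableT (mevent j mA).
  rewrite setIT => <-; apply: eq_integral => w _; rewrite !indicE.
  by congr (_%:R)%:E; apply/idP/idP; rewrite !inE.
have := @monotone_class_integral R _ U _ T P setT (fun w => cpair (X j w)) Z
  _ T P setT (fun w => cpair (X j w)) (cst c) measurableT (mX j) mZ Z0
  measurableT (mX j) (measurable_cst _) (fun _ => c0) step (g j) (mg j) (g0 j).
rewrite /= => h.
under eq_integral do rewrite big_cons -mulrA.
rewrite h; under eq_integral do rewrite EFinM.
rewrite ge0_integralZr ?lee_fin//=; last 2 first.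
  by apply/measurable_EFinP; exact: (measurableT_comp (mg j) (mX j)).
  by move=> w _; rewrite lee_fin.
by rewrite hm cE big_cons EFinM muleA.
Qed.

Lemma independent_prod (J : seq nat) (g : nat -> U -> R) (m : nat -> R) : uniq J ->
  (forall k, measurable_fun setT (g k)) -> (forall k u, (0 <= g k u)%R) ->
  (forall k, \int[P]_w (g k (cpair (X k w)))%:E = (m k)%:E) ->
  \int[P]_w (\prod_(k <- J) g k (cpair (X k w)))%:E = (\prod_(k <- J) m k)%:E.
Proof.
move=> uJ mg g0 hm.
have := @independent_prod_indic J [::] g m (fun _ => setT).
rewrite cats0 => /(_ uJ mg g0 (fun _ => measurableT) hm).
rewrite big_nil mule1 => <-.
by apply: eq_integral => w _; rewrite big_nil mulr1.
Qed.

End Independence.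

(** * Standard random variables are subgaussian *)

(** Gives a subgaussian bound for bounded centered variables: the term x integrates to 0. *)
Lemma expR_quadratic (R : realType) (x : R) : expR x <= x + expR (2 * x ^+ 2).
Proof.
have [x2|x2] := lerP x (1 / 2); last first.
  have h : expR x <= expR (2 * x ^+ 2).
    by rewrite ler_expR; nra.
  lra.
have h1 : 1 + 2 * x ^+ 2 <= expR (2 * x ^+ 2) by exact: expR_ge1Dx.
have h2 : 1 - x <= expR (- x) by exact: expR_ge1Dx.
have x1 : 0 < 1 - x by lra.
suff : expR x <= 1 + x + 2 * x ^+ 2 by lra.
rewrite -[expR x]invrK -expRN.
apply: (@le_trans _ _ (1 - x)^-1); first by rewrite lef_pV2 ?posrE ?expR_gt0.
rewrite -[leLHS]mul1r ler_pdivrMr//.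
rewrite (_ : (1 + x + 2 * x ^+ 2) * (1 - x) = 1 + x ^+ 2 * (1 - 2 * x)); last by ring.
by rewrite lerDl mulr_ge0 ?sqr_ge0//; lra.
Qed.

Section Laws.
Context {R : realType} d (T : measurableType d) (P : probability T R).
Variable Y : T -> R[i].
Hypothesis mY : complex_random_variable Y.
Local Notation leb := (@lebesgue_measure R).
Local Notation U := (R * R)%type.

Lemma cmeas_rv : cmeas Y.
Proof.
split.
  exact: (measurableT_comp (measurable_fst (T1 := R) (T2 := R)) mY).
exact: (measurableT_comp (measurable_snd (T1 := R) (T2 := R)) mY).
Qed.

Lemma cmeas_of_cpair : cmeas (fun u : U => of_cpair u).
Proof. by split; [exact: measurable_fst|exact: measurable_snd]. Qed.

Lemma of_cpairK (z : R[i]) : of_cpair (cpair z) = z.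
Proof. by case: z. Qed.

Lemma measurable_event (B : set U) : measurable B -> measurable [set w | B (cpair (Y w))].
Proof. by move=> mB; have := mY measurableT mB; rewrite setTI. Qed.

Local Open Scope ereal_scope.

(** Change of variables from the variable Y to any description of its law. *)
Lemma law_integral d2 (T2 : measurableType d2) (mu2 : {measure set T2 -> \bar R})
  (D2 : set T2) (phi2 : T2 -> R[i]) (Z2 : T2 -> R) :
  measurable D2 -> cmeas phi2 -> measurable_fun D2 Z2 -> (forall x, (0 <= Z2 x)%R) ->
  (forall B : set U, measurable B -> P [set w | B (cpair (Y w))] =
     \int[mu2]_(x in D2 `&` [set x | B (cpair (phi2 x))]) (Z2 x)%:E) ->
  forall g : R[i] -> R, measurable_fun setT (fun u : U => g (of_cpair u)) ->
    (forall z, (0 <= g z)%R) ->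
  \int[P]_w (g (Y w))%:E = \int[mu2]_(x in D2) (g (phi2 x) * Z2 x)%:E.
Proof.
move=> mD2 [mr mi] mZ2 Z20 hB g mg g0.
have mphi : measurable_fun setT (fun x => cpair (phi2 x)) by apply: measurable_fun_pair.
have := @monotone_class_integral R _ U _ T P setT (fun w => cpair (Y w)) (cst 1%R)
  _ T2 mu2 D2 (fun x => cpair (phi2 x)) Z2 measurableT mY (measurable_cst _)
  (fun _ => ler01) mD2 mphi mZ2 Z20 _ (fun u => g (of_cpair u)) mg
  (fun u => g0 (of_cpair u)).
have step (B : set U) : measurable B ->
    \int[P]_w (\1_B (cpair (Y w)) * cst 1%R w)%:E =
    \int[mu2]_(x in D2) (\1_B (cpair (phi2 x)) * Z2 x)%:E.
  move=> mB; transitivity (P [set w | B (cpair (Y w))]).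
    have := integral_indic P measurableT (measurable_event mB); rewrite setIT => <-.
    apply: eq_integral => w _; rewrite !indicE mulr1.
    by congr (_%:R)%:E; apply/idP/idP; rewrite !inE.
  rewrite hB// integral_mkcondr; apply: eq_integral => x _.
  rewrite /patch indicE; case: ifPn => h.
    by rewrite (_ : (_ \in B) = true) ?mul1r//; move: h; rewrite !inE.
  by rewrite (_ : (_ \in B) = false) ?mul0r//; apply: contraNF h; rewrite !inE.
move=> /(_ step); under eq_integral do rewrite of_cpairK mulr1.
by move=> ->; apply: eq_integral => x _; rewrite of_cpairK.
Qed.

Lemma bernoulli_integral (g : R[i] -> R) : bernoulli_variable P Y ->
  measurable_fun setT (fun u : U => g (of_cpair u)) -> (forall z, (0 <= g z)%R) ->
  \int[P]_w (g (Y w))%:E = ((g 1 + g (-1)) / 2)%:E.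
Proof.
move=> [P1 PN1] mg g0.
have mset (z : R[i]) : measurable [set w | Y w = z].
  have mz : measurable [set cpair z].
    by rewrite (_ : [set cpair z] = [set complex.Re z] `*` [set complex.Im z]);
      [exact: measurableX|apply/seteqP; split => -[a b] /= [-> ->]].
  rewrite (_ : [set w | Y w = z] = [set w | [set cpair z] (cpair (Y w))]).
    exact: measurable_event.
  apply/seteqP; split => w /=; first by move=> ->.
  by case: (Y w) => a b; case: z {mz} => a' b' [-> ->].
set A := [set w | Y w = 1%R] in P1; set B := [set w | Y w = (-1)%R] in PN1.
have mA : measurable A by exact: mset.
have mB : measurable B by exact: mset.
have dAB : A `&` B = set0.
  rewrite -subset0 => w [/= h1 h2]; have : (1 = -1 :> R[i])%R by rewrite -[LHS]h1 -[RHS]h2.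
  by case=> /eqP; rewrite -subr_eq0 opprK -(natrD _ 1 1) pnatr_eq0.
have PAB : P (A `|` B) = 1.
  rewrite measureU// [X in X + _]P1 [X in _ + X]PN1 -EFinD; congr EFin; lra.
have mgY : measurable_fun setT (fun w => (g (Y w))%:E).
  apply/measurable_EFinP.
  have := measurableT_comp mg mY; rewrite (_ : _ \o _ = fun w => g (Y w))//.
  by apply/funext => w /=; rewrite of_cpairK.
have PN : P (~` (A `|` B)) = 0.
  by rewrite probability_setC ?PAB ?subee//; exact: measurableU.
rewrite (ge0_negligible_integral (N := ~` (A `|` B)))//; last 2 first.
- exact: measurableC (measurableU _ _ mA mB).
- by move=> w _; rewrite lee_fin.
rewrite setTD setCK ge0_integral_setU//; last 3 first.
- exact: measurable_funTS.
- by move=> w _; rewrite lee_fin.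
- by rewrite disj_set2E dAB.
rewrite (eq_integral (cst (g 1)%:E)); last by move=> w; rewrite inE /A /= => ->.
rewrite [X in _ + X](eq_integral (cst (g (-1))%:E)); last by move=> w; rewrite inE /B /= => ->.
rewrite !integral_cst//.
rewrite [X in _ * X + _]P1 [X in _ + _ * X]PN1 -!EFinM -EFinD; congr EFin; by rewrite mulrDl.
Qed.

Lemma steinhaus_integral (g : R[i] -> R) : steinhaus_variable P Y ->
  measurable_fun setT (fun u : U => g (of_cpair u)) -> (forall z, (0 <= g z)%R) ->
  \int[P]_w (g (Y w))%:E =
  \int[leb]_(t in `[0%R, (2 * pi)%R]) (g (expi t) * (2 * pi)^-1)%:E.
Proof.
move=> sY mg g0.
have p0 : (0 <= (2 * pi)^-1 :> R)%R by rewrite invr_ge0 mulr_ge0 ?pi_ge0.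
apply: (law_integral (Z2 := cst (2 * pi)^-1%R)) => //.
- exact: cmeas_expi.
- move=> B mB; rewrite sY// (integral_cst leb _ ((2 * pi)^-1%:E)); first by [].
  apply: measurableI => //.
  have [mr mi] := @cmeas_expi R.
  have := measurable_fun_pair mr mi.
  by move=> /(_ measurableT B mB); rewrite setTI.
Qed.

Lemma gaussian_integral (g : R[i] -> R) : gaussian_variable P Y ->
  measurable_fun setT (fun u : U => g (of_cpair u)) -> (forall z, (0 <= g z)%R) ->
  \int[P]_w (g (Y w))%:E = \int[leb]_x (g x%:C * normal_pdf 0 1 x)%:E.
Proof.
move=> gY mg g0.
apply: (@law_integral _ _ leb setT (fun x : R => x%:C) (normal_pdf 0%R 1%R) measurableT _ _ _ _ g mg g0).
- by split => /=; [exact: measurable_id|exact: measurable_cst].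
- exact: measurable_normal_pdf.
- by move=> x; exact: normal_pdf_ge0.
- by move=> B mB; rewrite gY// setTI.
Qed.

End Laws.

(** The common ground of the three kinds of random variables: an equal second moment v
    and a Gaussian bound for the Laplace transform of every real linear form. Centering
    is not listed, as it follows from the last condition. *)
Definition subgaussian_sequence (R : realType) d (T : measurableType d)
    (P : probability T R) (X : nat -> T -> R[i]) (v : R) : Prop :=
  [/\ forall n, complex_random_variable (X n), mutually_independent P X,
    forall k, (\int[P]_w (cmod (X k w) ^+ 2)%:E = v%:E)%E &
    forall k b, (\int[P]_w (expR (complex.Re (b * X k w)))%:E
      <= (expR (2 * cmod b ^+ 2))%:E)%E].

Section StandardSubgaussian.
Context {R : realType} d (T : measurableType d) (P : probability T R).
Local Notation leb := (@lebesgue_measure R).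
Local Notation U := (R * R)%type.
Local Open Scope ereal_scope.

Lemma measurable_cmod2 : measurable_fun setT (fun u : U => cmod (of_cpair u) ^+ 2)%R.
Proof. by apply: measurable_funX; apply: measurable_cmod; exact: cmeas_of_cpair. Qed.

Lemma measurable_expRe (b : R[i]) :
  measurable_fun setT (fun u : U => expR (complex.Re (b * of_cpair u)%R)).
Proof.
apply: measurableT_comp => //.
by have [] := cmeasM (cmeas_cst U b) (@cmeas_of_cpair R).
Qed.

Lemma bernoulli_moments (Y : T -> R[i]) :
  complex_random_variable Y -> bernoulli_variable P Y ->
  \int[P]_w (cmod (Y w) ^+ 2)%:E = 1 /\
  forall b, \int[P]_w (expR (complex.Re (b * Y w)))%:E <= (expR (2 * cmod b ^+ 2))%:E.
Proof.
move=> mY bY; split.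
  rewrite (@bernoulli_integral _ _ _ _ _ mY (fun z => cmod z ^+ 2)%R bY
    measurable_cmod2 (fun z => sqr_ge0 _)).
  by rewrite cmodN cmod1 expr1n; congr EFin; lra.
move=> b.
rewrite (@bernoulli_integral _ _ _ _ _ mY (fun z => expR (complex.Re (b * z)%R)) bY
  (measurable_expRe b) (fun z => expR_ge0 _)).
rewrite lee_fin mulr1 mulrN1 (_ : complex.Re (- b) = - complex.Re b)%R; last by case: b.
have h1 := expR_quadratic (complex.Re b).
have h2 := expR_quadratic (- complex.Re b); rewrite sqrrN in h2.
have : (expR (2 * complex.Re b ^+ 2) <= expR (2 * cmod b ^+ 2))%R.
  by rewrite ler_expR ler_pM2l// cmod_sqr lerDl sqr_ge0.
lra.
Qed.

Lemma steinhaus_moments (Y : T -> R[i]) :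
  complex_random_variable Y -> steinhaus_variable P Y ->
  \int[P]_w (cmod (Y w) ^+ 2)%:E = 1 /\
  forall b, \int[P]_w (expR (complex.Re (b * Y w)))%:E <= (expR (2 * cmod b ^+ 2))%:E.
Proof.
move=> mY sY.
have p2 : (0 < 2 * pi :> R)%R by rewrite mulr_gt0 ?pi_gt0.
have circ (c : R) : \int[leb]_(t in `[0%R, (2 * pi)%R]) (c * (2 * pi)^-1)%:E = c%:E.
  rewrite (integral_cst leb _ ((c * (2 * pi)^-1)%:E))//= lebesgue_measure_itv /= lte_fin p2 sube0.
  by rewrite -EFinM mulfVK// gt_eqF.
split.
  rewrite (@steinhaus_integral _ _ _ _ _ mY (fun z => cmod z ^+ 2)%R sY
    measurable_cmod2 (fun z => sqr_ge0 _)).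
  by under eq_integral do rewrite cmod_expi expr1n; rewrite circ.
move=> b.
rewrite (@steinhaus_integral _ _ _ _ _ mY (fun z => expR (complex.Re (b * z)%R)) sY
  (measurable_expRe b) (fun z => expR_ge0 _)).
set M := expR (2 * cmod b ^+ 2).
pose h t := (complex.Re b * cos ((1%:R - 0%:R) * t) + (- complex.Im b) * sin ((1%:R - 0%:R) * t))%R.
have hE t : complex.Re (b * expi t)%R = h t.
  by rewrite Re_mul /h subr0 mul1r /= mulNr.
have hb t : (expR (complex.Re (b * expi t)) <= h t + M)%R.
  apply: le_trans (expR_quadratic _) _; rewrite hE lerD2l ler_expR ler_pM2l// -hE.
  rewrite -(real_normK (num_real (complex.Re _))) lerXn2r ?nnegrE ?cmod_ge0//.
  by apply: le_trans (Re_le_cmod _) _; rewrite cmodM cmod_expi mulr1.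
have mh : measurable_fun setT h.
  have [+ _] := cmeasM (cmeas_cst (measurableTypeR R) b) (@cmeas_expi R).
  by under eq_fun do rewrite hE.
have ih : leb.-integrable `[0%R, (2 * pi)%R] (EFin \o h).
  apply: (le_integrable _ _ _ (g := cst (cmod b)%:E)) => //.
  - by apply/measurable_EFinP; exact: measurable_funTS.
  - move=> t _; rewrite /= lee_fin -hE (ger0_norm (cmod_ge0 b)).
    by apply: le_trans (Re_le_cmod _) _; rewrite cmodM cmod_expi mulr1.
  - apply/integrableP; split; first exact: measurable_cst.
    rewrite (integral_cst leb _ `|(cmod b)%:E|)//= lebesgue_measure_itv /= lte_fin p2.
    by rewrite -EFinB -EFinM ltry.
have iM : leb.-integrable `[0%R, (2 * pi)%R] (cst M%:E).
  apply/integrableP; split; first exact: measurable_cst.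
  rewrite (integral_cst leb _ `|M%:E|)//= lebesgue_measure_itv /= lte_fin p2.
  by rewrite -EFinB -EFinM ltry.
apply: (@le_trans _ _ (\int[leb]_(t in `[0%R, (2 * pi)%R]) ((h t + M) * (2 * pi)^-1)%:E)).
  have mex : measurable_fun `[0%R, (2 * pi)%R] (fun t => expR (complex.Re (b * expi t)%R)).
    apply: measurable_funTS; apply: measurableT_comp => //.
    by under eq_fun do rewrite hE.
  apply: ge0_le_integral => //.
  - by move=> t _; rewrite lee_fin mulr_ge0 ?expR_ge0 ?invr_ge0 ?(ltW p2).
  - by apply/measurable_EFinP/measurable_funM => //; exact: measurable_cst.
  - apply/measurable_EFinP/measurable_funM; last exact: measurable_cst.
    by apply: measurable_funD; [exact: measurable_funTS|exact: measurable_cst].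
  - by move=> t _; rewrite lee_fin ler_wpM2r ?invr_ge0 ?(ltW p2).
under eq_integral do rewrite mulrC EFinM EFinD.
rewrite integralZl//; last exact: integrableD.
rewrite integralD// (@integral_trig R (complex.Re b) (- complex.Im b)%R 1%N 0%N)// add0e.
rewrite (integral_cst leb _ M%:E)//= lebesgue_measure_itv /= lte_fin p2 sube0 -!EFinM lee_fin.
by rewrite mulrC mulfK// gt_eqF.
Qed.

(** Completing the square. *)
Lemma gaussian_mgf (t : R) :
  \int[leb]_x (expR (t * x) * normal_pdf 0 1 x)%:E = (expR (t ^+ 2 / 2))%:E.
Proof.
have e x : ((expR (t * x) * normal_pdf 0 1 x) = expR (t ^+ 2 / 2) * normal_pdf t 1 x)%R.
  rewrite !normal_pdfE ?oner_eq0// mulrCA [RHS]mulrCA; congr (_ * _)%R.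
  rewrite /normal_fun -!expRD; congr expR.
  by rewrite -(mulr_natl (1 ^+ 2)) expr1n mulr1; field.
under eq_integral do rewrite e EFinM.
rewrite ge0_integralZl ?lee_fin ?expR_ge0//.
- by rewrite integral_normal_pdf mule1.
- by apply/measurable_EFinP; exact: measurable_normal_pdf.
- by move=> x _; rewrite lee_fin normal_pdf_ge0.
Qed.

Definition gaussian_variance : R :=
  fine (\int[leb]_x (x ^+ 2 * normal_pdf 0 1 x)%:E).

(** Finiteness comes from x^2 <= 2 (exp(x) + exp(-x)) and gaussian_mgf, positivity from
    the interval [1, 2]. *)
Lemma gaussian_variance_gt0 : (0 < gaussian_variance)%R /\
  \int[leb]_x (x ^+ 2 * normal_pdf 0 1 x)%:E = gaussian_variance%:E.
Proof.
have mp := @measurable_normal_pdf R 0 1.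
have p0 := @normal_pdf_ge0 R 0 1.
set I := \int[leb]_x _.
have Ilt : I < +oo.
  apply: (@le_lt_trans _ _ (\int[leb]_x
     (2%:E * (expR (1 * x) * normal_pdf 0 1 x)%:E
      + 2%:E * (expR (-1 * x) * normal_pdf 0 1 x)%:E))).
    apply: ge0_le_integral => //.
    - by move=> x _; rewrite lee_fin mulr_ge0 ?sqr_ge0.
    - by apply/measurable_EFinP/measurable_funM => //; exact: measurable_funX.
    - apply/measurable_EFinP; apply: measurable_funD; apply: measurable_funM => //;
      by apply: measurable_funM => //; apply: measurableT_comp => //; apply: measurable_funM.
    - move=> x _; rewrite -!EFinM -EFinD lee_fin !mulrA -mulrDl ler_wpM2r//.
      have h (y : R) : (0 <= y -> y ^+ 2 <= 2 * expR y)%R.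
        by move=> y0; have := expR_ge1Dxn 1 y0; rewrite !factS fact0; lra.
      have e1 := expR_ge0 (1 * x)%R; have e2 := expR_ge0 (-1 * x)%R.
      case: (lerP 0 x) => x0.
        by have := h _ x0; rewrite mul1r in e1 *; lra.
      have := h (- x)%R; rewrite sqrrN -mulN1r => /(_ _).
      rewrite mulN1r oppr_ge0 => /(_ (ltW x0)); rewrite mulN1r in e2 *; lra.
  rewrite ge0_integralD//; last 4 first.
  - by move=> x _; rewrite -EFinM lee_fin !mulr_ge0 ?expR_ge0.
  - apply/measurable_EFinP; apply: measurable_funM => //.
    by apply: measurable_funM => //; apply: measurableT_comp => //; apply: measurable_funM.
  - by move=> x _; rewrite -EFinM lee_fin !mulr_ge0 ?expR_ge0.
  - apply/measurable_EFinP; apply: measurable_funM => //.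
    by apply: measurable_funM => //; apply: measurableT_comp => //; apply: measurable_funM.
  rewrite !ge0_integralZl//; last 4 first.
  - apply/measurable_EFinP.
    by apply: measurable_funM => //; apply: measurableT_comp => //; apply: measurable_funM.
  - by move=> x _; rewrite lee_fin !mulr_ge0 ?expR_ge0.
  - apply/measurable_EFinP.
    by apply: measurable_funM => //; apply: measurableT_comp => //; apply: measurable_funM.
  - by move=> x _; rewrite lee_fin !mulr_ge0 ?expR_ge0.
  by rewrite !gaussian_mgf -!EFinM -EFinD ltry.
have I0 : 0 < I.
  pose q := normal_pdf 0 1 2 : R.
  have q0 : (0 < q)%R.
    by rewrite /q normal_pdfE ?oner_eq0// mulr_gt0 ?expR_gt0 ?normal_peak_gt0 ?oner_eq0.
  apply: (@lt_le_trans _ _ (\int[leb]_(x in `[1%R, 2%R]) q%:E)).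
    rewrite (integral_cst leb _ q%:E)//= lebesgue_measure_itv /= lte_fin ltr1n -EFinB -EFinM lte_fin.
    by rewrite mulr_gt0// subr_gt0 ltr1n.
  apply: (@le_trans _ _ (\int[leb]_(x in `[1%R, 2%R]) (x ^+ 2 * normal_pdf 0 1 x)%:E)).
    apply: ge0_le_integral => //.
    - by move=> x _; rewrite lee_fin ltW.
    - apply/measurable_EFinP/measurable_funTS/measurable_funM => //; exact: measurable_funX.
    - move=> x; rewrite /= in_itv /= => /andP[x1 x2]; rewrite lee_fin.
      apply: (@le_trans _ _ (1 * normal_pdf 0 1 x)%R).
        rewrite mul1r /q !normal_pdfE ?oner_eq0// ler_wpM2l ?normal_peak_ge0//.
        rewrite /normal_fun ler_expR !subr0 !mulNr lerN2 ler_pM2r; last first.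
          by rewrite invr_gt0 expr1n.
        by rewrite lerXn2r ?nnegrE//; lra.
      by rewrite ler_wpM2r// expr2; nra.
  apply: ge0_subset_integral => //.
  - by apply/measurable_EFinP/measurable_funM => //; exact: measurable_funX.
  - by move=> x _; rewrite lee_fin mulr_ge0 ?sqr_ge0.
have fI : I \is a fin_num by rewrite ge0_fin_numE// ltW.
by rewrite /gaussian_variance -/I fineK// fine_gt0 ?I0.
Qed.

Lemma gaussian_moments (Y : T -> R[i]) :
  complex_random_variable Y -> gaussian_variable P Y ->
  \int[P]_w (cmod (Y w) ^+ 2)%:E = gaussian_variance%:E /\
  forall b, \int[P]_w (expR (complex.Re (b * Y w)))%:E <= (expR (2 * cmod b ^+ 2))%:E.
Proof.
move=> mY gY; split.
  rewrite (@gaussian_integral _ _ _ _ _ mY (fun z => cmod z ^+ 2)%R gY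
    measurable_cmod2 (fun z => sqr_ge0 _)).
  under eq_integral do rewrite cmod_real real_normK ?num_real//.
  by rewrite gaussian_variance_gt0.2.
move=> b.
rewrite (@gaussian_integral _ _ _ _ _ mY (fun z => expR (complex.Re (b * z)%R)) gY
  (measurable_expRe b) (fun z => expR_ge0 _)).
under eq_integral do rewrite Re_mul /= mulr0 subr0.
rewrite gaussian_mgf lee_fin ler_expR cmod_sqr.
by have := sqr_ge0 (complex.Im b); have := sqr_ge0 (complex.Re b); lra.
Qed.

Lemma standard_subgaussian (X : nat -> T -> R[i]) : standard_random_sequence P X ->
  exists2 v, (0 < v)%R & subgaussian_sequence P X v.
Proof.
move=> [mX iX [hX|hX|hX]].
- exists 1%R => //; split=> // k; first by have [] := bernoulli_moments (mX k) (hX k).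
  by have [] := bernoulli_moments (mX k) (hX k).
- exists 1%R => //; split=> // k; first by have [] := steinhaus_moments (mX k) (hX k).
  by have [] := steinhaus_moments (mX k) (hX k).
- exists gaussian_variance; first by have [] := gaussian_variance_gt0.
  split=> // k; first by have [] := gaussian_moments (mX k) (hX k).
  by have [] := gaussian_moments (mX k) (hX k).
Qed.

End StandardSubgaussian.

(** * Sums of independent subgaussian variables *)

Section Subgaussian.
Context {R : realType} d (T : measurableType d) (P : probability T R).
Variables (X : nat -> T -> R[i]) (v : R).
Hypothesis HX : subgaussian_sequence P X v.
Local Notation U := (R * R)%type.
Local Open Scope ereal_scope.

Let mX : forall k, complex_random_variable (X k). Proof. by case: HX. Qed.
Let iX : mutually_independent P X. Proof. by case: HX. Qed.
Let X2 k : \int[P]_w (cmod (X k w) ^+ 2)%:E = v%:E. Proof. by case: HX => _ _ + _; exact. Qed.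
Let Xexp k b : \int[P]_w (expR (complex.Re (b * X k w)%R))%:E <= (expR (2 * cmod b ^+ 2))%:E.
Proof. by case: HX => _ _ _; exact. Qed.

Let cX k : cmeas (X k). Proof. exact: cmeas_rv. Qed.

Let mRe (b : R[i]) k : measurable_fun setT (fun w => complex.Re (b * X k w)%R).
Proof. by have [] := cmeasM (cmeas_cst T b) (cX k). Qed.

(** Independence turns the exponential of the sum into a product of integrals. *)
Lemma subgaussian_mgf_sum (b : nat -> R[i]) n :
  \int[P]_w (expR (complex.Re (\sum_(k < n) b k * X k w)%R))%:E <=
  (expR (2 * \sum_(k < n) cmod (b k) ^+ 2))%:E.
Proof.
pose g k (u : U) : R := expR (complex.Re (b k * of_cpair u)%R).
pose m k := fine (\int[P]_w (g k (cpair (X k w)))%:E).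
have gX k w : g k (cpair (X k w)) = expR (complex.Re (b k * X k w)%R).
  by rewrite /g of_cpairK.
have m0 k : 0 <= \int[P]_w (g k (cpair (X k w)))%:E.
  by apply: integral_ge0 => w _; rewrite lee_fin expR_ge0.
have mle k : \int[P]_w (g k (cpair (X k w)))%:E <= (expR (2 * cmod (b k) ^+ 2))%:E.
  by under eq_integral do rewrite gX; exact: Xexp.
have mE k : \int[P]_w (g k (cpair (X k w)))%:E = (m k)%:E.
  by rewrite /m fineK// ge0_fin_numE//; apply: le_lt_trans (mle k) (ltry _).
have := independent_prod mX iX (J := iota 0 n) (iota_uniq _ _)
  (fun k => measurable_expRe (b k)) (fun k u => expR_ge0 _) mE.
have e w : (\prod_(k <- iota 0 n) expR (complex.Re (b k * of_cpair (cpair (X k w)))))%R =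
   expR (complex.Re (\sum_(k < n) b k * X k w)%R).
  rewrite -expR_sum Re_sum -(big_mkord xpredT (fun k => complex.Re (b k * X k w)%R)).
  by rewrite /index_iota subn0; congr expR; apply: eq_bigr => k _; rewrite of_cpairK.
under eq_integral do rewrite e.
move=> ->; rewrite lee_fin mulr_sumr expR_sum -(big_mkord xpredT (fun k => expR (2 * cmod (b k) ^+ 2))).
rewrite /index_iota subn0; apply: ler_prod => k _.
by rewrite -!lee_fin -mE m0 mle.
Qed.

(** Positive part of the real linear form z |-> Re (b z). Nonnegative functions are
    integrated because independence is available for them. *)
Let up (b : R[i]) (z : R[i]) : R := (Num.max (complex.Re (b * z)) 0)%R.

Let up0 b z : (0 <= up b z)%R. Proof. by rewrite /up le_max lexx orbT. Qed.

Let mup b : measurable_fun setT (fun u : U => up b (of_cpair u)).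
Proof.
apply: measurable_maxr; last exact: measurable_cst.
by have [] := cmeasM (cmeas_cst U b) (@cmeas_of_cpair R).
Qed.

Let mupX b k : measurable_fun setT (fun w => up b (X k w)).
Proof. by apply: measurable_maxr => //; exact: measurable_cst. Qed.

Let upB b z : (up b z - up (- b) z = complex.Re (b * z))%R.
Proof.
rewrite /up mulNr (_ : complex.Re (- (b * z)) = - complex.Re (b * z))%R; last by case: (b * z)%R.
by rewrite /Num.max; do 2 case: ltP => ?; lra.
Qed.

Let mean b k := fine (\int[P]_w (up b (X k w))%:E).

Let meanE b k : \int[P]_w (up b (X k w))%:E = (mean b k)%:E.
Proof.
rewrite /mean fineK// ge0_fin_numE; last first.
  by apply: integral_ge0 => w _; rewrite lee_fin.
apply: le_lt_trans (le_lt_trans (Xexp k b) (ltry _)).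
apply: ge0_le_integral => //.
- by move=> w _; rewrite lee_fin.
- by apply/measurable_EFinP.
- by apply/measurable_EFinP; exact: measurableT_comp.
- move=> w _; rewrite lee_fin /up ge_max expR_ge0 andbT.
  by apply: le_trans (expR_ge1Dx _); rewrite lerDr.
Qed.

(** Centering: with de the difference of the two means, 1 + t de <= E exp(t Re (b X))
    <= exp(2 t^2 |b|^2) for all t > 0, which forces de <= 0 as t tends to 0. *)
Let mean_le b k : (mean b k <= mean (- b) k)%R.
Proof.
rewrite leNgt; apply/negP => lt_m.
pose c : R := (cmod b ^+ 2)%R; have c0 : (0 <= c)%R by exact: sqr_ge0.
pose de : R := (mean b k - mean (- b) k)%R; have de0 : (0 < de)%R by rewrite subr_gt0.
have key t : (0 < t)%R -> (t * de + 1 <= expR (2 * (t ^+ 2 * c)))%R.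
  move=> t0; rewrite /de mulrBr addrAC lerBlDr -lee_fin.
  have -> : (t * mean b k + 1)%:E = \int[P]_w (t * up b (X k w) + 1)%:E.
    under eq_integral do rewrite EFinD EFinM.
    rewrite ge0_integralD//; last 2 first.
    - by move=> w _; rewrite -EFinM lee_fin mulr_ge0 ?(ltW t0).
    - by apply: measurable_funeM; exact/measurable_EFinP.
    rewrite ge0_integralZl ?lee_fin ?(ltW t0)//; last 2 first.
    - exact/measurable_EFinP.
    - by move=> w _; rewrite lee_fin.
    by rewrite meanE integral_cst// [X in _ + _ * X]probability_setT mule1 EFinD EFinM.
  apply: (@le_trans _ _ (\int[P]_w ((expR (complex.Re ((t%:C * b) * X k w)%R))%:E +
      t%:E * (up (- b) (X k w))%:E))).
    apply: ge0_le_integral => //.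
    - by move=> w _; rewrite lee_fin addr_ge0// mulr_ge0// ltW.
    - apply/measurable_EFinP; apply: measurable_funD => //; apply: measurable_funM => //.
    - apply: emeasurable_funD; first by apply/measurable_EFinP; exact: measurableT_comp.
      by apply: measurable_funeM; exact/measurable_EFinP.
    - move=> w _; rewrite -EFinM -EFinD lee_fin.
      have -> : (complex.Re (t%:C * b * X k w) = t * (up b (X k w) - up (- b) (X k w)))%R.
        by rewrite upB -mulrA [LHS]Re_mul /= mul0r subr0.
      by have := expR_ge1Dx (t * (up b (X k w) - up (- b) (X k w)))%R; lra.
  rewrite ge0_integralD//; last 3 first.
  - by apply/measurable_EFinP; exact: measurableT_comp.
  - by move=> w _; rewrite -EFinM lee_fin mulr_ge0 ?(ltW t0).
  - by apply: measurable_funeM; exact/measurable_EFinP.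
  rewrite ge0_integralZl ?lee_fin ?(ltW t0)//; last 2 first.
  - exact/measurable_EFinP.
  - by move=> w _; rewrite lee_fin.
  rewrite meanE EFinD EFinM leeD2r//.
  apply: le_trans (Xexp k _) _; rewrite lee_fin ler_expR ler_pM2l//.
  by rewrite cmodM cmod_real exprMn real_normK ?num_real.
(* small enough for exp(y) <= 1 + 2 y at y = 2 t^2 c, and for 4 t c < de *)
pose t : R := (Num.min (de / (8 * (c + 1))) (1 / (2 * (c + 1))))%R.
have c1 : (0 < c + 1)%R by rewrite ltr_wpDl.
have t0 : (0 < t)%R by rewrite lt_min !divr_gt0 ?mulr_gt0.
have t1 : (t * (c + 1) <= de / 8)%R.
  have : (t <= de / (8 * (c + 1)))%R by rewrite ge_min lexx.
  by rewrite ler_pdivlMr ?mulr_gt0//; lra.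
have t2 : (t * (c + 1) <= 1 / 2)%R.
  have : (t <= 1 / (2 * (c + 1)))%R by rewrite ge_min lexx orbT.
  by rewrite ler_pdivlMr ?mulr_gt0//; lra.
rewrite mulrDr mulr1 in t1 t2.
have tc0 : (0 <= t * c)%R by rewrite mulr_ge0// ltW.
have t3 : (t <= 1 / 2)%R by lra.
pose y : R := (2 * (t ^+ 2 * c))%R.
have y0 : (0 <= y)%R by rewrite /y mulr_ge0// mulr_ge0// sqr_ge0.
have tc1 : (t * c <= 1 / 2)%R by lra.
have y2 : (y <= 1 / 2)%R.
  have -> : y = (2 * ((t * c) * t))%R by rewrite /y; ring.
  suff : (t * c * t <= 1 / 4)%R by lra.
  apply: (@le_trans _ _ (1 / 2 * (1 / 2)))%R; last by lra.
  by apply: ler_pM => //; exact: ltW.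
have ey : (expR y <= 1 + 2 * y)%R.
  have h : (1 - y <= expR (- y))%R by exact: expR_ge1Dx.
  have y1 : (0 < 1 - y)%R by lra.
  rewrite -[expR y]invrK -expRN; apply: (@le_trans _ _ (1 - y)^-1)%R.
    by rewrite lef_pV2 ?posrE ?expR_gt0.
  by rewrite -[leLHS]mul1r ler_pdivrMr//; nra.
have := key t t0; rewrite -/y => k1.
have : (t * de <= 2 * y)%R by lra.
rewrite /y (_ : 2 * (2 * (t ^+ 2 * c)) = t * (4 * (t * c)))%R; last by ring.
rewrite ler_pM2l// => k2; lra.
Qed.

Let meanN (b : R[i]) k : mean (- b)%R k = mean b k.
Proof. by apply/le_anti; rewrite [X in _ && X]mean_le andbT; have := mean_le (- b)%R k; rewrite opprK. Qed.

Let up_prod b c j k : j != k ->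
  \int[P]_w (up b (X j w) * up c (X k w))%:E = (mean b j * mean c k)%:E.
Proof.
move=> jk; pose b' i := if i == j then b else c.
have := independent_prod mX iX (J := [:: j; k]) _ (fun i => mup (b' i)) (fun i u => up0 _ _)
  (m := fun i => mean (b' i) i).
rewrite /= inE jk => /(_ isT); rewrite !big_cons big_nil mulr1.
rewrite /b' eqxx eq_sym (negbTE jk) => <-.
  by apply: eq_integral => w _; rewrite !big_cons big_nil mulr1 !of_cpairK eqxx eq_sym (negbTE jk).
by move=> i; rewrite -meanE; apply: eq_integral => w _; rewrite of_cpairK.
Qed.

Let int_up_prod b c j k : j != k ->
  P.-integrable setT (fun w => (up b (X j w) * up c (X k w))%:E).
Proof.
move=> jk; apply/integrableP; split.
  by apply/measurable_EFinP; apply: measurable_funM.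
under eq_integral do rewrite gee0_abs ?lee_fin ?mulr_ge0//.
by rewrite up_prod// ltry.
Qed.

Let Re_prod b c j k : j != k ->
  P.-integrable setT (fun w => (complex.Re (b * X j w) * complex.Re (c * X k w))%:E) /\
  \int[P]_w (complex.Re (b * X j w) * complex.Re (c * X k w))%:E = 0.
Proof.
move=> jk.
have e : (fun w => (complex.Re (b * X j w) * complex.Re (c * X k w))%:E) =
  (fun w => ((up b (X j w) * up c (X k w))%:E + (up (- b) (X j w) * up (- c) (X k w))%:E)
     - ((up b (X j w) * up (- c) (X k w))%:E + (up (- b) (X j w) * up c (X k w))%:E)).
  by apply/funext => w; rewrite -!EFinD; congr EFin; rewrite -!upB; ring.
have i1 := integrableD measurableT (int_up_prod b c jk) (int_up_prod (- b)%R (- c)%R jk).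
have i2 := integrableD measurableT (int_up_prod b (- c)%R jk) (int_up_prod (- b)%R c jk).
rewrite e; split; first exact: integrableB.
rewrite integralB//.
rewrite (integralD measurableT (int_up_prod b c jk) (int_up_prod (- b)%R (- c)%R jk)).
rewrite (integralD measurableT (int_up_prod b (- c)%R jk) (int_up_prod (- b)%R c jk)).
by rewrite !up_prod// !meanN subee// -EFinD.
Qed.

Lemma subgaussian_orthogonal b c j k : j != k ->
  \int[P]_w (dotc (b * X j w) (c * X k w))%:E = 0.
Proof.
(* Im z = Re (- i z), so that both parts of the inner product are products of real
   linear forms *)
move=> jk; pose mi : R[i] := (0 -i* 1)%R.
have ImE (z : R[i]) : complex.Im z = complex.Re (mi * z)%R.
  by case: z => x y; rewrite Re_mul /= mul0r sub0r mulN1r opprK.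
under eq_integral => w _ do rewrite /dotc !ImE !mulrA EFinD.
have [i1 e1] := Re_prod b c jk.
have [i2 e2] := Re_prod (mi * b)%R (mi * c)%R jk.
by rewrite integralD// e1 e2 adde0.
Qed.

Lemma subgaussian_second_moment b k :
  \int[P]_w (cmod (b * X k w) ^+ 2)%:E = (v * cmod b ^+ 2)%:E.
Proof.
under eq_integral do rewrite cmodM exprMn EFinM.
rewrite ge0_integralZl ?lee_fin ?sqr_ge0//.
- by rewrite X2 -EFinM mulrC.
- by apply/measurable_EFinP/measurable_funX/measurable_cmod.
- by move=> w _; rewrite lee_fin sqr_ge0.
Qed.

End Subgaussian.

(** * Moments of random series *)

Section SmallBall.
Context {R : realType} d (T : measurableType d) (P : probability T R).
Local Open Scope ereal_scope.

(** For x^2 >= K the exponential dominates, for x <= s the constant does, and in between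
    the power x^q is at least s^q. *)
Lemma small_ball_pointwise (K s q x : R) : (0 < K)%R -> (0 < s)%R -> (0 < q)%R ->
  (0 <= x)%R ->
  (x ^+ 2 <= s ^+ 2 + (K / s `^ q) * x `^ q + (24 / K) * expR x)%R /\
  (x ^+ 2 <= K + (24 / K) * expR x)%R.
Proof.
move=> K0 s0 q0 x0.
have x4 : (x ^+ 4 <= 24 * expR x)%R.
  have := expR_ge1Dxn 3 x0; rewrite !factS fact0 => h.
  have : (x ^+ 4 / 24 <= expR x)%R.
    by apply: le_trans h; rewrite lerDr.
  by rewrite ler_pdivrMr// mulrC.
have e0 : (0 <= 24 / K * expR x)%R by rewrite mulr_ge0 ?expR_ge0// divr_ge0// ltW.
have sq0 : (0 < s `^ q)%R by exact: powR_gt0.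
have p0 : (0 <= K / s `^ q * x `^ q)%R.
  by rewrite mulr_ge0 ?powR_ge0// divr_ge0 ?powR_ge0// ltW.
have big : (K <= x ^+ 2 -> x ^+ 2 <= 24 / K * expR x)%R.
  move=> Kx; rewrite mulrAC ler_pdivlMr//.
  by apply: le_trans x4; rewrite (_ : 4 = 2 + 2)%N// exprD ler_wpM2l ?sqr_ge0.
split; last first.
  by case: (lerP K (x ^+ 2)%R) => [/big|] ?; lra.
case: (lerP K (x ^+ 2)%R) => [/big h|xK].
  by have := sqr_ge0 s; lra.
case: (lerP x s) => xs.
  have : (x ^+ 2 <= s ^+ 2)%R by rewrite lerXn2r// nnegrE// ltW.
  lra.
have : (K <= K / s `^ q * x `^ q)%R.
  rewrite -mulrA ler_peMr ?(ltW K0)// mulrC ler_pdivlMr// mul1r.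
  by apply: ge0_ler_powR; rewrite ?nnegrE// ltW.
by have := sqr_ge0 s; lra.
Qed.

(** A second moment bounded below and an exponential moment bounded above force a fixed
    amount of mass of x^q on every event of probability close to 1. This replaces the
    lower Khinchin inequality for small exponents, in a form that survives the
    restriction to an event. *)
Lemma small_ball (m C q : R) : (0 < m)%R -> (0 < C)%R -> (0 < q)%R ->
  exists e k, [/\ (0 < e)%R, (0 < k)%R &
   forall (W A : set T) (x : T -> R), measurable W -> measurable A -> A `<=` W ->
    measurable_fun W x -> (forall w, (0 <= x w)%R) ->
    m%:E <= \int[P]_(w in W) (x w ^+ 2)%:E ->
    \int[P]_(w in W) (expR (x w))%:E <= C%:E ->
    P (W `\` A) <= e%:E ->
    k%:E <= \int[P]_(w in A) (x w `^ q)%:E].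
Proof.
move=> m0 C0 q0.
(* K and s are chosen so that each of the error terms stays well below m *)
have [K K0 KC] : exists2 K : R, (0 < K)%R & (24 / K * C = m / 8)%R.
  exists (192 * C / m)%R; first by rewrite divr_gt0 ?mulr_gt0.
  by field; rewrite (gt_eqF m0) (gt_eqF C0).
have [s s0 s2] : exists2 s : R, (0 < s)%R & (s ^+ 2 = m / 4)%R.
  exists (Num.sqrt m / 2)%R; first by rewrite divr_gt0 ?sqrtr_gt0.
  by rewrite expr_div_n sqr_sqrtr ?(ltW m0)//; congr (_ / _)%R; rewrite expr2 -natrM.
have sq0 : (0 < s `^ q)%R by exact: powR_gt0.
pose c := (K / s `^ q)%R; have c0 : (0 < c)%R by rewrite divr_gt0.
have e0 : (0 < m / (4 * K))%R by rewrite divr_gt0// mulr_gt0.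
have k0 : (0 < m / 4 / c)%R by rewrite divr_gt0// divr_gt0.
exists (m / (4 * K))%R, (m / 4 / c)%R; split; [exact: e0|exact: k0|].
move=> W A x mW mA AW mx x0 hm hC hA.
have mWA : measurable (W `\` A) by exact: measurableD.
have msub B : B `<=` W -> measurable_fun B x by move=> BW; exact: measurable_funS mx.
have mex B : B `<=` W -> measurable_fun B (fun w => (expR (x w))%:E).
  by move=> BW; apply/measurable_EFinP; apply: measurableT_comp => //; exact: msub.
have WAW : W `\` A `<=` W by move=> ? [].
have Pfin B : measurable B -> P B = (fine (P B))%:E.
  by move=> mB; rewrite fineK// fin_num_measure.
have expB B : measurable B -> B `<=` W -> \int[P]_(w in B) (24 / K * expR (x w))%:E <= (m / 8)%:E.
  move=> mB BW; under eq_integral do rewrite EFinM.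
  rewrite ge0_integralZl ?lee_fin ?divr_ge0 ?(ltW K0)//; last exact: mex.
  rewrite -KC (EFinM (24 / K)) lee_pmul2l ?lte_fin ?divr_gt0//.
  apply: le_trans hC; apply: ge0_subset_integral => //; exact: mex.
have I1 : \int[P]_(w in W `\` A) (x w ^+ 2)%:E <= (m / 4 + m / 8)%:E.
  apply: (@le_trans _ _ (\int[P]_(w in W `\` A) (K%:E + (24 / K * expR (x w))%:E))).
    apply: ge0_le_integral => //.
    - by move=> w _; rewrite lee_fin sqr_ge0.
    - by apply/measurable_EFinP/measurable_funX; exact: msub.
    - apply: emeasurable_funD => //; apply/measurable_EFinP; apply: measurable_funM => //.
      by apply: measurableT_comp => //; exact: msub.
    - by move=> w _; rewrite -EFinD lee_fin; have [] := small_ball_pointwise K0 s0 q0 (x0 w).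
  rewrite ge0_integralD//; last 3 first.
  - by move=> w _; rewrite lee_fin ltW.
  - by move=> w _; rewrite lee_fin mulr_ge0 ?expR_ge0// divr_ge0// ltW.
  - apply/measurable_EFinP; apply: measurable_funM => //.
    by apply: measurableT_comp => //; exact: msub.
  rewrite integral_cst// EFinD leeD ?expB//.
  rewrite [X in _ * X](Pfin _ mWA) -EFinM lee_fin.
  have : (fine (P (W `\` A)) <= m / (4 * K))%R by rewrite -lee_fin -Pfin.
  by rewrite ler_pdivlMr ?mulr_gt0//; lra.
have I2 : \int[P]_(w in A) (x w ^+ 2)%:E <=
    (m / 4)%:E + c%:E * \int[P]_(w in A) (x w `^ q)%:E + (m / 8)%:E.
  have mpow : measurable_fun A (fun w => (x w `^ q)%:E).
    apply/measurable_EFinP; apply: (measurableT_comp (measurable_powR q)); exact: msub.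
  apply: (@le_trans _ _ (\int[P]_(w in A) (((s ^+ 2)%:E + c%:E * (x w `^ q)%:E)
     + (24 / K * expR (x w))%:E))).
    apply: ge0_le_integral => //.
    - by move=> w _; rewrite lee_fin sqr_ge0.
    - by apply/measurable_EFinP/measurable_funX; exact: msub.
    - apply: emeasurable_funD.
        by apply: emeasurable_funD => //; exact: measurable_funeM.
      apply/measurable_EFinP; apply: measurable_funM => //.
      by apply: measurableT_comp => //; exact: msub.
    - move=> w _; rewrite -EFinM -!EFinD lee_fin.
      by have [] := small_ball_pointwise K0 s0 q0 (x0 w).
  rewrite ge0_integralD//; last 4 first.
  - by move=> w _; rewrite -EFinM -EFinD lee_fin addr_ge0 ?sqr_ge0// mulr_ge0 ?powR_ge0// ltW.
  - by apply: emeasurable_funD => //; exact: measurable_funeM.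
  - by move=> w _; rewrite lee_fin mulr_ge0 ?expR_ge0// divr_ge0// ltW.
  - apply/measurable_EFinP; apply: measurable_funM => //.
    by apply: measurableT_comp => //; exact: msub.
  rewrite leeD ?expB//.
  rewrite ge0_integralD//; last 3 first.
  - by move=> w _; rewrite lee_fin sqr_ge0.
  - by move=> w _; rewrite -EFinM lee_fin mulr_ge0 ?powR_ge0// ltW.
  - exact: measurable_funeM.
  rewrite ge0_integralZl ?lee_fin ?(ltW c0)//; last first.
    by move=> w _; rewrite lee_fin powR_ge0.
  rewrite leeD2r// integral_cst// s2 -[leRHS]mule1 lee_pmul2l ?lte_fin ?divr_gt0//.
  exact: probability_le1.
have hsplit : \int[P]_(w in W) (x w ^+ 2)%:E =
    \int[P]_(w in A) (x w ^+ 2)%:E + \int[P]_(w in W `\` A) (x w ^+ 2)%:E.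
  rewrite -ge0_integral_setU//.
  - by congr integral; rewrite setDUK.
  - by rewrite setDUK//; apply/measurable_EFinP/measurable_funX.
  - by move=> w _; rewrite lee_fin sqr_ge0.
  - by rewrite disj_set2E setDIK.
have I30 : 0 <= \int[P]_(w in A) (x w `^ q)%:E.
  by apply: integral_ge0 => w _; rewrite lee_fin powR_ge0.
have := le_trans hm (le_trans (eq_ind _ (fun y => _ <= y) (lexx _) _ hsplit) (leeD I2 I1)).
case: (\int[P]_(w in A) (x w `^ q)%:E) I30 => [r r0|_ _|//]; last exact: leey.
rewrite -EFinM -!EFinD !lee_fin ler_pdivrMr// => h; lra.
Qed.

End SmallBall.

Section RandomSeries.
Context {R : realType} d (T : measurableType d) (P : probability T R).
Variables (X : nat -> T -> R[i]) (v : R).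
Hypothesis HX : subgaussian_sequence P X v.
Hypothesis v0 : (0 < v)%R.
Local Open Scope ereal_scope.

Let mX : forall k, complex_random_variable (X k). Proof. by case: HX. Qed.
Let cX k : cmeas (X k). Proof. exact: cmeas_rv. Qed.
Let cbX (b : nat -> R[i]) k : cmeas (fun w => b k * X k w)%R.
Proof. by apply: cmeasM; [exact: cmeas_cst|exact: cX]. Qed.

Variables (W : set T) (mW : measurable W) (PW : P (~` W) = 0).

Let integral_full (f : T -> \bar R) : measurable_fun setT f -> (forall w, 0 <= f w) ->
  \int[P]_(w in W) f w = \int[P]_w f w.
Proof.
move=> mf f0; rewrite [RHS](ge0_negligible_integral (N := ~` W))//.
  by rewrite setTD setCK.
exact: measurableC.
Qed.

Variables (b : nat -> R[i]) (S : T -> R[i]).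
Hypothesis hS : forall w, W w ->
  (fun n => \sum_(k < n) b k * X k w : R[i]^o)%R @ \oo --> (S w : R[i]^o).

Lemma random_series_second_moment (L : R) :
  (fun n => \sum_(0 <= k < n) cmod (b k) ^+ 2)%R @ \oo --> L ->
  (v * L)%:E <= 2%:E * \int[P]_(w in W) (cmod (S w) ^+ 2)%:E.
Proof.
move=> hL.
apply: (@orthogonal_limit R _ T P W mW (fun k w => b k * X k w)%R (fun k => cmod (b k)) v
  _ _ _ S L (ltW v0) hL hS).2.
- exact: cbX.
- move=> k; rewrite integral_full; first exact: (subgaussian_second_moment HX).
    by apply/measurable_EFinP/measurable_funX/measurable_cmod.
  by move=> w; rewrite lee_fin sqr_ge0.
- move=> j k jk; rewrite -[RHS](subgaussian_orthogonal HX (b j) (b k) jk).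
  rewrite [RHS](negligible_integral (N := ~` W))//; last 2 first.
  - exact: measurableC.
  - have i2 i : P.-integrable setT (fun w => (cmod (b i * X i w)%R ^+ 2)%:E).
      apply/integrableP; split.
        by apply/measurable_EFinP/measurable_funX/measurable_cmod.
      under eq_integral do rewrite gee0_abs ?lee_fin ?sqr_ge0//.
      by rewrite (subgaussian_second_moment HX) ltry.
    apply: (le_integrable measurableT _ _ (integrableD measurableT (i2 j) (i2 k))).
      by apply/measurable_EFinP/measurable_dotc.
    move=> w _; rewrite /= lee_fin; apply: le_trans (dotc_le _ _) _.
    by rewrite ger0_norm// addr_ge0 ?sqr_ge0.
  by rewrite setTD setCK.
Qed.

(** |z| <= |Re z| + |Im z|, followed by the inequality of the arithmetic and geometric
    means, reduces the exponential of the modulus to exponentials of linear forms. *)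
Let expR_cmod_le (z : R[i]) : (expR (cmod z) <=
  (expR (complex.Re (2%:C * z)) + expR (complex.Re ((-2)%:C * z)) +
   expR (complex.Re ((0 -i* 2) * z)) + expR (complex.Re ((0 +i* 2) * z))) / 2)%R.
Proof.
have a2 (x : R) : (expR (`|x| + `|x|) <= expR (2 * x) + expR (- 2 * x))%R.
  case: (lerP 0 x) => hx.
    by rewrite ger0_norm// (_ : x + x = 2 * x)%R ?lerDl ?expR_ge0//; ring.
  by rewrite ltr0_norm// (_ : - x + - x = - 2 * x)%R ?lerDr ?expR_ge0//; ring.
rewrite !Re_mul /= !(mul0r, mulr0, subr0, sub0r, mulNr, opprK).
apply: (@le_trans _ _ (expR (`|complex.Re z| + `|complex.Im z|))).
  by rewrite ler_expR cmod_le_ReIm.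
have h1 := a2 (complex.Re z); have h2 := a2 (complex.Im z).
rewrite !expRD !mulNr in h1 h2 *.
have := sqr_ge0 (expR `|complex.Re z| - expR `|complex.Im z|).
rewrite sqrrB => h3; lra.
Qed.

(** The upper Khinchin inequality for all exponents at once. Fatou's lemma passes from
    partial sums to the limit. For s = 0 all coefficients vanish, and division by zero
    gives the value 1 for the integrand. *)
Lemma random_series_exp_moment (s : R) : (0 <= s)%R ->
  (forall n, \sum_(k < n) cmod (b k) ^+ 2 <= s ^+ 2)%R ->
  \int[P]_(w in W) (expR (cmod (S w) / s))%:E <= (2 * expR 8)%:E.
Proof.
move=> s0 hs.
apply: (@fatou_bound R _ T P W mW
  (fun n w => expR (cmod (\sum_(k < n) b k * X k w)%R / s)%R)).
- move=> n; apply: measurable_funTS; apply: measurableT_comp => //.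
  apply: measurable_funM => //; apply: measurable_cmod.
  exact: (@cmeas_sum_ord R _ _ (fun k w => b k * X k w)%R).
- by move=> n w _; exact: expR_ge0.
- move=> w Ww; apply: (cvg_comp _ expR); last exact: continuous_expR.
  by apply: cvgM; [apply: cvg_cmod; exact: hS|exact: cvg_cst].
move=> n.
pose z w : R[i] := (\sum_(k < n) ((s^-1)%:C * b k) * X k w)%R.
have zE w : (cmod (\sum_(k < n) b k * X k w) / s)%R = cmod (z w).
  rewrite mulrC -{1}(ger0_norm s0) -normfV -cmod_real -cmodM mulr_sumr.
  by congr (cmod _); apply: eq_bigr => k _; rewrite mulrA.
have mz : cmeas z.
  by apply: (@cmeas_sum_ord R _ _ (fun k w => ((s^-1)%:C * b k) * X k w)%R) => k;
    apply: cmeasM; [exact: cmeas_cst|exact: cX].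
have me (c : R[i]) : measurable_fun setT (fun w => expR (complex.Re (c * z w)%R)).
  apply: measurableT_comp => //.
  by have [] := cmeasM (cmeas_cst T c) mz.
have bc (c : R[i]) : (cmod c <= 2)%R ->
    \int[P]_w (expR (complex.Re (c * z w)%R))%:E <= (expR 8)%:E.
  move=> c2; have e w : (c * z w = \sum_(k < n) (c * ((s^-1)%:C * b k)) * X k w)%R.
    by rewrite /z mulr_sumr; apply: eq_bigr => k _; rewrite mulrA.
  under eq_integral do rewrite e.
  apply: le_trans (subgaussian_mgf_sum HX (fun k => c * ((s^-1)%:C * b k))%R n) _.
  rewrite lee_fin ler_expR.
  under eq_bigr do rewrite !cmodM !exprMn mulrA.
  rewrite -mulr_sumr cmod_real normfV (ger0_norm s0).
  have h1 : (s^-1 ^+ 2 * \sum_(k < n) cmod (b k) ^+ 2 <= 1)%R.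
    have [->|sn0] := eqVneq s 0%R; first by rewrite invr0 expr0n mul0r.
    rewrite exprVn mulrC ler_pdivrMr ?mul1r ?hs// exprn_gt0// lt_def sn0.
    exact: s0.
  have h2 : (cmod c ^+ 2 <= 4)%R.
    by rewrite (_ : 4 = 2 ^+ 2)%R ?lerXn2r ?nnegrE ?cmod_ge0// expr2 -natrM.
  have h3 : (0 <= s^-1 ^+ 2 * \sum_(k < n) cmod (b k) ^+ 2)%R.
    by rewrite mulr_ge0 ?sqr_ge0// sumr_ge0// => k _; exact: sqr_ge0.
  rewrite -mulrA; have := ler_pM (sqr_ge0 (cmod c)) h3 h2 h1; lra.
under eq_integral do rewrite zE.
apply: (@le_trans _ _ (\int[P]_w (expR (cmod (z w)))%:E)).
  apply: ge0_subset_integral => //.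
  - by apply/measurable_EFinP; apply: measurableT_comp => //; exact: measurable_cmod.
pose F (c : R[i]) w := (expR (complex.Re (c * z w)%R))%:E.
have F0 c w : 0 <= F c w by rewrite lee_fin expR_ge0.
have mF c : measurable_fun setT (F c) by exact/measurable_EFinP.
have cM (x : R) : cmod (0 +i* x)%R = `|x|%R.
  by rewrite /cmod /= expr0n /= add0r sqrtr_sqr.
apply: (@le_trans _ _ (\int[P]_w ((2^-1)%:E * (F (2%:C)%R w + F ((-2)%:C)%R w + F (0 -i* 2)%R w + F (0 +i* 2)%R w)))).
  apply: ge0_le_integral => //.
  - by apply/measurable_EFinP; apply: measurableT_comp => //; exact: measurable_cmod.
  - by apply: measurable_funeM; do 3 (apply: emeasurable_funD => //).
  - by move=> w _; rewrite /F -!EFinD -EFinM lee_fin mulrC; exact: expR_cmod_le.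
rewrite ge0_integralZl//; last 2 first.
- by do 3 (apply: emeasurable_funD => //).
- by move=> w _; rewrite !adde_ge0.
rewrite ge0_integralD//; last 2 first.
- by move=> w _; rewrite !adde_ge0.
- by do 2 (apply: emeasurable_funD => //).
rewrite ge0_integralD//; last 2 first.
- by move=> w _; rewrite !adde_ge0.
- by apply: emeasurable_funD.
rewrite ge0_integralD//.
have -> : (2 * expR 8)%:E = (2^-1)%:E * ((expR 8)%:E + (expR 8)%:E + (expR 8)%:E + (expR 8)%:E) :> \bar R.
  by rewrite -!EFinD -EFinM; congr EFin; field.
rewrite lee_pmul2l ?lte_fin ?invr_gt0//.
by rewrite !leeD// bc// ?cM ?cmod_real ?normrN ger0_norm.
Qed.

End RandomSeries.

(** * Invariance of the area under rotations *)

Section Affine.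
Context {R : realType}.
Local Open Scope ereal_scope.
Local Notation leb := (@lebesgue_measure R).
Local Notation RR := (measurableTypeR R).

Let affine (k c : R) : RR -> RR := fun x => (k * x + c)%R.

Let measurable_affine k c : measurable_fun setT (affine k c).
Proof. by apply: measurable_funD => //; exact: measurable_funM. Qed.

Let lebesgue_affine (k c : R) (B : set RR) : (0 < k)%R -> measurable B ->
  leb (affine k c @^-1` B) = (k^-1)%:E * leb B.
Proof.
move=> k0 mB.
have kn0 : (0 <= k)%R by exact: ltW.
pose push : {measure set RR -> \bar R} := pushforward leb (affine k c).
pose mu : {measure set RR -> \bar R} :=
  mscale (NngNum kn0) (push (measurable_affine k c)).
suff -> : leb B = mu B.
  have -> : mu B = k%:E * leb (affine k c @^-1` B) by [].
  by rewrite muleA -EFinM mulVf ?mul1e// gt_eqF.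
apply: (@lebesgue_measure_unique R mu) => // _ [[a b]] _ <-.
have e : affine k c @^-1` `]a, b]%classic = `]((a - c) / k)%R, ((b - c) / k)%R]%classic :> set RR.
  apply/seteqP; split => x; rewrite /= /affine !in_itv /=.
    by rewrite ltr_pdivrMr// ler_pdivlMr// ltrBlDr lerBrDr mulrC.
  by rewrite ltr_pdivrMr// ler_pdivlMr// ltrBlDr lerBrDr mulrC.
transitivity (k%:E * leb (affine k c @^-1` `]a, b]%classic)); last by [].
rewrite e !lebesgue_measure_itv /= !lte_fin ltr_pM2r ?invr_gt0// ltrD2r.
case: ifP => _; last by rewrite mule0.
by rewrite -!EFinD -EFinM; congr EFin; field; rewrite gt_eqF.
Qed.

Lemma integral_affine (k c : R) (g : R -> R) : (0 < k)%R -> measurable_fun setT g ->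
  (forall x, (0 <= g x)%R) ->
  \int[leb]_x (g (k * x + c)%R)%:E = (k^-1)%:E * \int[leb]_x (g x)%:E.
Proof.
move=> k0 mg g0; have kV : (0 <= k^-1)%R by rewrite invr_ge0 ltW.
have := @monotone_class_integral R _ RR _ RR leb setT (affine k c) (cst 1%R)
  _ RR leb setT idfun (cst k^-1)%R measurableT (measurable_affine k c) (measurable_cst _)
  (fun _ => ler01) measurableT (@measurable_id _ _ _) (measurable_cst _) (fun _ => kV)
  _ g mg g0.
rewrite /= => h.
rewrite -ge0_integralZl//; last 2 first.
- exact/measurable_EFinP.
- by move=> x _; rewrite lee_fin.
under [RHS]eq_integral do rewrite -EFinM mulrC.
rewrite -h; first by apply: eq_integral => x _; rewrite mulr1.
move=> B mB; under eq_integral do rewrite mulr1.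
under [RHS]eq_integral do rewrite mulrC EFinM.
rewrite ge0_integralZl//; last first.
  by apply/measurable_EFinP; exact: measurable_indic.
have mA : measurable (affine k c @^-1` B).
  by have := measurable_affine k c measurableT mB; rewrite setTI.
have hA := integral_indic leb measurableT mA.
have hB := integral_indic leb measurableT mB.
rewrite setIT in hA; rewrite setIT in hB.
rewrite hB -(lebesgue_affine c k0 mB) -hA; apply: eq_integral => x _.
by rewrite !indicE; congr (_%:R)%:E; apply/idP/idP; rewrite !inE.
Qed.

End Affine.

Section Rotation.
Context {R : realType}.
Local Open Scope ereal_scope.
Local Notation leb := (@lebesgue_measure R).
Local Notation RR := (measurableTypeR R).
Local Notation U := (RR * RR)%type.
Local Notation leb2 := (leb \x leb).
Implicit Types g : U -> R.

Let sheary (a : R) (u : U) : U := (u.1 + a * u.2, u.2)%R.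
Let shearx (a : R) (u : U) : U := (u.1, u.2 + a * u.1)%R.

Let msheary a : measurable_fun setT (sheary a).
Proof.
apply: measurable_fun_pair => //; apply: measurable_funD => //.
by apply: measurable_funM => //; exact: measurable_snd.
Qed.

Let mshearx a : measurable_fun setT (shearx a).
Proof.
apply: measurable_fun_pair => //; apply: measurable_funD => //.
by apply: measurable_funM => //; exact: measurable_fst.
Qed.

Let integral_sheary a g : measurable_fun setT g -> (forall u, (0 <= g u)%R) ->
  \int[leb2]_u (g (sheary a u))%:E = \int[leb2]_u (g u)%:E.
Proof.
move=> mg g0.
have m1 : measurable_fun setT (fun u => (g (sheary a u))%:E).
  by apply/measurable_EFinP; exact: measurableT_comp.
have m2 : measurable_fun setT (fun u => (g u)%:E) by exact/measurable_EFinP.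
rewrite (fubini_tonelli2 _ m1); last by move=> u; rewrite lee_fin.
rewrite (fubini_tonelli2 _ m2); last by move=> u; rewrite lee_fin.
apply: eq_integral => y _; rewrite /fubini_G /sheary /=.
have := @integral_affine R 1 (a * y) (fun x => g (x, y)) ltr01 _ (fun x => g0 (x, y)).
rewrite invr1 mul1e => <-; first by apply: eq_integral => x _; rewrite mul1r.
exact: (measurable_fun_pair1 (f := g)).
Qed.

Let integral_shearx a g : measurable_fun setT g -> (forall u, (0 <= g u)%R) ->
  \int[leb2]_u (g (shearx a u))%:E = \int[leb2]_u (g u)%:E.
Proof.
move=> mg g0.
have m1 : measurable_fun setT (fun u => (g (shearx a u))%:E).
  by apply/measurable_EFinP; exact: measurableT_comp.
have m2 : measurable_fun setT (fun u => (g u)%:E) by exact/measurable_EFinP.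
rewrite (fubini_tonelli1 _ m1); last by move=> u; rewrite lee_fin.
rewrite (fubini_tonelli1 _ m2); last by move=> u; rewrite lee_fin.
apply: eq_integral => x _; rewrite /fubini_F /shearx /=.
have := @integral_affine R 1 (a * x) (fun y => g (x, y)) ltr01 _ (fun y => g0 (x, y)).
rewrite invr1 mul1e => <-; first by apply: eq_integral => y _; rewrite mul1r.
exact: (measurable_fun_pair2 (f := g)).
Qed.

Definition rotation (t : R) (u : U) : U := cpair (expi t * of_cpair u)%R.

(** A rotation is a product of three shears, and shears preserve the area by Fubini. The
    middle shear has coefficient sin t and the outer ones -tan(t/2), whence the
    condition on t. *)
Lemma integral_rotation (t : R) g : sin t != 0%R -> measurable_fun setT g ->
  (forall u, (0 <= g u)%R) ->
  \int[leb2]_u (g (rotation t u))%:E = \int[leb2]_u (g u)%:E.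
Proof.
move=> s0 mg g0; pose a := ((cos t - 1) / sin t)%R.
rewrite -(integral_sheary a mg g0).
have mg1 := measurableT_comp mg (msheary a).
rewrite -(integral_shearx (sin t) mg1 (fun u => g0 _)).
have mg2 := measurableT_comp mg1 (mshearx (sin t)).
rewrite -(integral_sheary a mg2 (fun u => g0 _)).
apply: eq_integral => -[x y] _; congr (g _)%:E.
rewrite /rotation /sheary /shearx /cpair Re_mul Im_mul /=.
have as1 : (a * sin t = cos t - 1)%R by rewrite /a mulfVK.
have c2 : (cos t ^+ 2 + sin t ^+ 2 = 1)%R by exact: cos2Dsin2.
have a2 : (a * (1 + cos t) = - sin t)%R.
  by apply: (mulIf s0); rewrite mulrAC as1 mulNr -expr2; lra.
congr pair.
  rewrite (_ : x + a * y + a * (y + sin t * (x + a * y)) =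
    (1 + a * sin t) * x + a * (1 + (1 + a * sin t)) * y)%R; last by ring.
  by rewrite as1 [(1 + (cos t - 1))%R]addrC subrK a2 mulNr.
rewrite (_ : y + sin t * (x + a * y) = (1 + a * sin t) * y + sin t * x)%R; last by ring.
by rewrite as1 [(1 + (cos t - 1))%R]addrC subrK.
Qed.

End Rotation.

(** * Geometry of the tent regions *)

Section PowerComparison.
Context {R : realType}.
Implicit Types (w s e : R).

(** Inside a tent, 1 - |z|^2 and 1 - Re z are comparable, and so are their powers for
    exponents of either sign. *)
Lemma powR_comparable w s e : 0 < w -> w / 2 <= s <= 2 * w ->
  (2 `^ `|e|)^-1 * w `^ e <= s `^ e <= 2 `^ `|e| * w `^ e.
Proof.
move=> w0 /andP[h1 h2]; have s0 : 0 < s by lra.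
have p2 : 0 < 2 `^ `|e| :> R by exact: powR_gt0.
have key x y : 0 < x -> 0 < y -> x <= 2 * y -> y <= 2 * x -> x `^ e <= 2 `^ `|e| * y `^ e.
  move=> x0 y0 xy yx; case: (lerP 0 e) => e0.
    rewrite (ger0_norm e0) -powRM ?(ltW y0)//; apply: ge0_ler_powR => //.
    - by rewrite nnegrE ltW.
    - by rewrite nnegrE mulr_ge0// ltW.
  have xe u : u `^ e = (u `^ (- e))^-1 by rewrite -powRN opprK.
  rewrite (ltr0_norm e0) !xe ler_pdivlMr ?powR_gt0// mulrC ler_pdivrMr ?powR_gt0//.
  rewrite -powRM ?(ltW x0)//; apply: ge0_ler_powR => //.
  - by rewrite oppr_ge0 ltW.
  - by rewrite nnegrE ltW.
  - by rewrite nnegrE mulr_ge0// ltW.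
apply/andP; split; last by apply: key => //; lra.
by rewrite ler_pdivrMl//; apply: key => //; lra.
Qed.

End PowerComparison.

Section TentGeometry.
Context {R : realType}.
Implicit Types (x y t : R) (z : R[i]).

Let conjE (z : R[i]) : Num.conj z = complex.Re z -i* complex.Im z.
Proof. by case: z. Qed.

Let cj1 : Num.conj (1 : R[i]) = 1.
Proof. by rewrite conjE; apply/eqP; rewrite eq_complex /= oppr0 !eqxx. Qed.

Lemma tent1E x y : tent_region 1 (x +i* y) <->
  x ^+ 2 + y ^+ 2 < 1 /\ (1 - x) ^+ 2 + y ^+ 2 < (1 - (x ^+ 2 + y ^+ 2)) ^+ 2.
Proof.
have c2 : cmod (x +i* y) ^+ 2 = x ^+ 2 + y ^+ 2 by exact: cmod_sqr.
have c3 : cmod (1 - (x +i* y) * Num.conj 1) ^+ 2 = (1 - x) ^+ 2 + y ^+ 2.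
  by rewrite cj1 mulr1 cmod_sqr /= sub0r sqrrN.
rewrite -c2 -c3 (expr_lt1 (n := 2))// ?cmod_ge0//.
have sq z : cmod z < 1 -> 0 <= 1 - cmod z ^+ 2.
  by move=> h; rewrite subr_ge0 ltW// expr_lt1 ?cmod_ge0.
split=> -[h1 h2]; split=> //; move: h2;
  by rewrite ltr_sqr ?nnegrE ?cmod_ge0// sq.
Qed.

Lemma tent_region_rotation t z : tent_region (expi t) (expi t * z) <-> tent_region 1 z.
Proof.
have e1 : expi t * Num.conj (expi t) = 1 :> R[i].
  rewrite conjE /expi; apply/eqP; rewrite eq_complex Re_mul Im_mul /=.
  by rewrite mulrN opprK -!expr2 cos2Dsin2 eqxx /= mulrN mulrC addNr.
rewrite /tent_region /unit_disk /= cmodM cmod_expi mul1r.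
by rewrite mulrAC e1 mul1r cj1 mulr1.
Qed.

(** In the tent at 1 the modulus exceeds the real part by at most half of the distance
    of the latter to 1, which allows a radial nondecreasing weight to be compared with
    a function of x alone. *)
Lemma tent_sub_box x y : tent_region 1 (x +i* y) ->
  let r := cmod (x +i* y) in
  [/\ 0 < x < 1, `|y| <= 2 * (1 - x), x <= r <= (1 + x) / 2, r < 1 &
      (1 - x) / 2 <= 1 - r ^+ 2 <= 2 * (1 - x)].
Proof.
move=> /tent1E; have := cmod_sqr (x +i* y); have := cmod_ge0 (x +i* y).
set r := cmod _ => r0 /= <- [rr1 h] /=.
have r1 : r < 1 by rewrite -(expr_lt1 (n := 2)).
have hy : y ^+ 2 = r ^+ 2 - x ^+ 2.
  by have := cmod_sqr (x +i* y); rewrite -/r /=; lra.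
have x0 : 0 < x.
  have r20 := sqr_ge0 r; nra.
have xr : x <= r.
  have : x ^+ 2 <= r ^+ 2 by have := sqr_ge0 y; lra.
  by rewrite ler_sqr ?nnegrE// ltW.
have d1 : (1 - x) < 1 - r ^+ 2.
  have h1 : (1 - x) ^+ 2 < (1 - r ^+ 2) ^+ 2 by have := sqr_ge0 y; lra.
  have : 1 - x < 1 - r ^+ 2.
    by rewrite -ltr_sqr ?nnegrE//; lra.
  by [].
have d2 : 1 - r ^+ 2 <= 2 * (1 - r) by nra.
split => //.
- by apply/andP; split; lra.
- have : `|y| ^+ 2 <= (2 * (1 - x)) ^+ 2.
    rewrite real_normK ?num_real//.
    have h1 : y ^+ 2 < (1 - r ^+ 2) ^+ 2 by have := sqr_ge0 (1 - x); lra.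
    apply: le_trans (ltW h1) _; rewrite ler_sqr ?nnegrE; last 2 first.
      lra.
      lra.
    nra.
  by rewrite ler_sqr ?nnegrE//; lra.
- by apply/andP; split; lra.
- by apply/andP; split; nra.
Qed.

Lemma box_sub_tent x y : 1 / 2 < x < 1 -> `|y| < (1 - x) / 2 -> tent_region 1 (x +i* y).
Proof.
move=> /andP[x1 x2] hy; apply/tent1E.
have hy2 : y ^+ 2 <= ((1 - x) / 2) ^+ 2.
  by rewrite -(real_normK (num_real y)) lerXn2r ?nnegrE ?(ltW hy)//; lra.
have h1 : 11 / 8 * (1 - x) <= 1 - (x ^+ 2 + y ^+ 2) by nra.
split; first by lra.
apply: (@lt_le_trans _ _ ((11 / 8 * (1 - x)) ^+ 2)).
  have : 0 < (1 - x) ^+ 2 by rewrite exprn_gt0//; lra.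
  move: hy2; rewrite !exprMn; nra.
by rewrite ler_sqr ?nnegrE//; lra.
Qed.

End TentGeometry.

(** * Tent integrals of radial weights *)

Lemma measurable_ltset d (T : measurableType d) (R : realType) (f g : T -> R) :
  measurable_fun setT f -> measurable_fun setT g -> measurable [set x | f x < g x].
Proof.
move=> mf mg; have := measurable_fun_ltr mf mg.
by move=> /(_ measurableT [set true] I); rewrite setTI.
Qed.

Lemma measurable_leset d (T : measurableType d) (R : realType) (f g : T -> R) :
  measurable_fun setT f -> measurable_fun setT g -> measurable [set x | f x <= g x].
Proof.
move=> mf mg; have := measurable_fun_ler mf mg.
by move=> /(_ measurableT [set true] I); rewrite setTI.
Qed.

Lemma integral_indicE d (T : measurableType d) (R : realType)
    (mu : {measure set T -> \bar R}) (D : set T) (f : T -> R) :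
  (\int[mu]_(x in D) (f x)%:E = \int[mu]_x (f x * \1_D x)%:E)%E.
Proof.
rewrite integral_mkcond; apply: eq_integral => x _; rewrite /patch indicE.
by case: ifP => _; rewrite ?mulr1 ?mulr0.
Qed.

Lemma eq_indic_point (R : realType) T1 T2 (A : set T1) (B : set T2) x y :
  (A x <-> B y) -> \1_A x = \1_B y :> R.
Proof.
move=> e; rewrite !indicE; congr (nat_of_bool _)%:R.
by apply/idP/idP; rewrite !inE => /e.
Qed.

Section TentWeight.
Context {R : realType}.
Local Notation leb := (@lebesgue_measure R).
Local Notation RR := (measurableTypeR R).
Local Notation U := (RR * RR)%type.
Local Notation leb2 := (leb \x leb)%E.

Let expi0 : expi 0 = 1 :> R[i]. Proof. by rewrite /expi cos0 sin0. Qed.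

Definition tent_set (t : R) : set U := [set u | tent_region (expi t) (of_cpair u)].

Lemma measurable_tent_set_joint :
  measurable [set p : RR * U | tent_set p.1 p.2].
Proof.
have cz : cmeas (fun p : RR * U => of_cpair p.2).
  apply: (cmeas_comp (h := snd) (f := fun u : U => of_cpair u)); last exact: cmeas_of_cpair.
  exact: measurable_snd.
have cxi : cmeas (fun p : RR * U => Num.conj (expi p.1)).
  have c1 : measurable_fun setT (fun p : RR * U => cos p.1).
    apply: (measurableT_comp (f := @cos R)); last exact: measurable_fst.
    by apply: continuous_measurable_fun; exact: continuous_cos.
  have s1 : measurable_fun setT (fun p : RR * U => sin p.1).
    apply: (measurableT_comp (f := @sin R)); last exact: measurable_fst.
    by apply: continuous_measurable_fun; exact: continuous_sin.
  by split => //=; exact: measurable_funN.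
rewrite (_ : [set p | _] =
  [set p : RR * U | cmod (of_cpair p.2) < 1] `&`
  [set p : RR * U | cmod (1 - of_cpair p.2 * Num.conj (expi p.1))
       < 1 - cmod (of_cpair p.2) ^+ 2])//.
  apply: measurableI; apply: measurable_ltset => //.
  - exact: measurable_cmod.
  - apply: measurable_cmod; under eq_fun do rewrite -mulN1r.
    apply: cmeasD; first exact: cmeas_cst.
    by apply: cmeasM; [exact: cmeas_cst|exact: cmeasM].
  - apply: measurable_funB => //; apply: measurable_funX; exact: measurable_cmod.
Qed.

Lemma measurable_tent_set t : measurable (tent_set t).
Proof.
have := measurable_xsection t measurable_tent_set_joint.
by rewrite (_ : xsection _ _ = tent_set t)//; apply/seteqP; split => u;
  rewrite /xsection /= inE.
Qed.

Variables (h : R -> R) (alpha : R).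
Hypotheses (mh : measurable_fun setT h) (h0 : forall r, 0 <= h r)
  (hmono : forall r s, 0 <= r -> r <= s -> s < 1 -> h r <= h s).
Local Open Scope ereal_scope.

Definition weight (u : U) : R :=
  (h (cmod (of_cpair u)) * (1 - cmod (of_cpair u) ^+ 2) `^ alpha)%R.

Let mcm : measurable_fun setT (fun u : U => cmod (of_cpair u)).
Proof. by apply: measurable_cmod; exact: cmeas_of_cpair. Qed.

Lemma measurable_weight : measurable_fun setT weight.
Proof.
apply: measurable_funM; first exact: measurableT_comp.
apply: (measurableT_comp (measurable_powR alpha)).
by apply: measurable_funB => //; exact: measurable_funX.
Qed.

Lemma weight_ge0 u : (0 <= weight u)%R.
Proof. by rewrite mulr_ge0// powR_ge0. Qed.

Definition tent_int t := \int[leb2]_(u in tent_set t) (weight u)%:E.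

Lemma tent_intE t : tent_int t = \int[leb2]_u (weight u * \1_(tent_set t) u)%:E.
Proof. exact: integral_indicE. Qed.

Definition radial_int := \int[leb]_(r in `]0%R, 1%R[) (h r * (1 - r) `^ (alpha + 1))%:E.

(** Rotation by t maps the tent at 1 onto the tent at exp(it) and preserves weights. *)
Lemma tent_int_rotation t : sin t != 0%R -> tent_int t = tent_int 0.
Proof.
move=> s0; rewrite !tent_intE.
rewrite -(integral_rotation (g := fun u => weight u * \1_(tent_set t) u)%R s0); last 2 first.
- by apply: measurable_funM; [exact: measurable_weight|apply: measurable_indic; exact: measurable_tent_set].
- by move=> u; rewrite mulr_ge0 ?weight_ge0.
apply: eq_integral => u _; congr EFin.
have ofr : of_cpair (rotation t u) = (expi t * of_cpair u)%R by rewrite /rotation of_cpairK.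
congr (_ * _)%R; first by rewrite /weight ofr cmodM cmod_expi mul1r.
apply: eq_indic_point; rewrite /tent_set /= ofr expi0; exact: tent_region_rotation.
Qed.

(** The section of the triangle above x has length 2 c (1 - x); this is where the
    exponent alpha + 1 of the radial integral comes from. *)
Lemma strip_integral (k : R -> R) (a c : R) : measurable_fun setT k ->
  (forall x, (0 <= k x)%R) -> (0 < c)%R ->
  let B := [set u : U | (a < u.1 < 1)%R /\ (`|u.2| <= c * (1 - u.1))%R] in
  measurable B /\
  \int[leb2]_(u in B) (k u.1)%:E =
  \int[leb]_(x in `]a, 1%R[) (k x * (2 * c * (1 - x)))%:E.
Proof.
move=> mk k0 c0 B.
have mB : measurable B.
  rewrite (_ : B = [set u : U | (cst a u < u.1)%R] `&` [set u : U | (u.1 < cst 1 u)%R] `&`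
     [set u : U | (`|u.2| <= c * (1 - u.1))%R]); last first.
    apply/seteqP; split => u; first by case=> /andP[? ?] ?.
    by case=> -[? ?] ?; split => //; apply/andP.
  apply: measurableI; first by apply: measurableI; apply: measurable_ltset => //; exact: measurable_fst.
  apply: measurable_leset; first by apply: measurableT_comp => //; exact: measurable_snd.
  by apply: measurable_funM => //; apply: measurable_funB => //; exact: measurable_fst.
split=> //.
rewrite (integral_indicE leb2 B (fun u : U => k u.1)).
rewrite (integral_indicE leb `]a, 1%R[%classic (fun x => k x * (2 * c * (1 - x)))%R).
have mG : measurable_fun setT (fun u : U => (k u.1 * \1_B u)%:E).
  apply/measurable_EFinP; apply: measurable_funM; last exact: measurable_indic.
  exact: (measurableT_comp mk (@measurable_fst _ _ RR RR)).
rewrite (fubini_tonelli1 _ mG); last by move=> u; rewrite lee_fin mulr_ge0.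
apply: eq_integral => x _; rewrite /fubini_F /=.
have [xa|xa] := boolP (a < x < 1)%R; last first.
  rewrite indicE memNset ?mulr0; last by rewrite /= in_itv /=; exact/negP.
  under eq_integral => y _.
    rewrite indicE memNset ?mulr0; last by rewrite /B /= => -[hx _]; move: xa; rewrite hx.
    over.
  by rewrite integral0.
rewrite indicE mem_set ?mulr1; last by rewrite /= in_itv.
have x1 : (0 <= c * (1 - x))%R by case/andP: xa => _ h1; rewrite mulr_ge0 ?(ltW c0)// subr_ge0 ltW.
pose I : set RR := `[(- (c * (1 - x)))%R, (c * (1 - x))%R]%classic.
transitivity (\int[leb]_y ((k x)%:E * (\1_I y)%:E)).
  apply: eq_integral => y _; rewrite -EFinM; congr (_ * _)%:E.
  apply: eq_indic_point; rewrite /B /I /= in_itv /= -ler_norml.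
  by split=> [[]|].
have mI : measurable I by exact: measurable_itv.
rewrite ge0_integralZl//; last 2 first.
- by apply/measurable_EFinP; exact: measurable_indic.
- by rewrite lee_fin.
have := integral_indic leb measurableT mI; rewrite setIT => ->.
have := @lebesgue_measure_itv R `[(- (c * (1 - x)))%R, (c * (1 - x))%R].
rewrite /= lte_fin => lI.
transitivity ((k x)%:E * (2 * (c * (1 - x)))%:E); last by rewrite -EFinM; congr EFin; ring.
congr (_ * _); apply: etrans; first exact: lI.
case: ltP => hx; first by rewrite -EFinD; congr EFin; ring.
by congr EFin; lra.
Qed.

Let p2 : (0 < 2 `^ `|alpha| :> R)%R. Proof. exact: powR_gt0. Qed.

Let powRD1 (w : R) : (0 < w)%R -> (w `^ (alpha + 1) = w `^ alpha * w)%R.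
Proof.
move=> w0; rewrite powRD; last by rewrite (gt_eqF w0) implybT.
by rewrite powRr1// ltW.
Qed.

Let mweight1 (l m : R) : measurable_fun setT (fun x : R => h (l * x + m) * (1 - x) `^ alpha)%R.
Proof.
apply: measurable_funM.
  apply: measurableT_comp => //; apply: measurable_funD => //; exact: measurable_funM.
apply: (measurableT_comp (measurable_powR alpha)).
by apply: measurable_funB.
Qed.

(** In the tent h(|z|) <= h((1 + x) / 2), and the integral over the triangle containing the
    tent becomes the radial one by the affine substitution r = (1 + x) / 2. *)
Lemma tent_int_lty : radial_int < +oo -> tent_int 0 < +oo.
Proof.
move=> Jfin.
pose k x := (2 `^ `|alpha| * (h (2^-1 * x + 2^-1) * (1 - x) `^ alpha))%R.
have mk : measurable_fun setT k by apply: measurable_funM => //; exact: mweight1.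
have k0 x : (0 <= k x)%R by rewrite /k !mulr_ge0 ?powR_ge0.
have [mB eB] := strip_integral 0 mk k0 (ltr0n _ 2).
set B := [set u | _] in mB eB.
(* the function of r = (1 + x) / 2 that dominates the weight on the tent *)
pose f (r : R) := (2 `^ `|alpha| * (h r * (2 * (1 - r)) `^ alpha) * (4 * (2 * (1 - r))) * \1_`]2^-1, 1[ r)%R.
have mf : measurable_fun setT f.
  apply: measurable_funM; last exact: measurable_indic.
  apply: measurable_funM.
    apply: measurable_funM => //; apply: measurable_funM => //.
    apply: (measurableT_comp (measurable_powR alpha)).
    by apply: measurable_funM => //; exact: measurable_funB.
  by apply: measurable_funM => //; apply: measurable_funM => //; exact: measurable_funB.
have f0 r : (0 <= f r)%R.
  rewrite /f indicE; case: (boolP (r \in _)) => [|_]; last by rewrite mulr0.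
  rewrite inE /= in_itv /= => /andP[r1 r2].
  by rewrite mulr1 !mulr_ge0 ?powR_ge0// subr_ge0 ltW.
apply: (@le_lt_trans _ _ (\int[leb2]_(u in B) (k u.1)%:E)).
  rewrite tent_intE (integral_indicE leb2 B (fun u : U => k u.1)); apply: ge0_le_integral => //.
  - by move=> u _; rewrite lee_fin mulr_ge0 ?weight_ge0.
  - apply/measurable_EFinP; apply: measurable_funM; first exact: measurable_weight.
    apply: measurable_indic; exact: measurable_tent_set.
  - apply/measurable_EFinP; apply: measurable_funM; last exact: measurable_indic.
    exact: (measurableT_comp mk (@measurable_fst _ _ RR RR)).
  - move=> [x y] _; rewrite lee_fin !indicE; case: (boolP ((x, y) \in tent_set 0)); last first.
      by move=> _; rewrite mulr0 mulr_ge0.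
    rewrite inE /tent_set /= expi0.
    move=> /tent_sub_box /= [/andP[x0 x1] hy /andP[xr rx] r1 hr].
    rewrite mem_set; last by rewrite /B /= x0 x1.
    rewrite !mulr1 /weight /k /of_cpair /= mulrCA.
    have w0 : (0 < 1 - x)%R by rewrite subr_gt0.
    have hr' : ((1 - x) / 2 <= 1 - cmod (x +i* y) ^+ 2 <= 2 * (1 - x))%R by [].
    have /andP[_ hp] := powR_comparable alpha w0 hr'.
    apply: ler_pM => //; first exact: powR_ge0.
    by apply: hmono => //; lra.
rewrite eB.
have -> : \int[leb]_(x in `]0%R, 1%R[) (k x * (2 * 2 * (1 - x)))%:E =
    \int[leb]_x (f (2^-1 * x + 2^-1)%R)%:E.
  rewrite integral_indicE; apply: eq_integral => x _; congr EFin; rewrite /f /k.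
  rewrite (_ : (2 * (1 - (2^-1 * x + 2^-1)) = 1 - x)%R); last by field.
  congr (_ * _)%R; first by rewrite -natrM.
  apply: eq_indic_point; rewrite /= !in_itv /=.
  by split=> /andP[? ?]; apply/andP; split; lra.
rewrite integral_affine//.
apply: lte_mul_pinfty; [by rewrite lee_fin|by []|].
pose C := (2 `^ `|alpha| * 2 `^ alpha * 8)%R.
have C0 : (0 <= C)%R by rewrite !mulr_ge0 ?powR_ge0.
apply: (@le_lt_trans _ _ (C%:E * radial_int)); last exact: lte_mul_pinfty.
have mr : measurable_fun setT (fun r : R => h r * (1 - r) `^ (alpha + 1))%R.
  apply: measurable_funM => //; apply: (measurableT_comp (measurable_powR (alpha + 1))).
  exact: measurable_funB.
rewrite /radial_int (integral_indicE leb `]0%R, 1%R[%classic (fun r => h r * (1 - r) `^ (alpha + 1))%R) -ge0_integralZl ?lee_fin//; last 2 first.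
- by apply/measurable_EFinP; apply: measurable_funM => //; exact: measurable_indic.
- by move=> r _; rewrite lee_fin !mulr_ge0 ?powR_ge0.
apply: ge0_le_integral => //.
- by move=> r _; rewrite lee_fin.
- exact/measurable_EFinP.
- apply: measurable_funeM; apply/measurable_EFinP; apply: measurable_funM; [exact: mr|exact: measurable_indic].
move=> r _; rewrite -EFinM lee_fin /f !indicE.
case: (boolP (r \in `]2^-1%R, 1%R[%classic)) => [|_]; last first.
  by rewrite mulr0 !mulr_ge0 ?powR_ge0.
rewrite inE /= in_itv /= => /andP[r1 r2].
rewrite mem_set; last by rewrite /= in_itv /=; apply/andP; split; lra.
have w0 : (0 < 1 - r)%R by rewrite subr_gt0.
rewrite powRM ?(ltW w0)// powRD1// /C !mulr1.
by rewrite le_eqVlt; apply/orP; left; apply/eqP; ring.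
Qed.

(** On [0, 1/2] the radial integrand is bounded. On [1/2, 1[ it is compared with the
    triangle contained in the tent, where h(x) <= h(|z|). *)
Lemma radial_int_lty : tent_int 0 < +oo -> radial_int < +oo.
Proof.
move=> Vfin.
have mr : measurable_fun setT (fun r : R => h r * (1 - r) `^ (alpha + 1))%R.
  apply: measurable_funM => //; apply: (measurableT_comp (measurable_powR (alpha + 1))).
  exact: measurable_funB.
have pos r : (0 <= h r * (1 - r) `^ (alpha + 1))%R by rewrite mulr_ge0 ?powR_ge0.
have -> : radial_int =
  \int[leb]_(r in `]0%R, 2^-1%R]) (h r * (1 - r) `^ (alpha + 1))%:E +
  \int[leb]_(r in `]2^-1%R, 1%R[) (h r * (1 - r) `^ (alpha + 1))%:E.
  rewrite /radial_int -ge0_integral_setU//=.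
  - congr (integral _ _ _); apply/seteqP; split => r; rewrite /= !in_itv /=.
      by move=> /andP[r0 r1]; case: (lerP r 2^-1) => h2; [left|right]; rewrite ?r0 ?r1.
    by case=> /andP[? ?]; apply/andP; split; lra.
  - by apply/measurable_EFinP; exact: measurable_funTS.
  - by move=> r _; rewrite lee_fin.
  - apply/disj_set2P; rewrite -subset0 => r [/=]; rewrite !in_itv /= => /andP[_ h1] /andP[h2 _].
    by move: h1; rewrite leNgt h2.
rewrite lte_add_pinfty//.
  pose C := (h 2^-1 * 2 `^ `|(alpha + 1)%R|)%R.
  apply: (@le_lt_trans _ _ (\int[leb]_(r in `]0%R, 2^-1%R]) C%:E)).
    apply: ge0_le_integral => //.
    - by move=> r _; rewrite lee_fin.
    - by apply/measurable_EFinP; exact: measurable_funTS.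
    - move=> r; rewrite /= in_itv /= => /andP[r0 r1]; rewrite lee_fin /C.
      apply: ler_pM => //; first exact: powR_ge0.
        by apply: hmono => //; lra.
      have hw : (1 / 2 <= 1 - r <= 2 * 1)%R by apply/andP; split; lra.
      by have /andP[_] := powR_comparable (alpha + 1) ltr01 hw; rewrite powR1 mulr1.
  rewrite (integral_cst leb _ C%:E)//= lebesgue_measure_itv /= lte_fin.
  by case: ifP => _; rewrite ?mule0// -EFinB -EFinM ltry.
pose k x := ((2 `^ `|alpha|)^-1 * (h (1 * x + 0) * (1 - x) `^ alpha))%R.
have mk : measurable_fun setT k by apply: measurable_funM => //; exact: mweight1.
have k0 x : (0 <= k x)%R by rewrite /k !mulr_ge0 ?powR_ge0// invr_ge0 ltW.
have c40 : (0 < 4^-1 :> R)%R by rewrite invr_gt0.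
have [mB eB] := strip_integral 2^-1 mk k0 c40.
set B := [set u | _] in mB eB.
have Bfin : \int[leb2]_(u in B) (k u.1)%:E < +oo.
  apply: le_lt_trans Vfin; rewrite tent_intE (integral_indicE leb2 B (fun u : U => k u.1)); apply: ge0_le_integral => //.
  - by move=> u _; rewrite lee_fin mulr_ge0.
  - apply/measurable_EFinP; apply: measurable_funM; last exact: measurable_indic.
    exact: (measurableT_comp mk (@measurable_fst _ _ RR RR)).
  - apply/measurable_EFinP; apply: measurable_funM; first exact: measurable_weight.
    apply: measurable_indic; exact: measurable_tent_set.
  - move=> [x y] _; rewrite lee_fin !indicE; case: (boolP ((x, y) \in B)); last first.
      by move=> _; rewrite mulr0 mulr_ge0 ?weight_ge0.
    rewrite inE /B /= => -[/andP[x1 x2] hy].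
    have ht : tent_region 1%R (x +i* y).
      by apply: box_sub_tent; [apply/andP; split; lra|lra].
    rewrite mem_set; last by rewrite /tent_set /= expi0.
    have /= [_ _ /andP[xr rx] r1 hr] := tent_sub_box ht.
    rewrite !mulr1 /weight /k /of_cpair /= mulrCA mul1r addr0.
    have w0 : (0 < 1 - x)%R by rewrite subr_gt0.
    have hr' : ((1 - x) / 2 <= 1 - cmod (x +i* y) ^+ 2 <= 2 * (1 - x))%R by [].
    have /andP[hp _] := powR_comparable alpha w0 hr'.
    apply: ler_pM => //; last by apply: hmono => //; lra.
    by rewrite mulr_ge0 ?powR_ge0// invr_ge0 ltW.
pose c := (2 `^ `|alpha| * 2)%R.
have c0 : (0 <= c)%R by rewrite mulr_ge0 ?(ltW p2).
rewrite [ltLHS](_ : _ = c%:E * \int[leb2]_(u in B) (k u.1)%:E); first exact: lte_mul_pinfty.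
rewrite eB -ge0_integralZl ?lee_fin//; last 2 first.
- apply/measurable_EFinP; apply: measurable_funTS; apply: measurable_funM => //.
  by apply: measurable_funM => //; exact: measurable_funB.
- move=> x; rewrite /= in_itv /= => /andP[x1 x2]; rewrite lee_fin mulr_ge0//.
  by rewrite mulr_ge0 ?subr_ge0 ?(ltW x2)// mulr_ge0// ltW.
apply: eq_integral => x; rewrite inE /= in_itv /= => /andP[x1 x2].
rewrite -EFinM; congr EFin; rewrite powRD1 ?subr_gt0// /c /k mul1r addr0.
by field; rewrite gt_eqF.
Qed.

Theorem tent_int_radial t : sin t != 0%R -> tent_int t < +oo <-> radial_int < +oo.
Proof.
move=> s0; rewrite tent_int_rotation//; split; [exact: radial_int_lty|exact: tent_int_lty].
Qed.

End TentWeight.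

(** * Moment comparison for random fields *)

Section FubiniRectangle.
Context {R : realType} d1 (T1 : measurableType d1) d2 (T2 : measurableType d2).
Variables (m1 : {sigma_finite_measure set T1 -> \bar R})
  (m2 : {sigma_finite_measure set T2 -> \bar R}).
Local Open Scope ereal_scope.
Variable f : T1 * T2 -> \bar R.
Hypotheses (mf : measurable_fun setT f) (f0 : forall x, 0 <= f x).

Let patch0 (B : set (T1 * T2)) x : 0 <= (f \_ B) x.
Proof. by rewrite /patch; case: ifP. Qed.

Let mpatch (B : set (T1 * T2)) : measurable B -> measurable_fun setT (f \_ B).
Proof. by move=> mB; apply: (measurable_restrictT _ mB).1; exact: measurable_funTS. Qed.

Lemma fubini_rectangle (A : set T1) (D : set T2) : measurable A -> measurable D ->
  \int[m1]_(x in A) \int[m2]_(y in D) f (x, y) =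
  \int[m2]_(y in D) \int[m1]_(x in A) f (x, y).
Proof.
move=> mA mD; set g := f \_ (A `*` D).
transitivity (\int[m1]_x \int[m2]_y g (x, y)).
  rewrite integral_mkcond; apply: eq_integral => x _; rewrite /patch.
  case: ifPn => xA; last first.
    by rewrite integral0_eq// => y _; rewrite /g /patch in_setX /= (negbTE xA).
  rewrite integral_mkcond; apply: eq_integral => y _.
  by rewrite /g /patch in_setX /= xA.
rewrite fubini_tonelli; [|by apply: mpatch; exact: measurableX|exact: patch0].
rewrite [RHS]integral_mkcond; apply: eq_integral => y _; rewrite [RHS]/patch.
case: ifPn => yD; last first.
  by rewrite integral0_eq// => x _; rewrite /g /patch in_setX /= (negbTE yD) andbF.
rewrite [RHS]integral_mkcond; apply: eq_integral => x _.
by rewrite /g /patch in_setX /= yD andbT.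
Qed.

Lemma measurable_section_integral (B : set (T1 * T2)) : measurable B ->
  measurable_fun setT (fun x => \int[m2]_(y in [set y | B (x, y)]) f (x, y)).
Proof.
move=> mB; have := measurable_fun_fubini_tonelli_F (m2 := m2) _ (mpatch mB) (patch0 B).
congr measurable_fun; apply/funext => x; rewrite /fubini_F [RHS]integral_mkcond.
by apply: eq_integral => y _; rewrite /patch.
Qed.

Lemma measurable_integral_in (D : set T2) : measurable D ->
  measurable_fun setT (fun x => \int[m2]_(y in D) f (x, y)).
Proof.
move=> mD; have := measurable_section_integral (measurableX measurableT mD).
congr measurable_fun; apply/funext => x; congr (integral _ _ _).
by apply/seteqP; split => y //= [].
Qed.

End FubiniRectangle.

(** An elementary substitute for Hoelder's inequality: integrated with a well chosen
    c, it bounds a first moment by an s-th moment and a total mass. *)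
Lemma powR_interpolation (R : realType) (c y s : R) : 0 < c -> 0 <= y -> 1 <= s ->
  y <= c + c `^ (1 - s) * y `^ s.
Proof.
move=> c0 y0 s1; case: (lerP y c) => yc.
  by apply: le_trans yc _; rewrite lerDl mulr_ge0 ?powR_ge0.
have yp : 0 < y by exact: lt_trans yc.
apply: (@le_trans _ _ (c `^ (1 - s) * y `^ s)); last by rewrite lerDr ltW.
have -> : y `^ s = y `^ (s - 1) * y.
  by rewrite -{3}(powRr1 y0) -powRD ?subrK// (gt_eqF yp) implybT.
rewrite mulrA ler_peMl// -opprB powRN mulrC ler_pdivlMr ?powR_gt0// mul1r.
by apply: ge0_ler_powR; rewrite ?nnegrE ?subr_ge0// ltW.
Qed.

Lemma powR_le_expR (R : realType) (t : R) : 0 <= t ->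
  exists2 c, 0 <= c & forall x, 0 <= x -> x `^ t <= c * expR x.
Proof.
move=> t0; pose n := Num.truncn t.
have tn : t <= n.+1%:R by rewrite ltW// truncnS_gt.
(* x^t <= 1 + x^(n+1) for n + 1 >= t, and one term of the exponential series *)
exists (1 + n.+1`!%:R); first by rewrite addr_ge0.
move=> x x0; have e1 : 1 <= expR x by rewrite -expR0 ler_expR.
apply: (@le_trans _ _ (1 + x ^+ n.+1)).
  case: (lerP x 1) => x1.
    apply: (@le_trans _ _ 1); last by rewrite lerDl exprn_ge0.
    have <- : 1 `^ t = 1 :> R by rewrite powR1.
    by apply: ge0_ler_powR; rewrite ?nnegrE.
  apply: (@le_trans _ _ (x ^+ n.+1)); last by rewrite lerDr.
  by rewrite -powR_mulrn// ler_powR// ltW.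
rewrite mulrDl mul1r lerD//.
have := expR_ge1Dxn n x0.
have f0 : 0 < n.+1`!%:R :> R by rewrite ltr0n fact_gt0.
move=> h; rewrite mulrC -ler_pdivrMr//; apply: le_trans h; by rewrite lerDr.
Qed.

Section MomentComparison.
Context {R : realType} d (T : measurableType d) (P : probability T R)
  du (U : measurableType du) (mu : {sigma_finite_measure set U -> \bar R}).
Variables (q : R) (W : set T) (G : T * U -> R) (sg wt : U -> R) (m C : R).
Local Open Scope ereal_scope.
Hypotheses (q0 : (0 < q)%R) (mW : measurable W)
  (mG : measurable_fun setT G) (G0 : forall x, (0 <= G x)%R)
  (msg : measurable_fun setT sg) (sg0 : forall u, (0 <= sg u)%R)
  (mwt : measurable_fun setT wt) (wt0 : forall u, (0 <= wt u)%R)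
  (m0 : (0 < m)%R) (C0 : (0 < C)%R)
  (second_moment : forall u,
     (m * sg u ^+ 2)%:E <= \int[P]_(w in W) (G (w, u) ^+ 2)%:E)
  (exp_moment : forall u, \int[P]_(w in W) (expR (G (w, u) / sg u))%:E <= C%:E)
  (G_null : forall u, sg u = 0%R -> forall w, G (w, u) = 0%R).

(** To be compared with its deterministic analogue, the integral of sg^q against wt, where
    sg is the size of the random field G at each point. *)
Definition field_mass (D : set U) (w : T) : \bar R :=
  \int[mu]_(u in D) (G (w, u) `^ q * wt u)%:E.

Let mGq : measurable_fun setT (fun x : T * U => (G x `^ q * wt x.2)%:E).
Proof.
apply/measurable_EFinP/measurable_funM.
  exact: (measurableT_comp (measurable_powR q)).
exact: measurableT_comp.
Qed.

Let Gq0 x : 0 <= (G x `^ q * wt x.2)%:E.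
Proof. by rewrite lee_fin mulr_ge0 ?powR_ge0. Qed.

Lemma measurable_field_mass D : measurable D -> measurable_fun setT (field_mass D).
Proof. by move=> mD; exact: (measurable_integral_in mu mGq Gq0 mD). Qed.

Lemma field_mass_ge0 D w : 0 <= field_mass D w.
Proof. by apply: integral_ge0 => u _; exact: (Gq0 (w, u)). Qed.

Let mGu u : measurable_fun setT (fun w => G (w, u)).
Proof. exact: measurableT_comp mG (pair2_measurable u). Qed.

Let mGw w : measurable_fun setT (fun u => G (w, u)).
Proof. exact: measurableT_comp mG (pair1_measurable w). Qed.

Let sw u := (sg u `^ q * wt u)%R.
Let sw0 u : (0 <= sw u)%R. Proof. by rewrite mulr_ge0 ?powR_ge0. Qed.
Let msw : measurable_fun setT sw.
Proof. by apply: measurable_funM => //; exact: (measurableT_comp (measurable_powR q)). Qed.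

(** small_ball for the normalized field G / sg, with constants independent of the point. *)
Lemma mean_field_lower : exists e k, [/\ (0 < e)%R, (0 < k)%R &
  forall A u, measurable A -> A `<=` W -> P (W `\` A) <= e%:E ->
   (k * sg u `^ q)%:E <= \int[P]_(w in A) (G (w, u) `^ q)%:E].
Proof.
have [e [k [e0 k0 sb]]] := small_ball P m0 C0 q0.
exists e, k; split => // A u mA AW PA.
have [sgu|sgu] := eqVneq (sg u) 0%R.
  rewrite sgu powR0 ?gt_eqF// mulr0; apply: integral_ge0 => w _.
  by rewrite lee_fin powR_ge0.
have s0 : (0 < sg u)%R by rewrite lt_def sgu sg0.
have mq (r : R) D : measurable_fun D (fun w => (G (w, u) `^ r)%:E).
  by apply/measurable_EFinP/measurable_funTS; exact: (measurableT_comp (measurable_powR r)).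
have := sb W A (fun w => G (w, u) / sg u)%R mW mA AW.
have -> : \int[P]_(w in A) ((G (w, u) / sg u) `^ q)%:E =
    (sg u `^ q)^-1%:E * \int[P]_(w in A) (G (w, u) `^ q)%:E.
  rewrite -ge0_integralZl//; last 2 first.
  - by move=> w _; rewrite lee_fin powR_ge0.
  - by rewrite lee_fin invr_ge0 powR_ge0.
  apply: eq_integral => w _; rewrite -EFinM mulrC powRM ?invr_ge0//.
  by rewrite -(powR_inv1 (sg0 u)) -(powR_inv1 (powR_ge0 (sg u) q)) -!powRrM mulN1r mulrN1.
move=> h; rewrite EFinM muleC -lee_pdivlMl ?powR_gt0//; apply: h => //.
- by apply: measurable_funM => //; exact: measurable_funTS.
- by move=> w; rewrite divr_ge0.
have -> : \int[P]_(w in W) ((G (w, u) / sg u) ^+ 2)%:E =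
    (sg u ^- 2)%:E * \int[P]_(w in W) (G (w, u) ^+ 2)%:E.
  rewrite -ge0_integralZl//; last 3 first.
  - by apply/measurable_EFinP/measurable_funTS; exact: measurable_funX.
  - by move=> w _; rewrite lee_fin sqr_ge0.
  - by rewrite lee_fin invr_ge0 sqr_ge0.
  by apply: eq_integral => w _; rewrite -EFinM expr_div_n mulrC.
rewrite lee_pdivlMl ?exprn_gt0// -EFinM mulrC; exact: second_moment.
Qed.

(** If the mass is almost surely finite, it is at most some n on an event A of
    probability close to 1. By Fubini the integral of the mass over A is an integral
    over D of means of G^q over A, which are at least k sg^q. *)
Lemma field_mass_necessary D : measurable D -> P (~` W) = 0 ->
  {ae P, forall w, W w -> field_mass D w < +oo} ->
  \int[mu]_(u in D) (sg u `^ q * wt u)%:E < +oo.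
Proof.
move=> mD PW fin; have [e [k [e0 k0 hk]]] := mean_field_lower.
(* the sublevel sets of the mass exhaust the probability space up to a null set *)
pose F n := [set w | field_mass D w <= n%:R%:E].
have mF n : measurable (F n).
  have := measurable_field_mass mD measurableT (emeasurable_itv `]-oo, n%:R%:E]).
  rewrite setTI; congr measurable; apply/seteqP; split => w; by rewrite /= in_itv.
have mU : measurable (\bigcup_n F n) by exact: bigcupT_measurable.
have PU : P (\bigcup_n F n) = 1.
  have : P (~` \bigcup_n F n) = 0.
    apply/negligibleP; first exact: measurableC.
    have nW : P.-negligible (~` W) by apply/negligibleP => //; exact: measurableC.
    apply: negligibleS (negligibleU nW fin) => w hw.
    case: (pselect (W w)) => Ww; [right|by left].
    move=> /(_ Ww) hlt; apply: hw.
    move: hlt (field_mass_ge0 D w); case E : (field_mass D w) => [y| |]// _ y0.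
    exists (Num.truncn y).+1 => //; rewrite /F /= E lee_fin ltW// truncnS_gt//.
  rewrite probability_setC//; case: (P _) (fin_num_measure P _ mU) => // y _.
  by rewrite -EFinB => -[/eqP]; rewrite subr_eq0 => /eqP <-.
have [n hn] : exists n, (1 - e)%:E < P (F n).
  apply: contrapT => /forallNP hN.
  have cv := nondecreasing_cvg_mu (mu := P) mF mU _.
  have : P (\bigcup_n F n) <= (1 - e)%:E.
    have hcv : (P \o F) x @[x --> \oo] --> P (\bigcup_n F n).
      apply: cv => i j ij; apply/subsetPset => w /= h.
      by apply: le_trans h _; rewrite lee_fin ler_nat.
    rewrite -(cvg_lim _ hcv)//; apply: lime_le; first by apply/cvg_ex; eexists; exact: hcv.
    by apply: nearW => i; rewrite leNgt; apply/negP; exact: hN.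
  rewrite PU lee_fin; lra.
pose A := W `&` F n.
have mA : measurable A by exact: measurableI.
have PA : P (W `\` A) <= e%:E.
  apply: (@le_trans _ _ (P (~` F n))).
    apply: le_measure; rewrite ?inE; [exact: measurableD|exact: measurableC|].
    by move=> w [Ww nA] hF; apply: nA.
  rewrite probability_setC//; move: hn; rewrite -(fineK (fin_num_measure P _ (mF n))) lte_fin => hy.
  by rewrite -EFinB lee_fin; lra.
have key : k%:E * \int[mu]_(u in D) (sw u)%:E <= n%:R%:E.
  apply: (@le_trans _ _ (\int[P]_(w in A) field_mass D w)); last first.
    apply: (@le_trans _ _ (\int[P]_(w in A) cst n%:R%:E w)).
      apply: ge0_le_integral => //.
      - by move=> w _; exact: field_mass_ge0.
      - exact/measurable_funTS/measurable_field_mass.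
      - by move=> w [].
    rewrite integral_cst// -[leRHS]mule1; apply: lee_wpmul2l; first by rewrite lee_fin.
    exact: probability_le1.
  rewrite /field_mass (fubini_rectangle P mu mGq Gq0 mA mD).
  rewrite -ge0_integralZl//; last 3 first.
  - exact/measurable_EFinP/measurable_funTS.
  - by move=> u _; rewrite lee_fin.
  - by rewrite lee_fin ltW.
  apply: ge0_le_integral => //.
  - by move=> u _; rewrite -EFinM lee_fin mulr_ge0// ltW.
  - by apply: measurable_funeM; exact/measurable_EFinP/measurable_funTS.
  - apply: measurable_funTS.
    have := @measurable_integral_in R _ _ _ _ P (fun x : U * T => (G (x.2, x.1) `^ q * wt x.1)%:E).
    apply; [|by move=> x; exact: (Gq0 (x.2, x.1))|exact: mA].
    exact: (measurableT_comp mGq (@measurable_swap _ _ U T)).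
  move=> u _; under eq_integral do rewrite /= EFinM.
  rewrite ge0_integralZr//.
  - rewrite [leLHS](_ : _ = (k * sg u `^ q)%:E * (wt u)%:E); last by rewrite -!EFinM mulrA.
    by apply: lee_wpmul2r; [rewrite lee_fin|apply: hk => // w []].
  - by apply/measurable_EFinP/measurable_funTS; exact: (measurableT_comp (measurable_powR q)).
  - by move=> w _; rewrite lee_fin powR_ge0.
  - by rewrite lee_fin.
rewrite ltNge leye_eq; apply/negP => /eqP E; move: key.
by rewrite /sw E gt0_muley ?lte_fin// leye_eq.
Qed.

(** With s = max(rho, 1), powR_interpolation applied to (G / sg)^q bounds the mass by
    k (V + 1), where k^s - 1 is the integral of (G / sg)^(q s) against sg^q wt; the
    expectation of the latter is at most a constant times V because exponential moments
    control all powers. *)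
Lemma field_mass_sufficient rho : (0 < rho)%R -> exists2 c, (0 <= c)%R &
  forall D V, measurable D -> (0 <= V)%R ->
   \int[mu]_(u in D) (sg u `^ q * wt u)%:E <= V%:E ->
   \int[P]_(w in W) (field_mass D w `^ rho) <= ((V + 1) `^ rho * (c * V + 1))%:E.
Proof.
move=> rho0; pose s := Num.max rho 1%R.
have s1 : (1 <= s)%R by rewrite le_max lexx orbT.
have sr : (rho <= s)%R by rewrite le_max lexx.
have s0 : (0 < s)%R by exact: lt_le_trans s1.
have qs0 : (0 <= q * s)%R by rewrite mulr_ge0// ltW.
have [c c0 hc] := powR_le_expR qs0.
exists (c * C)%R; first by rewrite mulr_ge0// ltW.
move=> D V mD V0 hV.
pose y (x : T * U) := ((G x / sg x.2) `^ (q * s))%R.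
have my : measurable_fun setT y.
  apply: (measurableT_comp (measurable_powR (q * s))); apply: measurable_funM => //.
  rewrite (_ : (fun x => _) = fun x : T * U => (sg x.2 `^ (-1))%R).
    by apply: (measurableT_comp (measurable_powR (-1)%R)); exact: measurableT_comp.
  by apply/funext => x; rewrite powR_inv1.
have y0 x : (0 <= y x)%R by exact: powR_ge0.
have mys : measurable_fun setT (fun x => (y x * sw x.2)%:E).
  by apply/measurable_EFinP; apply: measurable_funM => //; exact: measurableT_comp.
have ys0 x : 0 <= (y x * sw x.2)%:E by rewrite lee_fin mulr_ge0.
pose Z w := \int[mu]_(u in D) (y (w, u) * sw u)%:E.
have Z0 w : 0 <= Z w by apply: integral_ge0 => u _; exact: (ys0 (w, u)).
have mZ : measurable_fun setT Z by exact: (measurable_integral_in mu mys ys0 mD).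
have V1 : (0 < V + 1)%R by rewrite ltr_wpDl.
have ptw w : field_mass D w `^ rho <= ((V + 1) `^ rho)%:E * (Z w + 1).
  case E : (Z w) (Z0 w) => [z| |]// z0; last first.
    by rewrite addye// gt0_muley ?leey// lte_fin powR_gt0.
  rewrite lee_fin in z0.
  have z1 : (1 <= z + 1)%R by rewrite lerDr.
  (* z + 1 avoids the degenerate value k = 0 *)
  pose k := ((z + 1) `^ s^-1)%R.
  have k0 : (0 < k)%R by rewrite powR_gt0// (lt_le_trans ltr01).
  have ks : (k `^ s = z + 1)%R.
    by rewrite /k -powRrM mulVf ?gt_eqF// powRr1// (le_trans ler01).
  have kz : (k `^ (1 - s) * z <= k)%R.
    rewrite powRB ?(gt_eqF k0) ?implybT// ks powRr1 ?(ltW k0)// -mulrA ger_pMr//.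
    by rewrite mulrC ler_pdivrMr ?mul1r ?lerDl// (lt_le_trans ltr01).
  have hY : field_mass D w <= (k * (V + 1))%:E.
    apply: (@le_trans _ _ (k%:E * \int[mu]_(u in D) (sw u)%:E + (k `^ (1 - s))%:E * Z w)).
      rewrite -!ge0_integralZl//; last 5 first.
      - by apply: measurable_funTS; exact: (measurableT_comp mys (pair1_measurable w)).
      - by rewrite lee_fin powR_ge0.
      - exact/measurable_EFinP/measurable_funTS.
      - by move=> u _; rewrite lee_fin.
      - by rewrite lee_fin ltW.
      rewrite -ge0_integralD//; last 4 first.
      - by move=> u _; rewrite -EFinM lee_fin mulr_ge0// ltW.
      - by apply: measurable_funeM; exact/measurable_EFinP/measurable_funTS.
      - by move=> u _; rewrite -EFinM lee_fin !mulr_ge0// powR_ge0.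
      - by apply/measurable_funeM/measurable_funTS; exact: (measurableT_comp mys (pair1_measurable w)).
      apply: ge0_le_integral => //.
      - by apply: measurable_funTS; exact: (measurableT_comp mGq (pair1_measurable w)).
      - apply: emeasurable_funD; apply: measurable_funeM.
          exact/measurable_EFinP/measurable_funTS.
        by apply: measurable_funTS; exact: (measurableT_comp mys (pair1_measurable w)).
      move=> u _; rewrite -!EFinM -EFinD lee_fin /sw /y /=.
      have [su|su] := eqVneq (sg u) 0%R.
        by rewrite (G_null su) powR0 ?gt_eqF// mul0r addr_ge0// mulr_ge0 ?powR_ge0// ?(ltW k0)//
          !mulr_ge0 ?powR_ge0.
      have sp : (0 < sg u)%R by rewrite lt_def su sg0.
      have -> : (G (w, u) `^ q = (G (w, u) / sg u) `^ q * sg u `^ q)%R.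
        by rewrite -powRM ?divr_ge0// divfK.
      rewrite powRrM -[leLHS]mulrA [X in (_ <= _ + X)%R]mulrA -mulrDl; apply: ler_wpM2r.
        by rewrite mulr_ge0 ?powR_ge0.
      by apply: powR_interpolation => //; exact: powR_ge0.
    apply: (@le_trans _ _ (k%:E * V%:E + (k `^ (1 - s))%:E * z%:E)).
      by rewrite E leeD2r//; apply: lee_wpmul2l; rewrite ?lee_fin ?(ltW k0).
    by rewrite -!EFinM -EFinD lee_fin mulrDr mulr1 lerD2l.
  rewrite -EFinD -EFinM.
  apply: (@le_trans _ _ ((k * (V + 1))%:E `^ rho)).
    have kV0 : 0 <= (k * (V + 1))%:E by rewrite lee_fin mulr_ge0// ltW.
    apply: gt0_ler_poweR; rewrite ?in_itv ?(ltW rho0)//= ?field_mass_ge0 ?leey//.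
    by rewrite kV0.
  rewrite poweR_EFin lee_fin powRM ?(ltW k0) ?(ltW V1)// mulrC ler_wpM2l ?powR_ge0//.
  rewrite /k -powRrM -[leRHS]powRr1 ?(le_trans ler01)// ler_powR//.
  by rewrite mulrC ler_pdivrMr// mul1r.
apply: (@le_trans _ _ (\int[P]_(w in W) (((V + 1) `^ rho)%:E * (Z w + 1)))).
  apply: ge0_le_integral => //.
  - by move=> w _; exact: poweR_ge0.
  - apply: measurable_funTS; apply: (measurableT_comp (measurable_poweR rho)).
    exact: measurable_field_mass.
  - apply/measurable_funTS/measurable_funeM; apply: emeasurable_funD => //.
rewrite ge0_integralZl//; last 3 first.
- by apply/measurable_funTS/emeasurable_funD.
- by move=> w _; rewrite adde_ge0.
- by rewrite lee_fin powR_ge0.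
rewrite EFinM; apply: lee_wpmul2l; first by rewrite lee_fin powR_ge0.
rewrite ge0_integralD//; last exact: measurable_funTS.
rewrite EFinD; apply: leeD; last first.
  by rewrite (integral_cst P mW 1) mul1e; exact: probability_le1.
rewrite /Z (fubini_rectangle P mu mys ys0 mW mD).
apply: (@le_trans _ _ (\int[mu]_(u in D) ((c * C)%:E * (sw u)%:E))); last first.
  rewrite ge0_integralZl//; last 3 first.
  - exact/measurable_EFinP/measurable_funTS.
  - by move=> u _; rewrite lee_fin.
  - by rewrite lee_fin mulr_ge0// ltW.
  by rewrite [leRHS]EFinM; apply: lee_wpmul2l; rewrite ?lee_fin ?mulr_ge0// ltW.
apply: ge0_le_integral => //.
- by move=> u _; apply: integral_ge0 => w _; exact: (ys0 (w, u)).
- apply: measurable_funTS.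
  have := @measurable_integral_in R _ _ _ _ P (fun x : U * T => (y (x.2, x.1) * sw x.1)%:E).
  apply; [|by move=> x; exact: (ys0 (x.2, x.1))|exact: mW].
  exact: (measurableT_comp mys (@measurable_swap _ _ U T)).
- by apply: measurable_funeM; exact/measurable_EFinP/measurable_funTS.
move=> u _; under eq_integral do rewrite /= EFinM.
have myu : measurable_fun W (fun w => (y (w, u))%:E).
  apply/measurable_EFinP/measurable_funTS; exact: (measurableT_comp my (pair2_measurable u)).
rewrite ge0_integralZr ?lee_fin//; last by move=> w _; rewrite lee_fin.
apply: lee_wpmul2r; first by rewrite lee_fin.
have mexp : measurable_fun W (fun w => (expR (G (w, u) / sg u))%:E).
  apply/measurable_EFinP/measurable_funTS; apply: measurableT_comp => //.
  exact: measurable_funM.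
apply: (@le_trans _ _ (\int[P]_(w in W) (c%:E * (expR (G (w, u) / sg u))%:E))).
  apply: ge0_le_integral => //.
  - by move=> w _; rewrite lee_fin.
  - exact: measurable_funeM.
  - by move=> w _; rewrite -EFinM lee_fin; apply: hc; rewrite divr_ge0.
rewrite ge0_integralZl ?lee_fin//.
by rewrite [leRHS]EFinM; apply: lee_wpmul2l; rewrite ?lee_fin.
Qed.

End MomentComparison.

(** * The quadratic profile and the random radius of convergence *)

Section Profile.
Context {R : realType}.
Variable a : nat -> R[i].
Implicit Types r s : R.
Hypothesis ha : forall s : R, 0 <= s < 1 -> summable_at a s.

(** The value 0 outside [0, 1[ makes the function measurable on the line, and makes the
    moment bounds below hold at points outside the disk. *)
Definition profile (r : R) : R := Num.sqrt (sig2 a r * \1_`[0%R, 1%R[ r).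

Lemma profile_ge0 r : 0 <= profile r. Proof. exact: sqrtr_ge0. Qed.

Let in01 r : 0 <= r < 1 -> \1_`[0%R, 1%R[ r = 1 :> R.
Proof. by move=> hr; rewrite indicE mem_set//= in_itv. Qed.

Lemma sig2_partial r n : 0 <= r < 1 ->
  \sum_(0 <= k < n) (cmod (a k) * r ^+ k) ^+ 2 <= sig2 a r.
Proof.
move=> /[dup] hr /andP[r0 r1].
apply: (nondecreasing_cvgn_le (u_ := series (fun k => (cmod (a k) * r ^+ k) ^+ 2))).
  by apply: nondecreasing_series => k _ _; exact: sqr_ge0.
by apply: summable_nonneg_cvg => //; exact: ha.
Qed.

Lemma sig2_ge0 r : 0 <= r < 1 -> 0 <= sig2 a r.
Proof. by move=> /(sig2_partial 0); rewrite big_geq. Qed.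

Lemma profile_sqr r : 0 <= r < 1 -> profile r ^+ 2 = sig2 a r.
Proof. by move=> hr; rewrite /profile in01// mulr1 sqr_sqrtr// sig2_ge0. Qed.

Lemma profile_out r : 1 <= r -> profile r = 0.
Proof.
move=> r1; rewrite /profile indicE memNset ?mulr0 ?sqrtr0//=.
by rewrite in_itv /= ltNge r1 andbF.
Qed.

Lemma profile_mono r s : 0 <= r -> r <= s -> s < 1 -> profile r <= profile s.
Proof.
move=> r0 rs s1; have hr : 0 <= r < 1 by rewrite r0 (le_lt_trans rs).
have hs : 0 <= s < 1 by rewrite s1 (le_trans r0).
rewrite /profile !in01// !mulr1 ler_wsqrtr//.
rewrite /sig2; apply: ler_lim.
- by apply: summable_nonneg_cvg => //; exact: ha.
- by apply: summable_nonneg_cvg => //; [exact: ha|exact: le_trans rs].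
apply: nearW => n; apply: ler_sum => k _.
have p x : 0 <= x -> 0 <= cmod (a k) * x ^+ k by move=> x0; rewrite mulr_ge0 ?cmod_ge0 ?exprn_ge0.
rewrite lerXn2r// ?nnegrE ?p ?(le_trans r0)//.
by rewrite ler_wpM2l ?cmod_ge0// lerXn2r// nnegrE (le_trans r0).
Qed.

Lemma measurable_profile : measurable_fun setT profile.
Proof.
apply: (measurableT_comp (f := @Num.sqrt R)).
  by apply: continuous_measurable_fun; exact: sqrt_continuous.
apply: (measurable_fun_cvg (h := fun n r =>
  (\sum_(0 <= k < n) (cmod (a k) * r ^+ k) ^+ 2) * \1_`[0%R, 1%R[ r)).
  move=> n; apply: measurable_funM; last exact: measurable_indic.
  apply: measurable_sum => k; apply: measurable_funX; apply: measurable_funM => //.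
move=> r _; case: (boolP (0 <= r < 1)) => hr.
  apply: cvgM; last exact: cvg_cst.
  apply: summable_nonneg_cvg; first exact: ha.
  by case/andP: hr.
rewrite indicE memNset; last by rewrite /= in_itv /=; exact/negP.
by rewrite mulr0; under eq_fun do rewrite mulr0; exact: cvg_cst.
Qed.

End Profile.

Section GoodSet.
Context {R : realType} d (T : measurableType d) (P : probability T R).
Variables (X : nat -> T -> R[i]) (v : R) (a : nat -> R[i]).
Hypothesis HX : subgaussian_sequence P X v.
Hypothesis ha : forall s : R, 0 <= s < 1 -> summable_at a s.
Local Open Scope ereal_scope.

Let cX k : cmeas (X k). Proof. by apply: cmeas_rv; case: HX. Qed.

Let v0 : (0 <= v)%R.
Proof.
have [_ _ /(_ 0%N) h _] := HX; rewrite -lee_fin -h.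
by apply: integral_ge0 => w _; rewrite lee_fin sqr_ge0.
Qed.

Let mean_cmod k : \int[P]_w (cmod (X k w))%:E <= (1 + v)%:E.
Proof.
have mc := measurable_cmod (cX k).
apply: (@le_trans _ _ (\int[P]_w (1 + (cmod (X k w) ^+ 2)%:E))).
  apply: ge0_le_integral => //.
  - by move=> w _; rewrite lee_fin cmod_ge0.
  - exact/measurable_EFinP.
  - by apply: emeasurable_funD => //; apply/measurable_EFinP/measurable_funX.
  move=> w _; rewrite -EFinD lee_fin.
  by have := sqr_ge0 (cmod (X k w) - 2^-1)%R; rewrite sqrrB => h; lra.
rewrite ge0_integralD//; last 2 first.
- by move=> w _; rewrite lee_fin sqr_ge0.
- by apply/measurable_EFinP/measurable_funX.
have [_ _ -> _] := HX.
rewrite EFinD; apply: leeD => //; rewrite (integral_cst P measurableT 1) mul1e.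
exact: probability_le1.
Qed.

Let summable_ae (s : R) : (0 <= s < 1)%R ->
  {ae P, forall w, summable_at (fun k => X k w * a k)%R s}.
Proof.
move=> hs; have s0 : (0 <= s)%R by case/andP: hs.
pose f k w := (cmod (X k w * a k) * s ^+ k)%:E.
have f0 k w : 0 <= f k w by rewrite lee_fin mulr_ge0 ?cmod_ge0 ?exprn_ge0.
have mf k : measurable_fun setT (f k).
  apply/measurable_EFinP; apply: measurable_funM => //; apply: measurable_cmod.
  by apply: cmeasM => //; exact: cmeas_cst.
pose F w := \sum_(k <oo) f k w.
have F0 w : 0 <= F w by apply: nneseries_ge0.
have mF : measurable_fun setT F by exact: ge0_emeasurable_sum.
have IF : \int[P]_w F w < +oo.
  rewrite /F integral_nneseries//.
  apply: (@le_lt_trans _ _ (\sum_(k <oo) (1 + v)%:E * (cmod (a k) * s ^+ k)%:E)).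
    apply: lee_nneseries => [k _ _|k _]; first exact: integral_ge0.
    rewrite /f; under eq_integral do rewrite cmodM -mulrA EFinM.
    rewrite ge0_integralZr//; last 3 first.
    - exact/measurable_EFinP/measurable_cmod.
    - by move=> w _; rewrite lee_fin cmod_ge0.
    - by rewrite lee_fin mulr_ge0 ?cmod_ge0 ?exprn_ge0.
    by apply: lee_wpmul2r => //; rewrite lee_fin mulr_ge0 ?cmod_ge0 ?exprn_ge0.
  rewrite nneseriesZl; last by move=> k _; rewrite lee_fin mulr_ge0 ?cmod_ge0 ?exprn_ge0.
  rewrite (_ : (fun n => _) = EFin \o series (fun k => cmod (a k) * s ^+ k)%R); last first.
    by apply/funext => n; rewrite /= sumEFin.
  by rewrite EFin_lim; [rewrite -EFinM ltry|exact: ha].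
have iF : P.-integrable setT F.
  apply/integrableP; split => //.
  by under eq_integral do rewrite gee0_abs//.
apply: filterS (integrable_ae measurableT iF) => w /(_ I) hF.
apply: nondecreasing_is_cvgn.
  by apply: nondecreasing_series => k _ _; rewrite mulr_ge0 ?cmod_ge0 ?exprn_ge0.
exists (fine (F w)) => _ [n _ <-]; rewrite -lee_fin fineK//.
have := @nneseries_lim_ge R (fun k => f k w) xpredT 0%N n (fun k _ _ => f0 k w).
by rewrite /f sumEFin.
Qed.

(** The variables have bounded first moments, so that for each radius the expected sum
    of the moduli is finite; a sequence of radii increasing to 1 yields one event of
    probability 1 on which all of them are admissible. *)
Lemma random_coefficients_summable : exists W : set T,
  [/\ measurable W, P (~` W) = 0 & forall w, W w -> forall s : R, (0 <= s < 1)%R ->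
    summable_at (fun k => X k w * a k)%R s].
Proof.
pose r m : R := (1 - m.+1%:R^-1)%R.
have r01 m : (0 <= r m < 1)%R.
  by rewrite /r subr_ge0 invf_le1 ?ler1n//= gtrBl invr_gt0.
have [N [mN PN hN]] := ae_foralln (fun m => summable_ae (r01 m)).
exists (~` N); split; [exact: measurableC|by rewrite setCK|].
move=> w Nw s /andP[s0 s1]; apply: (@summable_le _ _ _ (r (Num.truncn (1 - s)^-1))).
  rewrite s0 /= /r lerBrDl -lerBrDr ltW//.
  by rewrite invf_plt ?posrE ?subr_gt0// truncnS_gt.
by apply: contrapT => h; apply: Nw; apply: hN => /(_ (Num.truncn (1 - s)^-1)).
Qed.

End GoodSet.

(** Cutting off by E before taking limits yields functions that are measurable on the
    whole space. *)
Lemma measurable_limit_modulus (R : realType) d (Y : measurableType d)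
    (t : nat -> Y -> R[i]) (S : Y -> R[i]) (E : set Y) :
  (forall k, cmeas (t k)) -> measurable E ->
  (forall y, E y -> (fun n => \sum_(k < n) t k y : R[i]^o) @ \oo --> (S y : R[i]^o)) ->
  measurable_fun setT (fun y => cmod (S y) * \1_E y).
Proof.
move=> mt mE hS.
apply: (measurable_fun_cvg (h := fun n y => cmod (\sum_(k < n) t k y) * \1_E y)).
  move=> n; apply: measurable_funM; last exact: measurable_indic.
  by apply: measurable_cmod; exact: cmeas_sum_ord.
move=> y _; rewrite indicE; case: (boolP (y \in E)) => yE; last first.
  by rewrite mulr0; under eq_fun do rewrite mulr0; exact: cvg_cst.
by apply: cvgM; [apply: cvg_cmod; apply: hS; rewrite inE in yE|exact: cvg_cst].
Qed.

(** * The mixed norm as a radial integral *)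

Section MixedNorm.
Context {R : realType}.
Variables (a : nat -> R[i]) (f : R[i] -> R[i]) (q alpha : R).
Hypotheses (fa : power_series_on f 0 1 a) (q0 : 0 < q).
Local Notation leb := (@lebesgue_measure R).
Local Notation RR := (measurableTypeR R).
Local Open Scope ereal_scope.

Let ha : forall s : R, (0 <= s < 1)%R -> summable_at a s := power_series_summable fa.

(** Immediate from parseval; the constants 1/2 and 1 stem from its factor 2. *)
Lemma integral_mean_profile (r : R) : (0 <= r < 1)%R ->
  (profile a r / 2)%:E <= integral_mean 2 r f <= (profile a r)%:E.
Proof.
move=> /[dup] hr /andP[r0 r1].
have [h1 h2] := parseval r0 (ha hr).
have pi2 : (0 < 2 * pi :> R)%R by rewrite mulr_gt0 ?pi_gt0.
rewrite /integral_mean (_ : \int[_]_(t in _) _ =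
  \int[leb]_(t in `[0%R, (2 * pi)%R]) (cmod (psum a (r%:C%C * expi t)%R) ^+ 2)%:E); last first.
  apply: eq_integral => t _; rewrite powR_mulrn ?cmod_ge0//; congr (cmod _ ^+ 2)%:E.
  have /(power_series_psum _ _ ha) h := fa.
  by rewrite h subr0// cmod_circle.
set I := (\int[leb]_(t in _) _) in h1 h2 *.
have p2 := profile_sqr ha hr; have p0 := profile_ge0 a r.
have I0 : 0 <= I by apply: integral_ge0 => t _; rewrite lee_fin sqr_ge0.
case: I I0 h1 h2 => [y| |]// y0 h1 h2; rewrite -EFinM poweR_EFin !lee_fin.
rewrite -p2 lee_fin in h1; rewrite -p2 -EFinM lee_fin in h2; rewrite lee_fin in y0.
have e (x : R) : (0 <= x)%R -> ((x ^+ 2) `^ 2^-1 = x)%R.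
  by move=> x0; rewrite -powR_mulrn// -powRrM mulfV// powRr1.
have hy : (0 <= (2 * pi)^-1 * y)%R by rewrite mulr_ge0// invr_ge0 ltW.
apply/andP; split.
- rewrite -[leLHS]e ?divr_ge0//; apply: ge0_ler_powR; rewrite ?nnegrE ?sqr_ge0//.
  rewrite [leRHS]mulrC ler_pdivlMr// expr_div_n.
  have A0 := sqr_ge0 (profile a r); move: h2 A0; set A := (profile a r ^+ 2)%R => h2 A0.
  have : (0 <= 2 * pi * A)%R by rewrite mulr_ge0// ltW.
  by lra.
- rewrite -[leRHS]e//; apply: ge0_ler_powR; rewrite ?nnegrE ?sqr_ge0//.
  by rewrite mulrC ler_pdivrMr// mulrC.
Qed.

(** The exponent ((alpha + 2) / q) q - 1 equals alpha + 1, which is the exponent found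
    for the tent integrals. *)
Lemma mixed_norm_radial : mixed_norm 2 q ((alpha + 2) / q) f < +oo <->
  radial_int (fun r => profile a r `^ q)%R alpha < +oo.
Proof.
have qn : q != 0%R by rewrite gt_eqF.
have qi : (q^-1 != 0)%R by rewrite invr_eq0.
have -> : mixed_norm 2 q ((alpha + 2) / q) f < +oo <->
    \int[leb]_(r in `]0%R, 1%R[)
      (integral_mean 2 r f `^ q * ((1 - r) `^ (alpha + 1))%:E) < +oo.
  rewrite /mixed_norm (_ : (alpha + 2) / q * q - 1 = alpha + 1)%R; last by field.
  by split=> [/(lty_poweRy qi)|/(poweR_lty q^-1)].
pose E := [set x : RR * RR | (0 < x.1 < 1)%R].
have mE : measurable E.
  have := measurableX (measurable_itv `]0%R, 1%R[ : measurable (_ : set RR)) (@measurableT _ RR).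
  by congr measurable; apply/seteqP; split => x; rewrite /E /= in_itv /=; [case|].
pose H (x : RR * RR) := (cmod (f (x.1%:C%C * expi x.2)%R) * \1_E x)%R.
have mH : measurable_fun setT H.
  apply: (@measurable_limit_modulus R _ (RR * RR)%type
    (fun k x => a k * (x.1%:C%C * expi x.2) ^+ k)%R (fun x => f (x.1%:C%C * expi x.2)%R) E) => //.
    move=> k; apply: cmeasM; first exact: cmeas_cst.
    apply: cmeasX; apply: cmeasM.
      by split => /=; [exact: measurable_fst|exact: measurable_cst].
    by apply: (cmeas_comp (h := snd) (f := @expi R)); [exact: measurable_snd|exact: cmeas_expi].
  move=> x /andP[x0 x1]; have /(_ (x.1%:C%C * expi x.2)%R) := fa.
  by rewrite subr0 cmod_circle ?(ltW x0)//; exact.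
pose M (r : RR) := ((2 * pi)^-1%:E * \int[leb]_(t in `[0%R, (2 * pi)%R]) (H (r, t) ^+ 2)%:E) `^ 2^-1.
have mM : measurable_fun setT M.
  apply: (measurableT_comp (measurable_poweR 2^-1)); apply: measurable_funeM.
  apply: (measurable_integral_in leb (f := fun x => (H x ^+ 2)%:E)) => //.
  - by apply/measurable_EFinP/measurable_funX.
  - by move=> x; rewrite lee_fin sqr_ge0.
have ME r : (0 < r < 1)%R -> integral_mean 2 r f = M r.
  move=> hr; rewrite /integral_mean /M; congr (poweR (_ * _) _); apply: eq_integral => t _.
  by rewrite powR_mulrn ?cmod_ge0// /H indicE mem_set// mulr1.
have mw (e : R) : measurable_fun setT (fun r : RR => (1 - r) `^ e)%R.
  by apply: (measurableT_comp (measurable_powR e)); exact: measurable_funB.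
have mp : measurable_fun setT (fun r : RR => profile a r `^ q)%R.
  by apply: (measurableT_comp (measurable_powR q)); exact: measurable_profile.
have mI : measurable_fun (`]0%R, 1%R[%classic : set RR) (fun r : RR => integral_mean 2 r f `^ q * ((1 - r) `^ (alpha + 1))%:E).
  apply: (@eq_measurable_fun _ _ _ _ _ (fun r => M r `^ q * ((1 - r) `^ (alpha + 1))%:E)).
    by move=> r; rewrite inE /= in_itv /= => hr; rewrite ME.
  apply: measurable_funTS; apply: emeasurable_funM; last exact/measurable_EFinP.
  exact: (measurableT_comp (measurable_poweR q)).
have pw (x y : \bar R) : 0 <= x -> x <= y -> x `^ q <= y `^ q.
  move=> x0 xy; apply: gt0_ler_poweR; rewrite ?in_itv ?(ltW q0)//= leey andbT//.
  exact: le_trans xy.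
have mean0 r : 0 <= integral_mean 2 r f by exact: poweR_ge0.
split => fin.
- apply: (@le_lt_trans _ _ ((2 `^ q)%:E * \int[leb]_(r in `]0%R, 1%R[)
      (integral_mean 2 r f `^ q * ((1 - r) `^ (alpha + 1))%:E))); last first.
    by apply: lte_mul_pinfty; rewrite ?lee_fin ?powR_ge0.
  rewrite -ge0_integralZl ?lee_fin ?powR_ge0//; last first.
    by move=> r _; rewrite mule_ge0 ?poweR_ge0// lee_fin powR_ge0.
  apply: ge0_le_integral => //.
  - by move=> r _; rewrite lee_fin mulr_ge0 ?powR_ge0.
  - by apply/measurable_EFinP/measurable_funTS; exact: measurable_funM.
  - exact: measurable_funeM.
  move=> r; rewrite /= in_itv /= => /andP[r0 r1]; rewrite muleA EFinM.
  apply: lee_wpmul2r; first by rewrite lee_fin powR_ge0.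
  have hr : (0 <= r < 1)%R by rewrite r1 ltW.
  have /andP[h _] := integral_mean_profile hr.
  have p0 := profile_ge0 a r.
  apply: (@le_trans _ _ ((2 `^ q)%:E * (profile a r / 2)%:E `^ q)).
    rewrite poweR_EFin -EFinM lee_fin -powRM ?divr_ge0//.
    by rewrite mulrC divfK.
  apply: lee_wpmul2l; first by rewrite lee_fin powR_ge0.
  by apply: pw => //; rewrite lee_fin divr_ge0.
- apply: le_lt_trans fin; apply: ge0_le_integral => //.
  - by move=> r _; rewrite mule_ge0 ?poweR_ge0// lee_fin powR_ge0.
  - by apply/measurable_EFinP/measurable_funTS; exact: measurable_funM.
  move=> r; rewrite /= in_itv /= => /andP[r0 r1]; rewrite EFinM.
  apply: lee_wpmul2r; first by rewrite lee_fin powR_ge0.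
  have hr : (0 <= r < 1)%R by rewrite r1 ltW.
  have /andP[_ h] := integral_mean_profile hr.
  by rewrite -poweR_EFin; apply: pw.
Qed.

End MixedNorm.

(** * Tent norms of random power series *)

(** Fubini for the indicator of N, whose double integral vanishes in either order. *)
Lemma ae_section_swap (R : realType) d1 (T1 : measurableType d1) d2 (T2 : measurableType d2)
    (m1 : {sigma_finite_measure set T1 -> \bar R})
    (m2 : {sigma_finite_measure set T2 -> \bar R})
    (N : set (T1 * T2)) (A : set T1) (D : set T2) :
  measurable N -> measurable A -> measurable D ->
  {ae m1, forall x, A x -> {ae m2, forall y, D y -> ~ N (x, y)}} ->
  {ae m2, forall y, D y -> {ae m1, forall x, A x -> ~ N (x, y)}}.
Proof.
move=> mN mA mD h; pose f (z : T1 * T2) : \bar R := (\1_N z)%:E.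
have mf : measurable_fun setT f by apply/measurable_EFinP; exact: measurable_indic.
have f0 z : (0 <= f z)%E by rewrite lee_fin.
have fN z : f z = 0%E <-> ~ N z.
  rewrite /f indicE; split=> [[/eqP]|Nz]; last by rewrite memNset.
  by case: (boolP (z \in N)) => [|/negP h1 _ h2]; rewrite ?oner_eq0//; apply: h1; rewrite inE.
have zero d (Y : measurableType d) (mu : {measure set Y -> \bar R}) (B : set Y) (g : Y -> \bar R) :
    measurable B -> measurable_fun B g -> (forall y, (0 <= g y)%E) ->
    (\int[mu]_(y in B) g y = 0)%E <-> {ae mu, forall y, B y -> g y = 0%E}.
  move=> mB mg g0; have e := ae_eq_integral_abs mu mB mg.
  by rewrite (_ : \int[mu]_(y in B) `|g y| = \int[mu]_(y in B) g y)%E in e;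
    [exact: e|apply: eq_integral => y _; rewrite gee0_abs].
have m1x y : measurable_fun A (fun x => f (x, y)).
  by apply: measurable_funTS; exact: measurableT_comp mf (pair2_measurable y).
have m2y x : measurable_fun D (fun y => f (x, y)).
  by apply: measurable_funTS; exact: measurableT_comp mf (pair1_measurable x).
have mS : measurable_fun setT (fun y => \int[m1]_(x in A) f (x, y))%E.
  apply: (measurable_integral_in m1 (f := fun z : T2 * T1 => f (z.2, z.1))) => //.
  exact: (measurableT_comp mf (@measurable_swap _ _ T2 T1)).
have : (\int[m2]_(y in D) \int[m1]_(x in A) f (x, y) = 0)%E.
  rewrite -(fubini_rectangle m1 m2 mf f0 mA mD).
  apply/zero => //.
  - exact/measurable_funTS/(measurable_integral_in m2 mf f0 mD).
  - by move=> x; exact: integral_ge0.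
  apply: filterS h => x hx Ax; apply/zero => //.
  by apply: filterS (hx Ax) => y hy Dy; apply/fN; exact: hy.
move=> /zero; move=> /(_ mD (measurable_funTS mS) (fun y => integral_ge0 _ (fun x _ => f0 (x, y)))).
apply: filterS => y hy Dy; have := (zero _ _ m1 A _ mA (m1x y) (fun x => f0 (x, y))).1 (hy Dy).
by apply: filterS => x hx Ax; apply/fN; exact: hx.
Qed.

(** Only the angles 0, pi and 2 pi are excluded, where the factorization of rotations
    into shears degenerates. *)
Lemma sin_neq0_ae (R : realType) :
  {ae @lebesgue_measure R, forall t : measurableTypeR R,
    `[0%R, (2 * pi)%R]%classic t -> sin t != 0}.
Proof.
exists [set 0; pi; 2 * pi]; split.
- by apply: measurableU; [apply: measurableU|]; exact: measurable_set1.
- by apply: countable_lebesgue_measure0; apply: finite_set_countable; exact: finite_set3.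
move=> t; apply: contra_notP => ht; rewrite /= in_itv /= => /andP[t0 t1].
have [[/eqP n0 /eqP n1] /eqP n2] : (t <> 0 /\ t <> pi) /\ t <> 2 * pi.
  by split; [split|] => e; apply: ht; [left; left|left; right|right].
case: (ltrP t pi) => tpi.
  by rewrite gt_eqF// sin_gt0_pi// tpi lt_def n0 t0.
have : 0 < sin (t - pi).
  apply: sin_gt0_pi; rewrite subr_gt0 lt_def n1 tpi /=.
  by rewrite ltrBlDr (_ : pi + pi = 2 * pi); [rewrite lt_neqAle n2|ring].
by rewrite sinB sinpi cospi mulr0 subr0 mulrN1 oppr_gt0 => /lt_eqF ->.
Qed.

Section Area.
Context {R : realType}.
Local Notation leb := (@lebesgue_measure R).
Local Notation RR := (measurableTypeR R).

(** Planar Lebesgue measure under a name of its own, to which its sigma-finiteness is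
    attached. *)
Definition area : set (RR * RR) -> \bar R := (leb \x leb)%E.

HB.instance Definition _ := Measure.on area.

Let area_sigma_finite : sigma_finite setT area.
Proof.
have /sigma_finiteP[F [TF ndF Foo]] := sigma_finiteT leb.
exists (fun n => F n `*` F n).
  rewrite -setXTT {1}TF TF predeqE => -[x y]; split.
    move=> [/= [n _ Fnx] [k _ Gky]]; exists (maxn n k) => //; split.
    - by move: x Fnx; exact/subsetPset/ndF/leq_maxl.
    - by move: y Gky; exact/subsetPset/ndF/leq_maxr.
  by move=> [n _ []/= ? ?]; split; exists n.
move=> k; have [? ?] := Foo k.
split; first exact: measurableX.
by rewrite /area product_measure1E// lte_mul_pinfty// ge0_fin_numE.
Qed.

HB.instance Definition _ := Measure_isSigmaFinite.Build _ _ _ area area_sigma_finite.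

End Area.

Section RandomTent.
Context {R : realType} d (T : measurableType d) (P : probability T R).
Variables (X : nat -> T -> R[i]) (v : R) (a : nat -> R[i]) (p q alpha : R).
Hypotheses (HX : subgaussian_sequence P X v) (v0 : 0 < v) (p0 : 0 < p) (q0 : 0 < q)
  (ha : forall s : R, 0 <= s < 1 -> summable_at a s).
Variable W : set T.
Hypotheses (mW : measurable W) (PW : P (~` W) = 0%E)
  (hW : forall w, W w -> forall s : R, 0 <= s < 1 ->
    summable_at (fun k => X k w * a k) s).
Local Notation leb := (@lebesgue_measure R).
Local Notation RR := (measurableTypeR R).
Local Notation U := (RR * RR)%type.
Local Notation leb2 := (leb \x leb)%E.

Let cX k : cmeas (X k). Proof. by apply: cmeas_rv; case: HX. Qed.

Let cvg_randomization w z : W w -> cmod z < 1 ->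
  (fun n => \sum_(k < n) X k w * a k * z ^+ k : R[i]^o) @ \oo -->
  (randomization X a w z : R[i]^o).
Proof.
move=> Ww z1; have hz : 0 <= cmod z < 1 by rewrite cmod_ge0.
exact: (cvg_psum (hW Ww hz)).
Qed.

Let disk : set U := [set u | cmod (of_cpair u) < 1].

Let mcm : measurable_fun setT (fun u : U => cmod (of_cpair u)).
Proof. by apply: measurable_cmod; exact: cmeas_of_cpair. Qed.

Let mdisk : measurable disk.
Proof. by apply: (measurable_ltset (g := cst 1) mcm). Qed.

(** On the set W x disk the partial sums converge, so that the product with the indicator
    is jointly measurable. *)
Definition random_field (x : T * U) : R :=
  cmod (randomization X a x.1 (of_cpair x.2)) * \1_(W `*` disk) x.

Lemma measurable_random_field : measurable_fun setT random_field.
Proof.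
apply: (@measurable_limit_modulus R _ (T * U)%type
  (fun k x => X k x.1 * a k * of_cpair x.2 ^+ k)
  (fun x => randomization X a x.1 (of_cpair x.2)) (W `*` disk)).
- move=> k; apply: cmeasM; first apply: cmeasM; last 2 first.
  + exact: cmeas_cst.
  + apply: cmeasX; apply: (cmeas_comp (h := snd) (f := fun u : U => of_cpair u)).
      exact: measurable_snd.
    exact: cmeas_of_cpair.
  by apply: (cmeas_comp (h := fst) (f := X k)); [exact: measurable_fst|exact: cX].
- exact: measurableX.
- by move=> x [Wx dx]; exact: cvg_randomization.
Qed.

Lemma random_field_ge0 x : 0 <= random_field x.
Proof. by rewrite mulr_ge0 ?cmod_ge0. Qed.

Lemma random_fieldE w u : W w -> cmod (of_cpair u) < 1 ->
  random_field (w, u) = cmod (randomization X a w (of_cpair u)).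
Proof. by move=> Ww hu; rewrite /random_field indicE mem_set ?mulr1. Qed.

Let field_out w u : 1 <= cmod (of_cpair u) -> random_field (w, u) = 0.
Proof.
move=> hu; rewrite /random_field indicE memNset ?mulr0//= => -[_].
by rewrite /disk /= ltNge hu.
Qed.

Let sg (u : U) : R := profile a (cmod (of_cpair u)).

Let cvg_field u w : W w -> cmod (of_cpair u) < 1 ->
  (fun n => \sum_(k < n) (a k * of_cpair u ^+ k) * X k w : R[i]^o) @ \oo -->
  (randomization X a w (of_cpair u) : R[i]^o).
Proof.
move=> Ww hu; have := cvg_randomization Ww hu.
rewrite (_ : (fun n => _) = fun n => \sum_(k < n) a k * of_cpair u ^+ k * X k w : R[i]^o)//.
by apply/funext => n; apply: eq_bigr => k _; ring.
Qed.

Lemma random_field_second_moment u :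
  ((v / 2 * sg u ^+ 2)%:E <= \int[P]_(w in W) (random_field (w, u) ^+ 2)%:E)%E.
Proof.
case: (ltrP (cmod (of_cpair u)) 1) => hu; last first.
  rewrite /sg profile_out// expr0n mulr0; apply: integral_ge0 => w _.
  by rewrite lee_fin sqr_ge0.
have hr : 0 <= cmod (of_cpair u) < 1 by rewrite cmod_ge0.
rewrite (_ : \int[P]_(w in W) _ =
  \int[P]_(w in W) (cmod (randomization X a w (of_cpair u)) ^+ 2)%:E)%E; last first.
  by apply: eq_integral => w; rewrite inE => Ww; rewrite random_fieldE.
rewrite /sg profile_sqr// (_ : v / 2 * _ = 2^-1 * (v * sig2 a (cmod (of_cpair u)))); last by ring.
rewrite EFinM lee_pdivrMl//.
apply: (random_series_second_moment HX v0 mW PW (b := fun k => a k * of_cpair u ^+ k)).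
  by move=> w Ww; exact: cvg_field.
under eq_fun do under eq_bigr do rewrite cmodM cmodX.
exact: (summable_nonneg_cvg (ha hr) (cmod_ge0 _)).
Qed.

Lemma random_field_exp_moment u :
  (\int[P]_(w in W) (expR (random_field (w, u) / sg u))%:E <= (2 * expR 8)%:E)%E.
Proof.
case: (ltrP (cmod (of_cpair u)) 1) => hu; last first.
  rewrite (_ : \int[P]_(w in W) _ = \int[P]_(w in W) cst 1 w)%E; last first.
    by apply: eq_integral => w _; rewrite field_out// mul0r expR0.
  rewrite integral_cst// mul1e; apply: le_trans (probability_le1 P mW) _.
  rewrite lee_fin; have : 1 <= expR 8 :> R by rewrite -expR0 ler_expR.
  lra.
have hr : 0 <= cmod (of_cpair u) < 1 by rewrite cmod_ge0.
rewrite (_ : \int[P]_(w in W) _ = \int[P]_(w in W)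
  (expR (cmod (randomization X a w (of_cpair u)) / sg u))%:E)%E; last first.
  by apply: eq_integral => w; rewrite inE => Ww; rewrite random_fieldE.
apply: (random_series_exp_moment HX (b := fun k => a k * of_cpair u ^+ k) mW).
- by move=> w Ww; exact: cvg_field.
- exact: profile_ge0.
move=> n; rewrite /sg profile_sqr//; apply: le_trans (sig2_partial ha n hr).
by rewrite big_mkord; under eq_bigr do rewrite cmodM cmodX.
Qed.

(** A vanishing profile at a radius r means that all a_k r^k vanish, hence also every
    term of the random series there. *)
Lemma random_field_null u : sg u = 0 -> forall w, random_field (w, u) = 0.
Proof.
move=> su w; case: (ltrP (cmod (of_cpair u)) 1) => hu; last exact: field_out.
have hr : 0 <= cmod (of_cpair u) < 1 by rewrite cmod_ge0.
have [Ww|Ww] := pselect (W w); last first.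
  by rewrite /random_field indicE memNset ?mulr0//= => -[].
have az k : a k * of_cpair u ^+ k = 0.
  apply/eqP; rewrite -cmod_eq0 -sqrf_eq0 eq_le sqr_ge0 andbT cmodM cmodX.
  have := sig2_term_le k (cmod_ge0 (of_cpair u)) (ha hr).
  by rewrite -profile_sqr// -/(sg u) su expr0n.
rewrite random_fieldE//; apply/eqP; rewrite cmod_eq0; apply/eqP.
apply: cvgC_unique (cvg_field Ww hu) _.
under eq_fun do under eq_bigr do rewrite az mul0r.
under eq_fun do rewrite big1//.
exact: cvg_cst.
Qed.

Let wt (u : U) : R := (1 - cmod (of_cpair u) ^+ 2) `^ alpha.

Let mwt : measurable_fun setT wt.
Proof.
apply: (measurableT_comp (measurable_powR alpha)).
by apply: measurable_funB => //; exact: measurable_funX.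
Qed.

Let wt0 u : 0 <= wt u. Proof. exact: powR_ge0. Qed.

Let msg : measurable_fun setT sg.
Proof. by apply: measurableT_comp mcm; exact: measurable_profile. Qed.

Let sg0 u : 0 <= sg u. Proof. exact: profile_ge0. Qed.

Let C0 : 0 < 2 * expR 8 :> R. Proof. by rewrite mulr_gt0 ?expR_gt0. Qed.

Let m0 : 0 < v / 2. Proof. by rewrite divr_gt0. Qed.

Definition tent_mass (t : R) (w : T) : \bar R :=
  field_mass area q random_field wt (tent_set t) w.

Let tent_massE t w : W w -> tent_mass t w =
  (\int[leb2]_(u in [set u | tent_region (expi t) (of_cpair u)])
    (cmod (randomization X a w (of_cpair u)) `^ q
      * (1 - cmod (of_cpair u) ^+ 2) `^ alpha)%:E)%E.
Proof.
move=> Ww; apply: eq_integral => u; rewrite inE => -[hu _].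
by rewrite random_fieldE.
Qed.

Let tent_normpE w : W w -> tent_normp p q alpha (randomization X a w) =
  (\int[leb]_(t in `[0%R, (2 * pi)%R]) (tent_mass t w `^ (p / q)))%E.
Proof. by move=> Ww; apply: eq_integral => t _; rewrite tent_massE. Qed.

Let h r : R := profile a r `^ q.

Let mh : measurable_fun setT h.
Proof. by apply: (measurableT_comp (measurable_powR q)); exact: measurable_profile. Qed.

Let h0 r : 0 <= h r. Proof. exact: powR_ge0. Qed.

Let hmono r s : 0 <= r -> r <= s -> s < 1 -> h r <= h s.
Proof.
move=> r0 rs s1; apply: ge0_ler_powR; rewrite ?nnegrE ?profile_ge0 ?(ltW q0)//.
exact: profile_mono.
Qed.

Let measurable_tent_mass : measurable_fun setT (fun x : T * RR => tent_mass x.2 x.1).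
Proof.
pose f (y : (T * RR) * U) := (random_field (y.1.1, y.2) `^ q * wt y.2)%:E.
pose B := [set y : (T * RR) * U | tent_set y.1.2 y.2].
apply: (measurable_section_integral area (f := f) _ _ (B := B)).
- apply/measurable_EFinP; apply: measurable_funM; last exact: measurableT_comp.
  apply: (measurableT_comp (measurable_powR q)).
  apply: (measurableT_comp measurable_random_field).
  apply: measurable_fun_pair; last exact: measurable_snd.
  exact: measurableT_comp.
- by move=> y; rewrite lee_fin mulr_ge0 ?powR_ge0.
have mr : measurable_fun setT (fun y : (T * RR) * U => (y.1.2, y.2)).
  by apply: measurable_fun_pair; [exact: measurableT_comp|exact: measurable_snd].
by have := mr measurableT _ measurable_tent_set_joint; rewrite setTI.
Qed.

Let measurable_tent_mass_t w : measurable_fun setT (fun t : RR => tent_mass t w).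
Proof. exact: measurableT_comp measurable_tent_mass (pair1_measurable w). Qed.

Let ae_W : {ae P, forall w, W w}.
Proof. by exists (~` W); split => //; exact: measurableC. Qed.

(** Almost surely, almost all tents have finite mass; exchanging the quantifiers gives
    one tent, at an angle t in ]0, pi[, whose mass is almost surely finite.
    field_mass_necessary then applies to it, and tent_int_radial concludes. *)
Lemma random_tent_necessary :
  {ae P, forall w, (tent_normp p q alpha (randomization X a w) < +oo)%E} ->
  (radial_int h alpha < +oo)%E.
Proof.
move=> fin; pose N := [set x : T * RR | (+oo <= tent_mass x.2 x.1)%E].
have mN : measurable N.
  have := measurable_tent_mass measurableT (emeasurable_itv `[+oo%E, +oo[).
  by rewrite setTI; congr measurable; apply/seteqP; split => x; rewrite /N /= in_itv /= andbT.
(* on this interval the sine is positive, so that the weighted area of the tent does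
   not depend on the angle *)
pose D : set RR := `]0%R, pi[%classic.
have mD : measurable D by exact: measurable_itv.
have pq : p / q != 0 by rewrite gt_eqF// divr_gt0.
have h1 : {ae P, forall w, W w -> {ae leb, forall t, D t -> ~ N (w, t)}}.
  apply: filterS fin => w fw Ww; rewrite tent_normpE// in fw.
  pose I : set RR := `[0%R, (2 * pi)%R]%classic.
  have mI : measurable I by exact: measurable_itv.
  have iI : leb.-integrable I (fun t => tent_mass t w `^ (p / q))%E.
    apply/integrableP; split.
      by apply/measurable_funTS/(measurableT_comp (measurable_poweR (p / q))).
    by under eq_integral do rewrite gee0_abs ?poweR_ge0//.
  apply: filterS (integrable_ae mI iI) => t ht; rewrite /D /= in_itv /= => /andP[t0 t1].
  rewrite /N /= leye_eq => /eqP e.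
  have : (tent_mass t w < +oo)%E.
    apply: (lty_poweRy pq); rewrite ltey_eq; apply/orP; left; apply: ht.
    by rewrite /I /= in_itv /= (ltW t0) (le_trans (ltW t1))// mulr_natl mulr2n lerDl pi_ge0.
  by rewrite e.
have h2 := ae_section_swap mN mW mD h1.
have [t tD ht] : exists2 t, D t & {ae P, forall w, W w -> ~ N (w, t)}.
  apply: contrapT => /forall2NP hn.
  have D0 : leb D = 0%E.
    apply/negligibleP => //; apply: negligibleS h2 => t tD /(_ tD) ht.
    by case: (hn t).
  have := @lebesgue_measure_itv R `]0, pi[; rewrite /= lte_fin pi_gt0 sube0 => Dpi.
  have [/eqP] := etrans (esym D0) Dpi.
  by rewrite eq_sym gt_eqF// pi_gt0.
have s0 : sin t != 0 by rewrite gt_eqF// sin_gt0_pi//; move: tD; rewrite /D /= in_itv.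
apply/(tent_int_radial alpha mh h0 hmono s0).
apply: (@field_mass_necessary R _ T P _ U area q W random_field sg wt _ _ q0 mW
  measurable_random_field random_field_ge0 msg sg0 mwt wt0 m0 C0
  random_field_second_moment random_field_exp_moment (tent_set t)) => //.
- exact: measurable_tent_set.
- by apply: filterS ht => w hw /hw hn; rewrite ltNge; exact/negP.
Qed.

(** All tents have the same weighted area V, so that field_mass_sufficient bounds the
    expected (p / q)-th powers of the masses uniformly in the angle. *)
Lemma random_tent_sufficient : (radial_int h alpha < +oo)%E ->
  {ae P, forall w, (tent_normp p q alpha (randomization X a w) < +oo)%E}.
Proof.
move=> /(tent_int_lty mh h0 hmono) fin.
have V0 : (0 <= tent_int h alpha 0)%E.
  by apply: integral_ge0 => u _; rewrite lee_fin weight_ge0.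
have pq : 0 < p / q by rewrite divr_gt0.
have [c c0 hc] := @field_mass_sufficient R _ T P _ U area q W random_field sg wt _ q0 mW
  measurable_random_field random_field_ge0 msg sg0 mwt wt0 C0
  random_field_exp_moment random_field_null _ pq.
pose V := fine (tent_int h alpha 0).
have VE : tent_int h alpha 0 = V%:E by rewrite fineK// ge0_fin_numE.
have VR : 0 <= V by exact: fine_ge0.
pose K := ((V + 1) `^ (p / q) * (c * V + 1)).
have K0 : 0 <= K by rewrite mulr_ge0 ?powR_ge0// addr_ge0// mulr_ge0.
pose D : set RR := `[0%R, (2 * pi)%R]%classic.
have mD : measurable D by exact: measurable_itv.
pose F (x : T * RR) := (tent_mass x.2 x.1 `^ (p / q))%E.
have mF : measurable_fun setT F by exact: (measurableT_comp (measurable_poweR (p / q))).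
have F0 x : (0 <= F x)%E by exact: poweR_ge0.
have Ifin : (\int[P]_(w in W) \int[leb]_(t in D) F (w, t) < +oo)%E.
  rewrite (fubini_rectangle P leb mF F0 mW mD).
  apply: (@le_lt_trans _ _ (\int[leb]_(t in D) cst K%:E t)%E).
    apply: ae_ge0_le_integral => //.
    - by move=> t _; exact: integral_ge0.
    - apply: measurable_funTS.
      have mFs := measurableT_comp mF (@measurable_swap _ _ RR T).
      exact: (@measurable_integral_in R _ RR _ T P (fun x => F (x.2, x.1)) mFs
        (fun x => F0 (x.2, x.1)) W mW).
    have hK (t : RR) : sin t != 0 -> (\int[P]_(w in W) F (w, t) <= K%:E)%E.
      move=> st; have hV : (tent_int h alpha t <= V%:E)%E.
        by rewrite -VE (tent_int_rotation alpha mh h0 st).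
      exact: (hc (tent_set t) V (measurable_tent_set t) VR hV).
    by apply: filterS (sin_neq0_ae R) => t ht tD; exact: hK (ht tD).
  rewrite integral_cst//; apply: lte_mul_pinfty; rewrite ?lee_fin//.
  have := @lebesgue_measure_itv R `[0, 2 * pi]; rewrite /= lte_fin => DE.
  by have : (leb D < +oo)%E by apply: (@eq_ind_r _ _ (fun z => z < +oo)%E _ _ DE); case: ifP => _; rewrite ?sube0 ltry.
have mJ : measurable_fun W (fun w => \int[leb]_(t in D) F (w, t))%E.
  by apply: measurable_funTS; exact: (measurable_integral_in leb mF F0 mD).
have iJ : P.-integrable W (fun w => \int[leb]_(t in D) F (w, t))%E.
  apply/integrableP; split => //.
  by under eq_integral do rewrite gee0_abs ?integral_ge0//.
apply: filterS2 ae_W (integrable_ae mW iJ) => w Ww /(_ Ww) hw.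
by rewrite tent_normpE// ltey_eq hw.
Qed.

End RandomTent.

(** * The symbol space *)

Theorem theorem1p9 (R : realType) (d : measure_display) (T : measurableType d)
    (P : probability T R) (X : nat -> T -> R[i]) (p q alpha : R) :
  0 < p -> 0 < q -> -2 < alpha ->
  standard_random_sequence P X ->
  symbol_space P X (tent_space p q alpha) =
  mixed_norm_space 2 q ((alpha + 2) / q).
Proof.
move=> p0 q0 _ /standard_subgaussian[v v0 HX].
apply/seteqP; split => f.
- move=> [fan [a [fa fin]]]; split => //.
  have ha := power_series_summable fa.
  have [W [mW PW hW]] := random_coefficients_summable HX ha.
  apply/(mixed_norm_radial alpha fa q0).
  apply: (random_tent_necessary HX v0 p0 q0 ha mW PW hW).
  by apply: filterS fin => w [].
- move=> [fan fin]; split => //; have [a fa] := analytic_power_series fan.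
  exists a; split => //; have ha := power_series_summable fa.
  have [W [mW PW hW]] := random_coefficients_summable HX ha.
  move/(mixed_norm_radial alpha fa q0) : fin => fin.
  have tn := random_tent_sufficient HX p0 q0 ha mW PW hW fin.
  have aeW : {ae P, forall w, W w} by exists (~` W); split => //; exact: measurableC.
  apply: filterS2 aeW tn => w Ww tw; split; last exact: tw.
  exact: (psum_analytic (hW w Ww)).
Qed.
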